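(* Let $t_2(m,n)$ denote the number of $2$-threshold functions on the grid $\mathcal{G}_{m,n}=\{0,\dots,m-1\}\times\{0,\dots,n-1\}$. Then, as $\min(m,n)\to\infty$, $$t_2(m,n)=\frac{25}{12\pi^4}\,m^4n^4+o(m^4n^4).$$
   Context: For positive integers $m,n$ let $\mathcal{G}_{m,n}=\{0,\dots,m-1\}\times\{0,\dots,n-1\}\subset\mathbb{Z}^2$. For $f:\mathcal{G}_{m,n}\to\{0,1\}$ and $\nu\in\{0,1\}$ let $M_\nu(f)=\{x\in\mathcal{G}_{m,n}: f(x)=\nu\}$. The function $f$ is threshold if $\mathrm{Conv}(M_0(f))\cap\mathrm{Conv}(M_1(f))=\emptyset$, where $\mathrm{Conv}$ is the convex hull in $\mathbb{R}^2$ (with $\mathrm{Conv}(\emptyset)=\emptyset$, so constant functions are threshold). The function $f$ is $k$-threshold if there exist at most $k$ threshold functions on $\mathcal{G}_{m,n}$ such that $M_1(f)$ is the intersection of their sets $M_1(\cdot)$. *)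

(* Defs.v *)
From HB Require Import structures.
From mathcomp Require Import all_boot all_order all_algebra.
From mathcomp Require Import all_classical all_reals all_analysis.
Set Implicit Arguments.
Unset Strict Implicit.
Unset Printing Implicit Defensive.
Import Order.TTheory GRing.Theory Num.Theory.
Import numFieldNormedType.Exports.

Local Open Scope classical_set_scope.
Local Open Scope ring_scope.

Notation grid m n := ('I_m * 'I_n)%type.

(* Functions grid -> {0, 1}, with true as 1 and false as 0. *)
Notation grid_fun m n := {ffun grid m n -> bool}.

Definition level_set (m n : nat) (nu : bool) (f : grid_fun m n)
  : {set grid m n} := [set x | f x == nu]%SET.

Definition conv_hull (R : numDomainType) (E : lmodType R)
  (A : set (convex_lmodType E)) : set (convex_lmodType E) :=
  smallest (@convex_set R E) A.

Definition grid_point (R : numDomainType) (m n : nat) (x : grid m n)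
  : R^o * R^o := ((x.1 : nat)%:R, (x.2 : nat)%:R).

Definition grid_hull (R : numDomainType) (m n : nat) (A : {set grid m n})
  : set (convex_lmodType (R^o * R^o)%type) :=
  conv_hull (@grid_point R m n @` [set` A]).
Arguments grid_hull R {m n} A.

Definition threshold (R : realType) (m n : nat) (f : grid_fun m n) : Prop :=
  grid_hull R (level_set false f) `&` grid_hull R (level_set true f) = set0.

Definition k_threshold (R : realType) (k m n : nat) (f : grid_fun m n) : Prop :=
  exists S : {set grid_fun m n},
    [/\ (#|S| <= k)%N,
        forall g, g \in S -> threshold R g
      & level_set true f = (\bigcap_(g in S) level_set true g)%SET].

Definition num_k_threshold (R : realType) (k m n : nat) : nat :=
  #|[set f : grid_fun m n | `[< k_threshold R k f >]]%SET|.

(* Main.v *)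
Require Import Defs.
From HB Require Import structures.
From mathcomp Require Import all_boot all_order all_algebra.
From mathcomp Require Import zify ring lra.
From mathcomp Require Import all_classical all_reals all_analysis.
From mathcomp Require Import fintype finset.
Set Implicit Arguments.
Unset Strict Implicit.
Unset Printing Implicit Defensive.
Import Order.TTheory GRing.Theory Num.Theory.
Import numFieldNormedType.Exports.
Local Open Scope ring_scope.

(** A nonconstant threshold function is determined by a coprime pair [(a, b)] of grid
points: tilt an inner common tangent of the two hulls about a point strictly between
[a] and [b].  Choosing the tangents extremally, a 2-threshold set that has two zeros no
half-plane can cut off together is the wedge of two opposite coprime edges [a b], [c d]
of a (weakly) convex quadrilateral [a b c d].  If the set contains a border point of the
grid, then the normals separating it from a given zero form an interval of a line; Helly's
theorem on the line provides the two zeros, and the absence of induced 4-cycles in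
interval graphs makes the pair of edges unique.  Two half-planes whose nonempty
intersection misses the border have boundary lines crossing the same gap between
neighbouring border points, which is rare.

So twice the number sought is asymptotically the number of convex quadrilaterals with
two opposite coprime edges.  Convexity cuts every row and column of the grid in an
interval, hence divisibility of an edge by [d] has density [1 / d ^ 2], and a sieve
turns this into a factor [6 / pi ^ 2] for each of the two edges.  Following Valtr, a
generic quadruple of vectors of sum zero has exactly one convex cyclic order, and the
number of translates of the resulting polygon inside the grid is a product of a function
of the abscissas and one of the ordinates; this gives [(5 / 6) ^ 2 / 6] times
[m ^ 4 n ^ 4] convex quadrilaterals. *)

(** * Tangents of separable grid sets *)

(** A border point cuts the circle of normals open: the outward normal there separates the set from
    no zero. Without such a point the normals form arcs of a circle, where three pairwise meeting
    arcs may have no common point and chordless 4-cycles do occur; this is why sets missing the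
    border are bounded separately. Separation is expressed over the integers. By Caratheodory, a
    finite set of vectors lies in an open half-plane as soon as no three of them satisfy a
    nontrivial nonnegative relation, and such a relation among differences is precisely a common
    point of two hulls. The factor 5/6 belongs to one coordinate: over all triples of steps, those
    whose first two steps have equal signs contribute about [m ^ 4 / 3], those with opposite signs
    about [m ^ 4 / 2]. The final constant is half of [(6 / pi ^ 2) ^ 2 * 25 / 216].
    Inclusion-exclusion up to a level L multiplies errors of relative size [1 / m + 1 / n] by
    [2 ^ L]. The levels are therefore fixed before the grid grows, and the level of the outer sieve
    before that of the inner one. *)

Definition det (u v : int * int) : int := u.1 * v.2 - u.2 * v.1.

Lemma det_anti u v : det v u = - det u v.
Proof. by rewrite /det; ring. Qed.

Definition dot (u v : int * int) : int := u.1 * v.1 + u.2 * v.2.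
Definition vec (a b : int * int) : int * int := (b.1 - a.1, b.2 - a.2).
Definition orient (a b x : int * int) : int := det (vec a b) (vec a x).

(* The discrete half-plane cut out by the line [ab] turned infinitesimally
   about a point strictly between [a] and [b], so that [a] is in and [b] out. *)
Definition side (a b x : int * int) : bool :=
  (0 < orient a b x) || (orient a b x == 0) && (dot (vec a b) (vec a x) <= 0).

(** On a [pos_free] set this is a total preorder: [v] has the direction of [u] or is reached from it
    by a counterclockwise turn of less than half a circle. *)
Definition cw (u v : int * int) : bool :=
  (0 < det u v) || (det u v == 0) && (0 < dot u v).

(** Three vectors suffice in the plane by Caratheodory: for finite [D] this means that some linear
    form is positive on [D]. *)
Definition pos_free (D : int * int -> Prop) : Prop :=
  forall u v w, D u -> D v -> D w -> forall i j k : int,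
    0 <= i -> 0 <= j -> 0 <= k ->
    i * u.1 + j * v.1 + k * w.1 = 0 -> i * u.2 + j * v.2 + k * w.2 = 0 ->
    [/\ i = 0, j = 0 & k = 0].

Lemma pos_free_neq0 (D : int * int -> Prop) u : pos_free D -> D u -> 0 < dot u u.
Proof.
move=> nD Du; rewrite ltNge; apply/negP => H.
have u10 : u.1 = 0 by move: H; rewrite /dot; nia.
have u20 : u.2 = 0 by move: H; rewrite /dot; nia.
by have [] := nD _ _ _ Du Du Du 1 0 0 isT isT isT; rewrite ?u10 ?u20.
Qed.

(** Incomparable vectors would point in opposite directions, and [dot v v * u - dot u v * v = 0]
    would be a forbidden relation. *)
Lemma cw_total (D : int * int -> Prop) u v : pos_free D -> D u -> D v ->
  cw u v || cw v u.
Proof.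
move=> nD Du Dv; apply/negPn/negP; rewrite negb_or => /andP[].
have := pos_free_neq0 nD Du; have := pos_free_neq0 nD Dv.
move=> vv uu; have dC := det_anti u v.
have dotC : dot v u = dot u v by rewrite /dot; ring.
rewrite /cw dC dotC => H1 H2.
have det0 : det u v = 0 by lia.
have dot0 : dot u v <= 0 by lia.
have E1 : dot v v * u.1 + - dot u v * v.1 + 0 * v.1 = det u v * v.2 by rewrite /dot /det; ring.
have E2 : dot v v * u.2 + - dot u v * v.2 + 0 * v.2 = - (det u v) * v.1 by rewrite /dot /det; ring.
have [] := nD _ _ _ Du Dv Dv (dot v v) (- dot u v) 0; rewrite ?E1 ?E2 ?det0; lia.
Qed.

(** If transitivity failed, the three vectors would turn around cyclically, so that Cramer's
    identity [det v w * u - det u w * v + det u v * w = 0] has nonnegative coefficients. They all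
    vanish, and the signs of the dot products of parallel vectors clash. *)
Lemma cw_trans (D : int * int -> Prop) u v w : pos_free D -> D u -> D v -> D w ->
  cw u v -> cw v w -> cw u w.
Proof.
move=> nD Du Dv Dw uv vw.
apply/negPn/negP => Nuw.
have := cw_total nD Du Dw; rewrite (negPf Nuw) /= => wu.
have vv := pos_free_neq0 nD Dv.
have dC := det_anti u w.
have dotC : dot w u = dot u w by rewrite /dot; ring.
move: uv vw wu Nuw; rewrite /cw dC dotC => uv vw wu Nuw.
have E1 : det v w * u.1 + - det u w * v.1 + det u v * w.1 = 0 by rewrite /det; ring.
have E2 : det v w * u.2 + - det u w * v.2 + det u v * w.2 = 0 by rewrite /det; ring.
have [] := nD _ _ _ Du Dv Dw (det v w) (- det u w) (det u v); [lia|lia|lia|done|done|].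
move=> d1 d2 d3.
have E : dot u v * dot v w = dot u w * dot v v + det u v * det v w by rewrite /dot /det; ring.
have p1 : 0 < dot u v by lia.
have p2 : 0 < dot v w by lia.
have p3 : dot u w <= 0 by lia.
have := mulr_gt0 p1 p2; rewrite E d1 mulr0 addr0.
have := mulr_le0_ge0 p3 (ltW vv); lia.
Qed.

Lemma extreme (D : int * int -> Prop) (s : seq (int * int)) :
  pos_free D -> (forall u, u \in s -> D u) -> s != [::] ->
  exists2 e, e \in s & forall u, u \in s -> cw u e.
Proof.
move=> nD; elim: s => // x s IH sD _.
have Dx : D x by apply: sD; rewrite inE eqxx.
have xx : cw x x.
  have := pos_free_neq0 nD Dx; rewrite /cw.
  have -> : det x x = 0 by rewrite /det; ring.
  lia.
case: (s =P [::]) => [-> | /eqP sN].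
  by exists x; [rewrite inE | move=> u; rewrite inE => /eqP->].
have [u us | e es He] := IH _ sN; first by apply: sD; rewrite inE us orbT.
have De : D e by apply: sD; rewrite inE es orbT.
have /orP[xe|ex] := cw_total nD Dx De.
  exists e; first by rewrite inE es orbT.
  by move=> u; rewrite inE => /predU1P[->|/He].
exists x; first by rewrite inE eqxx.
move=> u; rewrite inE => /predU1P[->//|us].
apply: (cw_trans nD _ De Dx (He u us) ex); apply: sD; by rewrite inE us orbT.
Qed.

Lemma pos_free_pos (D : int * int -> Prop) (n : int * int) :
  (forall u, D u -> 0 < dot n u) -> pos_free D.
Proof.
move=> pD u v w /pD pu /pD pv /pD pw i j k i0 j0 k0 E1 E2.
have E : i * dot n u + j * dot n v + k * dot n w = 0.
  transitivity (n.1 * (i * u.1 + j * v.1 + k * w.1) + n.2 * (i * u.2 + j * v.2 + k * w.2)).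
    by rewrite /dot; ring.
  by rewrite E1 E2; ring.
move: E pu pv pw; move: (dot n u) (dot n v) (dot n w) => x y z E px py pz.
by split; nia.
Qed.

Definition pt (m n : nat) (x : grid m n) : int * int :=
  ((x.1 : nat)%:Z, (x.2 : nat)%:Z).

Lemma pt_inj m n : injective (@pt m n).
Proof. by move=> [a b] [c d] [/val_inj -> /val_inj ->]. Qed.

Definition coprime_pair (a b : int * int) : bool :=
  coprime `|b.1 - a.1| `|b.2 - a.2|.

Lemma step_between (a b q g m : int) : 0 <= a -> a < m -> 0 <= b -> b < m ->
  b - a = q * g -> 1 < g -> 0 <= a + q /\ a + q < m.
Proof. by move=> *; case: (lerP 0 q) => ?; split; nia. Qed.

Section Tangent.
Variables (m n : nat).
Implicit Types (W Z : {set grid m n}).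

Definition diffs W Z (u : int * int) : Prop :=
  exists w z, [/\ w \in W, z \in Z & u = vec (pt w) (pt z)].

Lemma shorter (d e : int * int) : det d e = 0 -> 0 < dot d e ->
  dot d e < dot d d -> dot e e < dot d e.
Proof.
move=> d0 de dd.
have E : dot e e * dot d d = dot d e * dot d e + det d e * det d e.
  by rewrite /dot /det; ring.
move: E; rewrite d0 mulr0 addr0.
move: (dot d d) (dot e e) (dot d e) de dd => x y z; nia.
Qed.

(** The most counterclockwise difference from [W] to [Z] directs an inner common tangent, with [W]
    weakly on its left and [Z] weakly on its right. The shortest such difference makes [a] the last
    point of [W] and [b] the first point of [Z] along the tangent, so tilting separates the points
    on it too. The betweenness hypothesis is what turns shortest into coprime. *)
Lemma tangent W Z : W != set0 -> Z != set0 -> pos_free (diffs W Z) ->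
  (forall (a b x : grid m n) (k l : int), a \in W -> b \in Z -> 0 < k -> 0 < l ->
    (k + l) * (pt x).1 = k * (pt a).1 + l * (pt b).1 ->
    (k + l) * (pt x).2 = k * (pt a).2 + l * (pt b).2 -> x \in W :|: Z) ->
  exists a b, [/\ a \in W, b \in Z, coprime_pair (pt a) (pt b),
    forall x, x \in W -> side (pt a) (pt b) (pt x) &
    forall x, x \in Z -> ~~ side (pt a) (pt b) (pt x)].
Proof.
move=> /set0Pn[w1 w1W] /set0Pn[z1 z1Z] nD btw.
pose P (p : grid m n * grid m n) := (p.1 \in W) && (p.2 \in Z).
pose f (p : grid m n * grid m n) := vec (pt p.1) (pt p.2).
have fD p : P p -> diffs W Z (f p) by case: p => w z /andP[wW zZ]; exists w, z.
have [u | | e es He] := extreme (D := diffs W Z) (s := [seq f p | p <- enum P]) nD.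
- by case/mapP=> p; rewrite mem_enum => /fD + ->.
- rewrite -size_eq0 size_map -cardE -lt0n; apply/card_gt0P; exists (w1, z1).
  by apply/andP.
case/mapP: es => p0; rewrite mem_enum => Pp0 e0.
have Hp p : P p -> cw (f p) (f p0).
  by move=> Pp; rewrite -e0; apply: He; apply: map_f; rewrite mem_enum.
(* Since [f p0] is extreme, [Q] selects the pairs with exactly its direction; the shortest of them
   is taken next. *)
pose Q p := P p && cw (f p0) (f p).
have Q0 : Q p0 by apply/andP; split=> //; exact: Hp.
case: (arg_minnP (fun p => `|dot (f p) (f p)|%N) Q0) => -[a b] /andP[Pab cab] mn_.
have Hab p : P p -> cw (f p) (f (a, b)).
  move=> Pp; apply: (cw_trans nD _ _ _ (Hp _ Pp) cab); exact: fD.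
have pos p : P p -> 0 < dot (f p) (f p) by move=> /fD; apply: pos_free_neq0.
have Hmin p : P p -> cw (f (a, b)) (f p) -> dot (f (a, b)) (f (a, b)) <= dot (f p) (f p).
  move=> Pp cp; have Qp : Q p.
    rewrite /Q Pp; apply: (cw_trans nD _ _ _ cab cp); exact: fD.
  by have := mn_ _ Qp; have := pos _ Pp; have := pos _ Pab; clear; lia.
have /andP[/= aW bZ] := Pab.
set d := f (a, b) in Hab Hmin *.
have dd := pos _ Pab; rewrite -/d in dd.
have keyW w : w \in W -> 0 <= det d (vec (pt a) (pt w)) /\
    (det d (vec (pt a) (pt w)) = 0 -> dot d (vec (pt a) (pt w)) <= 0).
  move=> wW; have Pw : P (w, b) by rewrite /P /= wW.
  have := Hab _ Pw; have Hm := Hmin _ Pw.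
  have E : det (f (w, b)) d = det d (vec (pt a) (pt w)).
    by rewrite /d /f /vec /det /=; ring.
  have E2 : dot (f (w, b)) d = dot d d - dot d (vec (pt a) (pt w)).
    by rewrite /d /f /vec /dot /=; ring.
  have E3 : dot (f (w, b)) (f (w, b)) = dot d d - 2 * dot d (vec (pt a) (pt w)) +
      dot (vec (pt a) (pt w)) (vec (pt a) (pt w)).
    by rewrite /d /f /vec /dot /=; ring.
  have E4 : det d (f (w, b)) = - det d (vec (pt a) (pt w)).
    by rewrite /d /f /vec /det /=; ring.
  have E5 : dot d (f (w, b)) = dot d d - dot d (vec (pt a) (pt w)).
    by rewrite /d /f /vec /dot /=; ring.
  move: Hm; rewrite /cw E E2 E3 E4 E5 => Hm Hc; split; first by move: Hc; clear; lia.
  move=> d0; rewrite leNgt; apply/negP => dp.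
  have := @shorter d (vec (pt a) (pt w)) d0 dp; move: Hm Hc; rewrite d0; clear -dp; lia.
have keyZ z : z \in Z -> det d (vec (pt a) (pt z)) <= 0 /\
    (det d (vec (pt a) (pt z)) = 0 -> 0 < dot d (vec (pt a) (pt z))).
  move=> zZ; have Pz : P (a, z) by rewrite /P /= aW.
  have := Hab _ Pz.
  have -> : f (a, z) = vec (pt a) (pt z) by [].
  have E : det (vec (pt a) (pt z)) d = - det d (vec (pt a) (pt z)).
    by rewrite /det; ring.
  have E2 : dot (vec (pt a) (pt z)) d = dot d (vec (pt a) (pt z)) by rewrite /dot; ring.
  by rewrite /cw E E2; clear; move: (det _ _) (dot _ _) => u v; split; lia.
have sideE x : side (pt a) (pt b) x = (0 < det d (vec (pt a) x)) ||
    (det d (vec (pt a) x) == 0) && (dot d (vec (pt a) x) <= 0) by [].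
exists a, b; split => //; last 2 first.
- move=> x /keyW[]; rewrite sideE; clear; case: (ltrgt0P (det d _)) => //= d0 _; exact.
- move=> x /keyZ[]; rewrite sideE; clear; case: (ltrgt0P (det d _)) => //= d0 _ h.
  by rewrite -ltNge; apply: h.
(* If the gcd were not 1, a lattice point between [a] and [b] would give a shorter pair. *)
rewrite /coprime_pair /coprime; apply/negPn/negP => g1.
set g := gcdn _ _ in g1.
have g0 : (0 < g)%N.
  rewrite gcdn_gt0; apply/negPn/negP; rewrite negb_or -!eqn0Ngt !absz_eq0.
  by case/andP=> /eqP E1 /eqP E2; move: dd; rewrite /dot /d /f /vec E1 E2.
have [q1 E1] : exists q : int, (pt b).1 - (pt a).1 = q * g%:Z.
  have : (g%:Z %| (pt b).1 - (pt a).1)%Z by rewrite dvdzE /= dvdn_gcdl.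
  by case/dvdzP=> q ->; exists q.
have [q2 E2] : exists q : int, (pt b).2 - (pt a).2 = q * g%:Z.
  have : (g%:Z %| (pt b).2 - (pt a).2)%Z by rewrite dvdzE /= dvdn_gcdr.
  by case/dvdzP=> q ->; exists q.
have gz : 1 < g%:Z by rewrite ltz_nat ltn_neqAle eq_sym g1.
have [l1 u1] := @step_between (pt a).1 (pt b).1 q1 g%:Z m isT (ltn_ord a.1) isT (ltn_ord b.1) E1 gz.
have [l2 u2] := @step_between (pt a).2 (pt b).2 q2 g%:Z n isT (ltn_ord a.2) isT (ltn_ord b.2) E2 gz.
have lt1 : (`|((pt a).1 + q1)%R| < m)%N by rewrite -ltz_nat gez0_abs.
have lt2 : (`|((pt a).2 + q2)%R| < n)%N by rewrite -ltz_nat gez0_abs.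
pose x : grid m n := (Ordinal lt1, Ordinal lt2).
have x1 : (pt x).1 = (pt a).1 + q1 by rewrite /x /pt /= gez0_abs.
have x2 : (pt x).2 = (pt a).2 + q2 by rewrite /x /pt /= gez0_abs.
have vax : vec (pt a) (pt x) = (q1, q2) by rewrite /vec x1 x2; congr (_, _); ring.
have dE : d = (q1 * g%:Z, q2 * g%:Z) by rewrite /d /f /vec /= -E1 -E2.
have qq : 0 < dot (q1, q2) (q1, q2) by move: dd; rewrite dE /dot /=; nia.
have D0 : det d (vec (pt a) (pt x)) = 0 by rewrite vax dE /det /=; ring.
have D1 : dot d (vec (pt a) (pt x)) = g%:Z * dot (q1, q2) (q1, q2).
  by rewrite vax dE /dot /=; ring.
have : x \in W :|: Z.
  apply: (btw a b x (g%:Z - 1) 1); rewrite // ?subr_gt0 //.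
    by rewrite x1 -(subrK (pt a).1 (pt b).1) E1; ring.
  by rewrite x2 -(subrK (pt a).2 (pt b).2) E2; ring.
rewrite inE => /orP[xW|xZ].
  have [_ /(_ D0)] := keyW _ xW; rewrite D1 leNgt mulr_gt0 //; exact: lt_trans gz.
have Px : P (a, x) by rewrite /P /= aW.
have := Hmin _ Px; rewrite -[f (a, x)]/(vec (pt a) (pt x)) /cw D0 D1 eqxx ltxx /=.
rewrite vax dE mulr_gt0 ?(lt_trans _ gz) // => /(_ isT); apply/negP.
have -> : dot (q1 * g%:Z, q2 * g%:Z) (q1 * g%:Z, q2 * g%:Z) = g%:Z * g%:Z * dot (q1, q2) (q1, q2).
  by rewrite /dot /=; ring.
by rewrite -ltNge ltr_pMl // mulr_egt1.
Qed.

End Tangent.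

Lemma side_start a b : side a b a.
Proof.
have E1 : orient a b a = 0 by rewrite /orient /det /=; ring.
have E2 : dot (vec a b) (vec a a) = 0 by rewrite /dot /=; ring.
by rewrite /side E1 E2.
Qed.

Lemma side_end a b : a != b -> ~~ side a b b.
Proof.
move=> ab; have E1 : orient a b b = 0 by rewrite /orient /det; ring.
rewrite /side E1 /= -ltNge /dot -!expr2 lt_neqAle addr_ge0 ?sqr_ge0 // andbT eq_sym.
rewrite paddr_eq0 ?sqr_ge0 // !sqrf_eq0 !subr_eq0; apply: contra ab.
by case: a b E1 => [? ?] [? ?] /= _ /andP[/eqP-> /eqP->].
Qed.

(** * Half-planes of the grid *)

Section Lin.
Variables m n : nat.
Implicit Types (T W Z : {set grid m n}) (a b x : grid m n).

Definition lin T : Prop :=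
  exists (v : int * int) (c : int), forall x, (x \in T) = (dot v (pt x) <= c).

Definition half a b : {set grid m n} := [set x | side (pt a) (pt b) (pt x)].

Lemma mem_half a b x : (x \in half a b) = side (pt a) (pt b) (pt x).
Proof. by rewrite inE. Qed.

Lemma dot_vec_bound a b x : dot (vec (pt a) (pt b)) (vec (pt a) (pt x)) <= (m ^ 2 + n ^ 2)%N%:Z
   /\ - (m ^ 2 + n ^ 2)%N%:Z <= dot (vec (pt a) (pt b)) (vec (pt a) (pt x)).
Proof.
have key (M : nat) (i j k : 'I_M) : `|(j%:Z - i%:Z) * (k%:Z - i%:Z)| <= (M ^ 2)%N%:Z.
  rewrite normrM -mulnn PoszM; apply: ler_pM => //.
    by move: (ltn_ord i) (ltn_ord j); lia.
  by move: (ltn_ord i) (ltn_ord k); lia.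
have := key _ a.1 b.1 x.1; have := key _ a.2 b.2 x.2.
by rewrite !ler_norml /dot /= PoszD; lia.
Qed.

(** [side] compares [orient] first and breaks ties by [dot]. As [orient] is an integer, giving it a
    weight [K] larger than every possible [dot] turns this lexicographic test into a single linear
    one. *)
Lemma half_lin a b : lin (half a b).
Proof.
pose K := (m ^ 2 + n ^ 2)%N%:Z + 1.
pose d := vec (pt a) (pt b).
exists (d.1 + K * d.2, d.2 - K * d.1), (dot (d.1 + K * d.2, d.2 - K * d.1) (pt a)) => x.
rewrite mem_half.
have E : dot (d.1 + K * d.2, d.2 - K * d.1) (pt x) =
   dot d (vec (pt a) (pt x)) - K * orient (pt a) (pt b) (pt x) +
    dot (d.1 + K * d.2, d.2 - K * d.1) (pt a).
  by rewrite /orient /det /dot /d /=; ring.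
rewrite E -lerBrDr subrr /side -/d.
have := dot_vec_bound a b x; rewrite -/d.
move: (dot d _) (orient _ _ _) => u v; rewrite /K; clear.
move: (_ ^ _ + _)%N => K [h1 h2].
case: (ltrgt0P v) => [v0|v0|-> /=]; last by rewrite mulr0 subr0.
  rewrite /=; apply/esym; nia.
by apply/esym/negbTE; rewrite -ltNge; nia.
Qed.

Lemma lin_set0 : lin set0.
Proof. by exists (0, 0), (-1) => x; rewrite inE /dot /= !mul0r. Qed.

Lemma lin_setT : lin setT.
Proof. by exists (0, 0), 0 => x; rewrite inE /dot /= !mul0r. Qed.

Lemma lin_between T a b x (k l : int) : lin T -> a \in T -> b \in T ->
  0 < k -> 0 < l ->
  (k + l) * (pt x).1 = k * (pt a).1 + l * (pt b).1 ->
  (k + l) * (pt x).2 = k * (pt a).2 + l * (pt b).2 -> x \in T.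
Proof.
case=> v [c Tv]; rewrite !Tv => ha hb k0 l0 E1 E2.
have E : (k + l) * dot v (pt x) = k * dot v (pt a) + l * dot v (pt b).
  transitivity (v.1 * ((k + l) * (pt x).1) + v.2 * ((k + l) * (pt x).2)).
    by rewrite /dot; ring.
  by rewrite E1 E2 /dot; ring.
by move: E ha hb; move: (dot v _) (dot v _) (dot v _) => *; nia.
Qed.

Lemma pos_free_diffs W Z T : lin T -> W \subset T -> [disjoint Z & T] -> pos_free (diffs W Z).
Proof.
case=> v [c Tv] /fintype.subsetP WT ZT; apply: (pos_free_pos (n := v)) => u [w [z [wW zZ ->]]].
have := WT _ wW; have := disjointFr ZT zZ; rewrite !Tv /dot /vec /=; lia.
Qed.

(** [T1] only has to cut off the zeros inside [T2]. Convexity of [T2] supplies the betweenness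
    hypothesis of [tangent] for the sets [T1 :&: T2] and [T2 :\: T1]. *)
Lemma tangent_lin T1 T2 : lin T1 -> lin T2 -> T1 :&: T2 != set0 -> T2 :\: T1 != set0 ->
  exists a b, [/\ a \in T1 :&: T2, b \in T2, b \notin half a b,
    coprime_pair (pt a) (pt b) & half a b :&: T2 = T1 :&: T2].
Proof.
move=> l1 l2 W0 Z0.
have nd : pos_free (diffs (T1 :&: T2) (T2 :\: T1)).
  apply: (pos_free_diffs l1); first exact: subsetIl.
  by rewrite -setI_eq0; apply/eqP/setP=> x; rewrite !inE; case: (x \in T1); rewrite ?andbF.
have [|a [b [aW bZ cp HW HZ]]] := tangent W0 Z0 nd.
  move=> a b x k l aW bZ k0 l0 E1 E2; rewrite !inE.
  have -> : x \in T2.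
    apply: (lin_between l2 _ _ k0 l0 E1 E2).
      by move: aW; rewrite inE => /andP[].
    by move: bZ; rewrite inE => /andP[].
  by case: (x \in T1).
exists a, b; split => //.
- by move: bZ; rewrite inE => /andP[].
- by rewrite mem_half; apply: HZ.
apply/setP=> x; rewrite !in_setI mem_half.
case: (boolP (x \in T2)) => xT2; last by rewrite !andbF.
rewrite !andbT; case: (boolP (x \in T1)) => xT1.
  by rewrite HW // inE xT1.
by apply/negbTE/HZ; rewrite inE xT1.
Qed.

Lemma lin_half T : lin T -> T != set0 -> T != setT ->
  exists a b, coprime_pair (pt a) (pt b) /\ T = half a b.
Proof.
move=> lT T0 TT; have [|| a [b [_ _ _ cp]]] := tangent_lin lT lin_setT.
- by rewrite setIT.
- by rewrite setTD; apply: contra TT => /eqP E; rewrite -[T]setCK E setC0.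
by rewrite !setIT => <-; exists a, b.
Qed.

End Lin.

Lemma det_side (a b a' b' : int * int) : side a b a' -> ~~ side a b b' ->
  det (vec a b) (vec a' b') <= 0.
Proof.
have -> : det (vec a b) (vec a' b') = orient a b b' - orient a b a'.
  by rewrite /orient /det /=; ring.
by rewrite /side; lia.
Qed.

(* Each segment turns weakly clockwise to the other, so both lie on one line. *)
Lemma rigid (a b a' b' : int * int) : coprime_pair a b -> coprime_pair a' b' ->
  side a b a' -> ~~ side a b b' -> 0 <= det (vec a b) (vec a' b') ->
  a' = a /\ b' = b.
Proof.
move=> cp cp' sa sb dd; have := det_side sa sb.
have E : det (vec a b) (vec a' b') = orient a b b' - orient a b a'.
  by rewrite /orient /det /=; ring.
have oa : orient a b a' = 0 by move: sa sb dd; rewrite E /side; lia.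
have ob : orient a b b' = 0 by move: sa sb dd; rewrite E /side; lia.
move: sa sb; rewrite /side oa ob /= -ltNge => sa sb _.
have para x : orient a b x = 0 -> exists k : int,
    x.1 - a.1 = k * (b.1 - a.1) /\ x.2 - a.2 = k * (b.2 - a.2).
  rewrite /orient /det /= => /eqP; rewrite subr_eq0 => /eqP ox.
  have cz : coprimez (b.1 - a.1) (b.2 - a.2) by [].
  have d1 : ((b.1 - a.1) %| (x.1 - a.1))%Z.
    by rewrite -(Gauss_dvdzr _ cz) -ox dvdz_mulr.
  have d2 : ((b.2 - a.2) %| (x.2 - a.2))%Z.
    by rewrite coprimez_sym in cz; rewrite -(Gauss_dvdzr _ cz) ox dvdz_mulr.
  case/dvdzP: d1 => k1 e1; case/dvdzP: d2 => k2 e2.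
  case: (eqVneq (b.1 - a.1) 0) => [b10|b1].
    by exists k2; rewrite e2 e1 b10 !mulr0.
  exists k1; split=> //; apply: (mulfI b1); rewrite ox e1; ring.
have [k [k1 k2]] := para _ oa; have [l [l1 l2]] := para _ ob.
pose N := dot (vec a b) (vec a b).
have ea : dot (vec a b) (vec a a') = k * N by rewrite /dot /N /dot /= k1 k2; ring.
have eb : dot (vec a b) (vec a b') = l * N by rewrite /dot /N /dot /= l1 l2; ring.
move: sa sb; rewrite ea eb.
have N0 : 0 <= N by rewrite /N /dot; nia.
move=> sa sb; have lp : 0 < l by nia.
have kn : k <= 0 by nia.
have v1 : b'.1 - a'.1 = (l - k) * (b.1 - a.1).
  by rewrite mulrBl -k1 -l1; ring.
have v2 : b'.2 - a'.2 = (l - k) * (b.2 - a.2).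
  by rewrite mulrBl -k2 -l2; ring.
(* [vec a' b'] is [l - k] times [vec a b], and it is itself primitive. Together with [k <= 0 < l]
   this leaves only [k = 0] and [l = 1]. *)
have g1 : `|l - k| = 1.
  move: cp'; rewrite /coprime_pair v1 v2 !abszM /coprime -muln_gcdr muln_eq1.
  by case/andP=> /eqP; lia.
have k0 : k = 0 by lia.
have l1' : l = 1 by lia.
move: k1 k2 l1 l2; rewrite k0 l1' !mul0r !mul1r.
case: a b a' b' {cp cp' dd oa ob para ea eb N N0 sa sb v1 v2 E} => [? ?] [? ?] [? ?] [? ?] /=.
by move=> *; split; congr (_, _); lia.
Qed.

(** * Cones of normals on a slit plane *)

Definition off_slit (p : int * int) : Prop := p.1 = 0 -> 0 < p.2.

(* Convex cones of integer vectors avoiding the ray of [(0, -1)]. *)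
Definition slit_cone (P : int * int -> Prop) : Prop :=
  (forall u, P u -> off_slit u) /\
  (forall u v x (i j k : int), P u -> P v -> 0 <= i -> 0 <= j -> 0 < i + j -> 0 < k ->
     k * x.1 = i * u.1 + j * v.1 -> k * x.2 = i * u.2 + j * v.2 -> P x).

(* Counterclockwise angular order starting from the ray of [(0, -1)]. *)
Definition ang (p q : int * int) : bool :=
  if 0 < p.1 then (q.1 <= 0) || (0 <= det p q)
  else if p.1 == 0 then q.1 <= 0 else (q.1 < 0) && (0 <= det p q).

Lemma ang_total p q : ang p q || ang q p.
Proof.
have := det_anti p q.
rewrite /ang => ->; case: (ltrgt0P p.1) => _; case: (ltrgt0P q.1) => _ //=; lia.
Qed.

Lemma ang_trans p q r : off_slit q -> ang p q -> ang q r -> ang p r.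
Proof.
have E1 : q.1 * det p r = r.1 * det p q + p.1 * det q r by rewrite /det; ring.
rewrite /off_slit /ang; move: E1; move: (det _ _) (det _ _) (det _ _) => u v w.
case: p q r => [p1 p2] [q1 q2] [r1 r2] /= E1.
case: (ltrgt0P p1) => p10; case: (ltrgt0P q1) => q10; case: (ltrgt0P r1) => //= r10 _; rewrite ?andbF //=.
  by move=> *; nia.
by move=> *; nia.
Qed.

(** The delicate case has [p] and [q] on different sides of the vertical axis: their combination on
    that axis is [(0, det p q)], which must avoid the slit, so [det p q] is positive. Cramer's rule
    then writes [x] as a nonnegative combination of [p] and [q]. *)
Lemma ang_between P p x q : slit_cone P -> off_slit x -> P p -> P q ->
  ang p x -> ang x q -> P x.
Proof.
case=> Pp Pc px Hp Hq a1 a2.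
have gp := Pp _ Hp; have gq := Pp _ Hq.
have E1 : det p q * x.1 = det x q * p.1 + det p x * q.1 by rewrite /det; ring.
have E2 : det p q * x.2 = det x q * p.2 + det p x * q.2 by rewrite /det; ring.
have opp : 0 < p.1 -> q.1 < 0 -> 0 < det p q.
  move=> p1 q1; have /Pp : P (0, det p q); last exact.
  apply: (Pc p q _ (- q.1) p.1 1 Hp Hq) => //=; rewrite ?oppr_ge0 ?(ltW p1) ?(ltW q1) ?addr_gt0 ?oppr_gt0 //.
    by rewrite mulr0; ring.
  by rewrite /det; ring.
have gen : 0 < det p q -> 0 <= det x q -> 0 <= det p x -> P x.
  move=> d1 d2 d3; apply: (Pc p q x _ _ _ Hp Hq d2 d3 _ d1 E1 E2).
  rewrite lt_def addr_ge0 // andbT; apply/eqP => s0.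
  have x10 : det x q = 0 by lia.
  have x20 : det p x = 0 by lia.
  move: E1 E2; rewrite x10 x20 !mul0r addr0 => /eqP; rewrite mulf_eq0 gt_eqF //= => /eqP x1.
  by move/eqP; rewrite mulf_eq0 gt_eqF //= => /eqP x2; have := px x1; rewrite x2.
have par : det p x = 0 -> 0 < p.1 * x.1 -> P x.
  move=> d0 px1; have d1 : p.1 * x.2 = p.2 * x.1 by move: d0; rewrite /det; lia.
  apply: (Pc p p x (x.1 * x.1) 0 (p.1 * x.1) Hp Hp) => //.
  - by rewrite -expr2 sqr_ge0.
  - by rewrite addr0 -expr2 exprn_even_gt0 //=; apply: contraTneq px1 => ->; rewrite mulr0.
  - by ring.
  - by transitivity (p.1 * x.2 * x.1); [ring|rewrite d1; ring].
have E3 : p.1 * det x q = x.1 * det p q - q.1 * det p x by rewrite /det; ring.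
move: a1 a2; rewrite /ang.
case: (ltrgt0P p.1) => p10; case: (ltrgt0P x.1) => x10; rewrite ?andbF //=.
- case: (lerP q.1 0) => q10 /= h1 h2.
    have d1 : 0 < det p q.
      case: (ltrgt0P q.1) q10 => // q10 _; first exact: opp.
      by rewrite /det q10 mulr0 subr0 mulr_gt0 // gq.
    apply: gen => //; move: E3; nia.
  have [d1|d1] : 0 < det p q \/ det p q <= 0 by lia.
    exact: gen.
  by apply: par; nia.
- move=> _; case: (ltrgt0P q.1) => // q10 h2.
    have d0 := opp p10 q10; apply: gen => //.
    by move: E3; nia.
- move=> _ q10.
  have x2 := px x10.
  apply: gen.
  + case: (ltrgt0P q.1) q10 => // q10 _; first exact: opp.
    by rewrite /det q10 mulr0 subr0 mulr_gt0 // gq.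
  + by rewrite /det x10 mul0r sub0r; nia.
  + by rewrite /det x10 mulr0 subr0; nia.
- by move=> h1 /andP[q10 h2]; have [d1|d1] : 0 < det p q \/ det p q <= 0; [lia|exact: gen|apply: par; nia].
- move=> _ /andP[q10 h2]; have p2 := gp p10; apply: gen => //.
    by rewrite /det p10; nia.
  by rewrite /det p10; nia.
- move=> _ q10; have p2 := gp p10; have x2 := px x10.
  apply: (Pc p p x x.2 0 p.2 Hp Hp) => //; rewrite ?addr0 ?(ltW x2) //.
    by rewrite p10 x10 !mulr0.
  by ring.
Qed.

Section Helly.
Variables (A B C : int * int -> Prop).
Hypotheses (cA : slit_cone A) (cB : slit_cone B) (cC : slit_cone C).

(** Each point lies in two of the cones, and the other two points both lie in the third. So the
    median of the three in the angular order lies in all three cones. *)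
Lemma slit_cone_helly a b c : A a -> B a -> B b -> C b -> C c -> A c ->
  exists x, [/\ A x, B x & C x].
Proof.
move=> Aa Ba Bb Cb Cc Ac.
have pa := cA.1 _ Aa; have pb := cB.1 _ Bb; have pc := cC.1 _ Cc.
case/orP: (ang_total a b) => ab; case/orP: (ang_total b c) => bc;
  case/orP: (ang_total a c) => ac.
- by exists b; split => //; apply: (ang_between cA pb Aa Ac).
- by exists b; split => //; apply: (ang_between cA pb Aa Ac).
- by exists c; split => //; apply: (ang_between cB pc Ba Bb).
- by exists a; split => //; apply: (ang_between cC pa Cc Cb).
- by exists a; split => //; apply: (ang_between cC pa Cb Cc).
- by exists c; split => //; apply: (ang_between cB pc Bb Ba).
- by exists b; split => //; apply: (ang_between cA pb Ac Aa).
- by exists b; split => //; apply: (ang_between cA pb Ac Aa).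
Qed.

End Helly.

(** Of the points [b] and [d] following [a], the nearer one lies on the arc from [a] to the farther
    one, hence in a cone nonadjacent to the one it came with. *)
Lemma chord_step (A B C D : int * int -> Prop) a b d : slit_cone A -> slit_cone B ->
  A a -> B a -> B b -> C b -> D d -> A d -> off_slit b -> off_slit d -> ang a b -> ang a d ->
  exists x, A x /\ C x \/ B x /\ D x.
Proof.
move=> cA cB Aa Ba Bb Cb Dd Ad pb pd ab ad.
case/orP: (ang_total b d) => bd.
  by exists b; left; split=> //; apply: (ang_between cA pb Aa Ad).
by exists d; right; split=> //; apply: (ang_between cB pd Ba Bb).
Qed.

(* An intersection graph of intervals contains no induced 4-cycle. *)
Lemma slit_cone_chord (A B C D : int * int -> Prop) a b c d :
  slit_cone A -> slit_cone B -> slit_cone C -> slit_cone D ->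
  A a -> B a -> B b -> C b -> C c -> D c -> D d -> A d ->
  exists x, A x /\ C x \/ B x /\ D x.
Proof.
move=> cA cB cC cD Aa Ba Bb Cb Cc Dc Dd Ad.
have pa := cA.1 _ Aa; have pb := cB.1 _ Bb; have pc := cC.1 _ Cc; have pd := cD.1 _ Dd.
case/orP: (ang_total a b) => ab.
  case/orP: (ang_total a d) => ad; first exact: (@chord_step A B C D a b d).
  case/orP: (ang_total d c) => dc.
    have [x [[? ?]|[? ?]]] := @chord_step D A B C d a c cD cA Dd Ad Aa Ba Cc Dc pa pc ad dc.
      by exists x; right.
    by exists x; left.
  case/orP: (ang_total c b) => cb.
    have [x [[? ?]|[? ?]]] := @chord_step C D A B c d b cC cD Cc Dc Dd Ad Bb Cb pd pb dc cb.
      by exists x; left.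
    by exists x; right.
  have ba : ang b a by apply: ang_trans pc cb _; apply: ang_trans pd dc ad.
  have [x [[? ?]|[? ?]]] := @chord_step B C D A b c a cB cC Bb Cb Cc Dc Aa Ba pc pa cb ba.
    by exists x; right.
  by exists x; left.
case/orP: (ang_total b c) => bc.
  have [x [[? ?]|[? ?]]] := @chord_step B C D A b c a cB cC Bb Cb Cc Dc Aa Ba pc pa bc ab.
    by exists x; right.
  by exists x; left.
case/orP: (ang_total c d) => cd.
  have [x [[? ?]|[? ?]]] := @chord_step C D A B c d b cC cD Cc Dc Dd Ad Bb Cb pd pb cd bc.
    by exists x; left.
  by exists x; right.
case/orP: (ang_total d a) => da.
  have [x [[? ?]|[? ?]]] := @chord_step D A B C d a c cD cA Dd Ad Aa Ba Cc Dc pa pc da cd.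
    by exists x; right.
  by exists x; left.
have ab' : ang a b by apply: ang_trans pd da _; apply: ang_trans pc cd bc.
exact: (@chord_step A B C D a b d).
Qed.

(** * Wedges and convex quadrilaterals *)

(** An open half-plane together with one of its two boundary rays still admits no nonnegative
    relation: the determinants vanish first, then the dot products. *)
Lemma pos_free_lex (D : int * int -> Prop) (e : int * int) :
  (forall u, D u -> 0 < det e u \/ det e u = 0 /\ dot e u < 0) -> pos_free D.
Proof.
move=> H u v w /H Hu /H Hv /H Hw i j k i0 j0 k0 E1 E2.
have F1 : i * det e u + j * det e v + k * det e w = 0.
  transitivity (e.1 * (i * u.2 + j * v.2 + k * w.2) - e.2 * (i * u.1 + j * v.1 + k * w.1)).
    by rewrite /det; ring.
  by rewrite E1 E2 !mulr0 subrr.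
have F2 : i * dot e u + j * dot e v + k * dot e w = 0.
  transitivity (e.1 * (i * u.1 + j * v.1 + k * w.1) + e.2 * (i * u.2 + j * v.2 + k * w.2)).
    by rewrite /dot; ring.
  by rewrite E1 E2 !mulr0 addr0.
move: F1 F2 Hu Hv Hw; move: (det e u) (det e v) (det e w) (dot e u) (dot e v) (dot e w).
clear -i0 j0 k0 => d1 d2 d3 p1 p2 p3 F1 F2.
move=> H1 H2 H3.
have nn (c d p : int) : 0 <= c -> 0 < d \/ d = 0 /\ p < 0 -> 0 <= c * d.
  by move=> c0 [h|[-> _]]; rewrite ?mulr0 ?mulr_ge0 // ltW.
have n1 := nn _ _ _ i0 H1; have n2 := nn _ _ _ j0 H2; have n3 := nn _ _ _ k0 H3.
have np (c d p : int) : 0 <= c -> c * d = 0 -> 0 < d \/ d = 0 /\ p < 0 -> c = 0 \/ c * p < 0.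
  move=> c0 id; have [->|iN] := eqVneq c 0; first by left.
  move=> [h|[_ h]]; right.
    by move/eqP: id; rewrite mulf_eq0 (negPf iN) gt_eqF.
  by rewrite pmulr_rlt0 // lt_def iN.
have := np _ _ p1 i0 _ H1; have := np _ _ p2 j0 _ H2; have := np _ _ p3 k0 _ H3.
clear -F1 F2 n1 n2 n3 => h3 h2 h1.
have {}h1 : i = 0 \/ i * p1 < 0 by apply: h1; lia.
have {}h2 : j = 0 \/ j * p2 < 0 by apply: h2; lia.
have {}h3 : k = 0 \/ k * p3 < 0 by apply: h3; lia.
move: h1 h2 h3 F2 {n1 n2 n3 F1} => [->|h1] [->|h2] [->|h3]; rewrite ?mul0r ?add0r ?addr0; split=> //; lia.
Qed.

Section Wedge.
Variables m n : nat.
Implicit Types (T W Z : {set grid m n}) (a b c d x w z : grid m n).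

Definition on_border x : bool :=
  [|| x.1 == 0 :> nat, x.1.+1 == m, x.2 == 0 :> nat | x.2.+1 == n].

Definition wedge a b c d := half a b :&: half c d.

(** A weak form of convex position: with strict orientations in place of the four memberships, this
    becomes [convex_quad] with coprime sides. *)
Definition stable a b c d : bool :=
  [&& coprime_pair (pt a) (pt b), coprime_pair (pt c) (pt d),
      a \in half c d, b \in half c d, c \in half a b & d \in half a b].

Definition convex_quad (a b c d : int * int) : bool :=
  [&& 0 < orient a b c, 0 < orient b c d, 0 < orient c d a & 0 < orient d a b].

Definition joint W z z' : Prop :=
  exists v, forall w, w \in W -> 0 < dot v (vec (pt w) (pt z)) /\ 0 < dot v (vec (pt w) (pt z')).

Lemma lin_separates T W : lin T -> W \subset T ->
  exists v, forall z w, z \notin T -> w \in W -> 0 < dot v (vec (pt w) (pt z)).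
Proof.
case=> v [c Tv] WT; exists v => z w; rewrite Tv => zT wW.
have := fintype.subsetP WT _ wW; rewrite Tv; move: zT.
rewrite /dot /vec /=; lia.
Qed.

Lemma lin_joint T W z z' : lin T -> W \subset T -> z \notin T -> z' \notin T -> joint W z z'.
Proof.
move=> lT WT zT zT'; have [v Hv] := lin_separates lT WT.
by exists v => w wW; split; apply: Hv.
Qed.

Lemma coprime_neq a b : coprime_pair (pt a) (pt b) -> pt a != pt b.
Proof.
by apply: contraL => /eqP ->; rewrite /coprime_pair !subrr.
Qed.

Lemma end_notin a b : coprime_pair (pt a) (pt b) -> b \notin half a b.
Proof. by move=> cp; rewrite mem_half side_end // coprime_neq. Qed.

Lemma start_in a b : a \in half a b.
Proof. by rewrite mem_half side_start. Qed.

(** Either half-plane may be replaced by a tangent one, relative to the other, without changing the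
    intersection. Starting from the admissible segment of extreme direction, replacing the partner
    and then the segment itself returns the same segment, and being such a fixed point is
    stability. *)
Lemma stable_exists T1 T2 z z' : lin T1 -> lin T2 -> T1 :&: T2 != set0 ->
  z \notin T1 :&: T2 -> z' \notin T1 :&: T2 -> ~ joint (T1 :&: T2) z z' ->
  exists a b c d, stable a b c d /\ wedge a b c d = T1 :&: T2.
Proof.
set W := T1 :&: T2 => l1 l2 W0 zW zW' nj.
(* No half-plane cuts off both zeros, so the two half-planes share them out. Thus [z] tells which
   half-plane a segment replaces, and [R] collects the candidates for the one that excludes [z]. *)
have split_ T T' : lin T -> lin T' -> T :&: T' = W -> z \notin T -> z \in T' /\ z' \notin T'.
  move=> lT lT' E zT; have zT' : z' \in T.
    apply/negPn/negP => zT'; apply: nj; apply: (lin_joint lT) => //.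
    by rewrite -E subsetIl.
  have z'T' : z' \notin T' by move: zW'; rewrite -E inE zT'.
  split=> //; apply/negPn/negP => zT2; apply: nj; apply: (lin_joint lT') => //.
  by rewrite -E subsetIr.
pose R (p : grid m n * grid m n) : Prop := [/\ coprime_pair (pt p.1) (pt p.2),
  z \notin half p.1 p.2 & exists2 T, lin T & half p.1 p.2 :&: T = W].
have tan T T' : lin T -> lin T' -> T :&: T' = W -> z \notin T ->
    exists a b, [/\ a \in W, b \in T', b \notin W, R (a, b) & half a b :&: T' = W].
  move=> lT lT' E zT; have [zT' z'T'] := split_ _ _ lT lT' E zT.
  have [||a [b [aW bT' bh cp hE]]] := tangent_lin lT lT'.
  - by rewrite E.
  - by apply/set0Pn; exists z; rewrite inE zT.
  rewrite E in aW hE; exists a, b.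
  have bW : b \notin W by rewrite -hE inE (negPf bh).
  split=> //; split=> //; last by exists T'.
  by move: zW; rewrite -hE inE zT' andbT.
have [p0 Rp0] : exists p, R p.
  have [zT|zT] := boolP (z \in T1).
    have zT2 : z \notin T2 by move: zW; rewrite inE zT.
    by have [|a [b [_ _ _ Rab _]]] := tan T2 T1 l2 l1 _ zT2; [rewrite setIC|exists (a, b)].
  by have [a [b [_ _ _ Rab _]]] := tan T1 T2 l1 l2 erefl zT; exists (a, b).
case/set0Pn: W0 => w0 w0W.
(* Swapping the coordinates reverses orientations, so that [extreme] yields
   the segment whose direction is the most clockwise. *)
pose g (p : grid m n * grid m n) := ((vec (pt p.1) (pt p.2)).2, (vec (pt p.1) (pt p.2)).1).
pose e := ((vec (pt z) (pt w0)).2, (vec (pt z) (pt w0)).1).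
have nD : pos_free (fun u => exists2 p, R p & u = g p).
  apply: (@pos_free_lex _ e) => u [[a b] [_ zh [T lT hT]] ->].
  have : w0 \in half a b by move: w0W; rewrite -hT inE => /andP[].
  move: zh; rewrite !mem_half.
  have E1 : det e (g (a, b)) = orient (pt a) (pt b) (pt w0) - orient (pt a) (pt b) (pt z).
    by rewrite /orient /det /=; ring.
  have E2 : dot e (g (a, b)) = dot (vec (pt a) (pt b)) (vec (pt a) (pt w0)) - dot (vec (pt a) (pt b)) (vec (pt a) (pt z)).
    by rewrite /dot /=; ring.
  rewrite E1 E2 /side; clear; move: (orient _ _ _) (orient _ _ _) (dot _ _) (dot _ _); lia.
have [||u us Hu] := extreme (s := [seq g p | p <- enum [pred p | `[<R p>]]]) nD.
- by move=> u /mapP[p]; rewrite mem_enum => /asboolP Rp ->; exists p.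
- rewrite -size_eq0 size_map -cardE -lt0n; apply/card_gt0P; exists p0.
  exact/asboolP.
case/mapP: us => -[a b]; rewrite mem_enum => /asboolP Rab uE.
have ext p : R p -> 0 <= det (vec (pt a) (pt b)) (vec (pt p.1) (pt p.2)).
  move=> Rp; have : cw (g p) u.
    by apply: Hu; apply: map_f; rewrite mem_enum; apply/asboolP.
  have E1 : det (g p) (g (a, b)) = det (vec (pt a) (pt b)) (vec (pt p.1) (pt p.2)).
    by rewrite /det /=; ring.
  by rewrite uE /cw E1; lia.
have [/= cpab zab [T lT hT]] := Rab.
have [zT z'T] := split_ _ _ (half_lin a b) lT hT zab.
have [||c [d [cW dab dh cpcd hE]]] := tangent_lin lT (half_lin a b).
- by rewrite setIC hT; apply/set0Pn; exists w0.
- apply/set0Pn; exists z'; rewrite inE z'T.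
  apply/negPn/negP => z'ab; apply: nj; apply: (lin_joint (half_lin a b)) => //.
  by rewrite -hT subsetIl.
rewrite setIC hT in cW; rewrite [T :&: _]setIC hT in hE.
(* The second replacement gives an admissible segment again. Extremality of [a b] bounds its
   direction from one side, [half a b] from the other, and [rigid] identifies the two segments. *)
have [||||a' [b' [a'W b'cd b'W Rab' hE']]] := tan (half a b) (half c d) => //; try exact: half_lin.
  by rewrite setIC.
have [cpab' _ _] := Rab'.
have b'ab : b' \notin half a b by apply: contra b'W => b'ab; rewrite -hE inE b'cd.
have a'ab : a' \in half a b by move: a'W; rewrite -hT inE => /andP[].
have [||/pt_inj ea /pt_inj eb] := rigid cpab cpab' _ _ (ext _ Rab'); rewrite -?mem_half //.
rewrite /= in ea eb; move: b'cd a'W; rewrite ea eb => b'cd a'W; exists a, b, c, d; rewrite /wedge setIC hE; split => //.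
have aW : a \in half c d by move: a'W; rewrite -hE inE => /andP[].
have cW' : c \in half a b by move: cW; rewrite -hE inE => /andP[].
by rewrite /stable cpab cpcd aW b'cd cW' dab.
Qed.

(** [q] is the inward normal at the border point. In the coordinates given by [p] and [q], the
    outward normal is the ray of [(0, -1)], which no normal separating a set containing [w] from a
    zero can hit. *)
Lemma border_frame w : on_border w ->
  exists p q : int * int,
    (forall u, exists v : int * int, u = (v.1 * p.1 + v.2 * q.1, v.1 * p.2 + v.2 * q.2)) /\
    (forall z, 0 <= dot q (vec (pt w) (pt z))).
Proof.
have H (y : int * int) : y = (y.1, y.2) by case: y.
case/or4P=> /eqP E.
- exists (0, 1), (1, 0); split.
    by move=> u; exists (u.2, u.1); rewrite [LHS]H /=; congr (_, _); ring.
  by move=> z; rewrite /dot /vec /pt /= E; lia.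
- exists (0, 1), (-1, 0); split.
    by move=> u; exists (u.2, - u.1); rewrite [LHS]H /=; congr (_, _); ring.
  by move=> z; rewrite /dot /vec /pt /=; move: (ltn_ord z.1); lia.
- exists (1, 0), (0, 1); split.
    by move=> u; exists (u.1, u.2); rewrite [LHS]H /=; congr (_, _); ring.
  by move=> z; rewrite /dot /vec /pt /= E; lia.
exists (1, 0), (0, -1); split.
  by move=> u; exists (u.1, - u.2); rewrite [LHS]H /=; congr (_, _); ring.
by move=> z; rewrite /dot /vec /pt /=; move: (ltn_ord z.2); lia.
Qed.

Section Border.
Variables (W : {set grid m n}) (w0 : grid m n) (p q : int * int).
Hypotheses (w0W : w0 \in W) (q0 : forall z, 0 <= dot q (vec (pt w0) (pt z))).

Let L (v : int * int) : int * int := (v.1 * p.1 + v.2 * q.1, v.1 * p.2 + v.2 * q.2).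

Definition normal_cone z (v : int * int) : Prop :=
  forall w, w \in W -> 0 < dot (L v) (vec (pt w) (pt z)).

Lemma normal_cone_slit z : slit_cone (normal_cone z).
Proof.
split=> [u /(_ w0 w0W) | u v x i j k Pu Pv i0 j0 ij k0 E1 E2 w wW].
  move=> H u10; move: H (q0 z).
  have -> : dot (L u) (vec (pt w0) (pt z)) = u.2 * dot q (vec (pt w0) (pt z)).
    by rewrite /L u10 /dot /=; ring.
  by move: (dot _ _) => e; nia.
have := Pu w wW; have := Pv w wW; set D := vec (pt w) (pt z) => h1 h2.
have E : k * dot (L x) D = i * dot (L u) D + j * dot (L v) D.
  transitivity ((k * x.1) * dot p D + (k * x.2) * dot q D).
    by rewrite /dot /L /=; ring.
  by rewrite E1 E2 /dot /L /=; ring.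
by move: E h1 h2; move: (dot _ _) (dot _ _) (dot _ _) => *; nia.
Qed.

End Border.

(** A relation excluded by [pos_free] involves at most three zeros. Their normal cones meet
    pairwise, hence have a common normal by Helly, and this normal is positive on the three
    differences. *)
Lemma lin_pairwise W w0 : w0 \in W -> on_border w0 ->
  (forall z z', z \notin W -> z' \notin W -> joint W z z') -> lin W.
Proof.
move=> w0W /border_frame[p [q [Ls q0]]] J.
have [->|WT] := eqVneq W setT; first exact: lin_setT.
pose L (v : int * int) : int * int := (v.1 * p.1 + v.2 * q.1, v.1 * p.2 + v.2 * q.2).
have J' z z' : z \notin W -> z' \notin W ->
    exists v, normal_cone W p q z v /\ normal_cone W p q z' v.
  move=> zW zW'; have [u Hu] := J _ _ zW zW'; have [v vE] := Ls u.
  by exists v; split=> w /Hu; rewrite vE => -[].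
have nD : pos_free (diffs W (~: W)).
  move=> u v w Du Dv Dw i j k i0 j0 k0 E1 E2.
  have [x [Hu Hv Hw]] : exists x : int * int, [/\ 0 < dot x u, 0 < dot x v & 0 < dot x w].
    move: Du Dv Dw => [w1 [z1 [w1W z1W ->]]] [w2 [z2 [w2W z2W ->]]] [w3 [z3 [w3W z3W ->]]].
    rewrite !inE in z1W z2W z3W.
    have [n12 [h1 h2]] := J' _ _ z1W z2W; have [n23 [h3 h4]] := J' _ _ z2W z3W.
    have [n31 [h5 h6]] := J' _ _ z3W z1W.
    have C z := @normal_cone_slit W w0 p q w0W q0 z.
    have [y [y1 y2 y3]] := slit_cone_helly (C z1) (C z2) (C z3) h1 h2 h3 h4 h5 h6.
    by exists (L y); split; [apply: y1|apply: y2|apply: y3].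
  apply: (@pos_free_pos (fun y => [\/ y = u, y = v | y = w]) x) E1 E2 => //.
  - by move=> y [] ->.
  - exact: Or31.
  - exact: Or32.
  - exact: Or33.
have [|||a [b [aW bZ cp H1 H2]]] := tangent (W := W) (Z := ~: W) _ _ nD.
- by apply/set0Pn; exists w0.
- by apply: contra WT => /eqP E; rewrite -[W]setCK E setC0.
- by move=> a b x k l _ _ _ _ _ _; rewrite setUCr inE.
suff -> : W = half a b by apply: half_lin.
apply/setP=> x; rewrite mem_half; case: (boolP (x \in W)) => xW.
  by rewrite H1.
by apply/esym/negbTE/H2; rewrite inE.
Qed.

(** * Uniqueness of the two edges *)

Lemma convex_stable a b c d : coprime_pair (pt a) (pt b) -> coprime_pair (pt c) (pt d) ->
  convex_quad (pt a) (pt b) (pt c) (pt d) -> stable a b c d.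
Proof.
move=> c1 c2 /and4P[h1 h2 h3 h4]; rewrite /stable c1 c2 !mem_half /side.
have E1 : orient (pt c) (pt d) (pt b) = orient (pt b) (pt c) (pt d).
  by rewrite /orient /det /=; ring.
have E2 : orient (pt a) (pt b) (pt d) = orient (pt d) (pt a) (pt b).
  by rewrite /orient /det /=; ring.
by rewrite E1 E2 h1 h2 h3 h4.
Qed.

(** The diagonals cross. Positive combinations of the vectors to [b] and [d], taken from [a] and
    from [c], are multiples of [vec a c] with opposite signs, so no form is positive on all four. *)
Lemma convex_not_joint W a b c d : convex_quad (pt a) (pt b) (pt c) (pt d) ->
  a \in W -> c \in W -> ~ joint W b d.
Proof.
move=> /and4P[h1 h2 h3 h4] aW cW [v Hv].
have [ab ad] := Hv _ aW; have [cb cd] := Hv _ cW.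
have E1 : orient (pt c) (pt d) (pt a) * dot v (vec (pt a) (pt b)) +
   orient (pt a) (pt b) (pt c) * dot v (vec (pt a) (pt d)) =
   orient (pt d) (pt a) (pt b) * dot v (vec (pt a) (pt c)).
  by rewrite /orient /dot /det /=; ring.
have E2 : orient (pt c) (pt d) (pt a) * dot v (vec (pt c) (pt b)) +
   orient (pt a) (pt b) (pt c) * dot v (vec (pt c) (pt d)) =
   - orient (pt b) (pt c) (pt d) * dot v (vec (pt a) (pt c)).
  by rewrite /orient /dot /det /=; ring.
have := addr_gt0 (mulr_gt0 h3 ab) (mulr_gt0 h1 ad); rewrite E1 pmulr_rgt0 // => ac.
have := addr_gt0 (mulr_gt0 h3 cb) (mulr_gt0 h1 cd); rewrite E2 mulNr oppr_gt0 pmulr_rlt0 //.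
by rewrite ltNge (ltW ac).
Qed.

(** Each wedge distributes the two zeros of the other one over its half-planes. If the two
    distributions agree, corresponding edges are tangents of each other and [rigid] identifies them;
    if they disagree, the four zeros form a chordless 4-cycle of normal cones. *)
Lemma wedge_unique a b c d a' b' c' d' w0 :
  coprime_pair (pt a) (pt b) -> coprime_pair (pt c) (pt d) ->
  convex_quad (pt a) (pt b) (pt c) (pt d) ->
  coprime_pair (pt a') (pt b') -> coprime_pair (pt c') (pt d') ->
  convex_quad (pt a') (pt b') (pt c') (pt d') ->
  wedge a' b' c' d' = wedge a b c d -> w0 \in wedge a b c d -> on_border w0 ->
  ((a', b'), (c', d')) = ((a, b), (c, d)) \/ ((a', b'), (c', d')) = ((c, d), (a, b)).
Proof.
move=> cab ccd cq cab' ccd' cq' WE w0W bw0; set W := wedge a b c d in WE w0W.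
have /and5P[_ _ acd bcd /andP[cab_ dab]] := convex_stable cab ccd cq.
have /and5P[_ _ acd' bcd' /andP[cab_' dab']] := convex_stable cab' ccd' cq'.
have s1 : W \subset half a b by apply: subsetIl.
have s2 : W \subset half c d by apply: subsetIr.
have s1' : W \subset half a' b' by rewrite -WE; apply: subsetIl.
have s2' : W \subset half c' d' by rewrite -WE; apply: subsetIr.
have aW : a \in W by rewrite inE start_in.
have cW : c \in W by rewrite inE start_in andbT.
have aW' : a' \in W by rewrite -WE inE start_in.
have cW' : c' \in W by rewrite -WE inE start_in andbT.
have nj := convex_not_joint cq aW cW; have nj' := convex_not_joint cq' aW' cW'.
have bW : b \notin W by rewrite inE negb_and end_notin.
have dW : d \notin W by rewrite inE negb_and end_notin ?orbT.
have bW' : b' \notin W by rewrite -WE inE negb_and end_notin.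
have dW' : d' \notin W by rewrite -WE inE negb_and end_notin ?orbT.
have eqs e f e' f' : coprime_pair (pt e) (pt f) -> coprime_pair (pt e') (pt f') ->
    W \subset half e f -> W \subset half e' f' -> e \in W -> e' \in W ->
    f' \notin half e f -> f \notin half e' f' -> (e', f') = (e, f).
  move=> cp cp' /fintype.subsetP se /fintype.subsetP se' eW eW' f'e fe'.
  have /se := eW'; have /se' := eW; move: f'e fe'; rewrite !mem_half => h1 h2 h3 h4.
  have D1 := det_side h3 h2.
  have D2 : 0 <= det (vec (pt e) (pt f)) (vec (pt e') (pt f')).
    by rewrite det_anti oppr_ge0.
  by have [/pt_inj-> /pt_inj->] := rigid cp cp' h4 h1 D2.
have other z z' T T' : ~ joint W z z' -> z' \notin W -> lin T -> W \subset T ->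
    T :&: T' = W -> z \notin T -> z' \notin T'.
  move=> nJ zW' lT sT TE zT; apply: contra zW' => z'T'; rewrite -TE inE z'T' andbT.
  apply/negPn/negP => z'T; apply: nJ; exact: (lin_joint lT).
have nj2 : ~ joint W d b by move=> [v Hv]; apply: nj; exists v => w /Hv[].
have nj2' : ~ joint W d' b' by move=> [v Hv]; apply: nj'; exists v => w /Hv[].
have WC : half c d :&: half a b = W by rewrite setIC.
have WC' : half c' d' :&: half a' b' = W by rewrite setIC.
(* The cycle is [f], [h'], [h], [f']. Consecutive zeros are cut off by one of the four half-planes;
   the chords [f h] and [h' f'] are excluded by the last two hypotheses. *)
have cross e f g h e' f' g' h' :
    W \subset half e f -> W \subset half g h -> W \subset half e' f' -> W \subset half g' h' ->
    f \notin half e f -> h' \notin half e f -> h' \notin half g' h' -> h \notin half g' h' ->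
    h \notin half g h -> f' \notin half g h -> f' \notin half e' f' -> f \notin half e' f' ->
    ~ joint W f h -> ~ joint W f' h' -> False.
  move=> t1 t2 t3 t4 k1 k2 k3 k4 k5 k6 k7 k8 J J'.
  have [p [q [Ls q0]]] := border_frame bw0.
  have C z := @normal_cone_slit W w0 p q w0W q0 z.
  have rep e1 f1 : W \subset half e1 f1 -> exists v, forall z, z \notin half e1 f1 -> normal_cone W p q z v.
    move=> st; have [u Hu] := lin_separates (half_lin e1 f1) st; have [v vE] := Ls u.
    by exists v => z zT w wW; rewrite -vE; apply: Hu.
  have [v1 H1] := rep _ _ t1; have [v2 H2] := rep _ _ t2.
  have [v3 H3] := rep _ _ t3; have [v4 H4] := rep _ _ t4.
  have [x [[y1 y2]|[y1 y2]]] := slit_cone_chord (C f) (C h') (C h) (C f')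
     (H1 _ k1) (H1 _ k2) (H4 _ k3) (H4 _ k4) (H2 _ k5) (H2 _ k6) (H3 _ k7) (H3 _ k8).
    by apply: J; eexists => w wW; split; [apply: y1|apply: y2].
  by apply: J'; eexists => w wW; split; [apply: y2|apply: y1].
have {}other1 := other _ _ _ _ nj dW (half_lin a' b') s1' WE.
have {}other2 := other _ _ _ _ nj dW (half_lin c' d') s2' WC'.
have {}other3 := other _ _ _ _ nj' dW' (half_lin a b) s1 erefl.
have {}other4 := other _ _ _ _ nj' dW' (half_lin c d) s2 WC.
have : (b \notin half a' b') || (b \notin half c' d') by rewrite -negb_and -in_setI [_ :&: _]WE.
have : (b' \notin half a b) || (b' \notin half c d) by rewrite -negb_and -in_setI.
move=> /orP[k1|k1] /orP[k2|k2].
- left; rewrite (eqs a b a' b') // (eqs c d c' d') //; by [apply: other3|apply: other1].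
- exfalso; apply: (cross a b c d c' d' a' b') => //; rewrite ?end_notin //.
    by apply: other2.
  by apply: other3.
- exfalso; apply: (cross a b c d a' b' c' d') => //; rewrite ?end_notin //.
    by apply: other4.
  by apply: other1.
- right; rewrite (eqs c d a' b') // ?(eqs a b c' d') //; by [apply: other4|apply: other2].
Qed.

End Wedge.

(** * Wedges missing the border of the grid *)

(** At the rational point [num / den] both inequalities hold. Each one then holds at an end of the
    unit gap around this point, but never both at the same end, so both change across this gap. *)
Lemma gap_on_side (A1 B1 A2 B2 L num den : int) : 0 < den -> 0 <= num -> num <= L * den ->
  A1 * num + B1 * den <= 0 -> A2 * num + B2 * den <= 0 ->
  (forall j, 0 <= j -> j <= L -> (A1 * j + B1 <= 0) && (A2 * j + B2 <= 0) = false) ->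
  exists j, [/\ 0 <= j, j < L, (A1 * j + B1 <= 0) != (A1 * (j + 1) + B1 <= 0) &
    (A2 * j + B2 <= 0) != (A2 * (j + 1) + B2 <= 0)].
Proof.
move=> d0 n0 nL h1 h2 H.
have E := divz_eq num den; have r0 := modz_ge0 num (lt0r_neq0 d0).
have rd := ltz_pmod num d0.
have j0 : 0 <= (num %/ den)%Z by rewrite divz_ge0.
move: E r0 rd j0; move: (num %/ den)%Z (num %% den)%Z => j r E r0 rd j0.
have F1 : (den - r) * (A1 * j + B1) + r * (A1 * (j + 1) + B1) <= 0.
  by rewrite (_ : _ + _ = A1 * num + B1 * den) // E; ring.
have F2 : (den - r) * (A2 * j + B2) + r * (A2 * (j + 1) + B2) <= 0.
  by rewrite (_ : _ + _ = A2 * num + B2 * den) // E; ring.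
have jL : j <= L by nia.
have dr : 0 < den - r by lia.
have [r0'|rp] := eqVneq r 0.
  have := H j j0 jL; move: F1 F2; rewrite r0' subr0 !mul0r !addr0 !pmulr_rle0 // => -> ->.
  by [].
have {}rp : 0 < r by rewrite lt_def rp.
have jL' : j < L by nia.
have H1 := H j j0 jL; have H2 := H (j + 1) _ _.
have {}H2 := H2 (addr_ge0 j0 ler01).
have {}H2 : (A1 * (j + 1) + B1 <= 0) && (A2 * (j + 1) + B2 <= 0) = false by apply: H2; lia.
have aux x y : (den - r) * x + r * y <= 0 -> (x <= 0) || (y <= 0).
  by move=> h; apply/negPn/negP; rewrite negb_or -!ltNge => /andP[x0 y0]; nia.
exists j; split=> //; move: (aux _ _ F1) (aux _ _ F2) H1 H2; clear.
  by case: (_ <= 0); case: (_ <= 0); case: (_ <= 0); case: (_ <= 0).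
by case: (_ <= 0); case: (_ <= 0); case: (_ <= 0); case: (_ <= 0).
Qed.

(** The side reached first is found by comparing the two exit times. The other coordinate of the
    exit point is multiplied by the absolute value of the leading component of [v] to remain an
    integer. *)
Lemma ray_exit (w v : int * int) (M N : int) : 0 <= w.1 -> w.1 <= M -> 0 <= w.2 -> w.2 <= N ->
  ~~ ((v.1 == 0) && (v.2 == 0)) ->
  (exists e, [/\ e = 0 \/ e = M, v.1 != 0, 0 <= (e - w.1) * v.1,
     0 <= w.2 * `|v.1| + `|e - w.1| * v.2 & w.2 * `|v.1| + `|e - w.1| * v.2 <= N * `|v.1|]) \/
  (exists e, [/\ e = 0 \/ e = N, v.2 != 0, 0 <= (e - w.2) * v.2,
     0 <= w.1 * `|v.2| + `|e - w.2| * v.1 & w.1 * `|v.2| + `|e - w.2| * v.1 <= M * `|v.2|]).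
Proof.
case: w v => [w1 w2] [v1 v2] /= h1 h2 h3 h4 h5.
pose ex := if 0 < v1 then M else 0; pose ey := if 0 < v2 then N else 0.
have [c|c] : `|ex - w1| * `|v2| <= `|ey - w2| * `|v1| /\ v1 != 0 \/
   `|ey - w2| * `|v1| <= `|ex - w1| * `|v2| /\ v2 != 0.
- have [v10|v10] := eqVneq v1 0.
    by right; rewrite v10 normr0 mulr0 mulr_ge0 //; move: h5; rewrite v10.
  have [v20|v20] := eqVneq v2 0.
    by left; rewrite v20 normr0 mulr0 mulr_ge0.
  by case/orP: (le_total (`|ex - w1| * `|v2|) (`|ey - w2| * `|v1|)) => ?; [left|right].
- case: c => c v10; left; exists ex; split => //.
  + by rewrite /ex; case: ifP; [right|left].
  + by rewrite /ex; case: ifP => ?; nia.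
  + move: c; rewrite /ey; case: (ltrP 0 v2) => v20 c; first by rewrite addr_ge0 // mulr_ge0 // ltW.
    move: c; rewrite (ler0_norm v20) sub0r normrN (ger0_norm h3); nia.
  + move: c; rewrite /ey; case: (ltrP 0 v2) => v20 c.
      move: c; rewrite (gtr0_norm v20) (ger0_norm (x := N - w2)) ?subr_ge0 //; nia.
    have : `|ex - w1| * v2 <= 0 by rewrite mulr_ge0_le0.
    have := ler_wpM2r (normr_ge0 v1) h4; lia.
case: c => c v20; right; exists ey; split => //.
+ by rewrite /ey; case: ifP; [right|left].
+ by rewrite /ey; case: ifP => ?; nia.
+ move: c; rewrite /ex; case: (ltrP 0 v1) => v10 c; first by rewrite addr_ge0 // mulr_ge0 // ltW.
  move: c; rewrite (ler0_norm v10) sub0r normrN (ger0_norm h1); nia.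
move: c; rewrite /ex; case: (ltrP 0 v1) => v10 c.
  move: c; rewrite (gtr0_norm v10) (ger0_norm (x := M - w1)) ?subr_ge0 //; nia.
have : `|ey - w2| * v1 <= 0 by rewrite mulr_ge0_le0.
have := ler_wpM2r (normr_ge0 v2) h2; lia.
Qed.

Definition jump (a b : int * int) (i r : int) : bool :=
  side a b (i, r) != side a b (i + 1, r).

Lemma jump_unique a b i j r : jump a b i r -> jump a b j r -> i = j.
Proof.
have mono : (forall k l, k <= l -> side a b (l, r) -> side a b (k, r)) \/
            (forall k l, k <= l -> side a b (k, r) -> side a b (l, r)).
  have O k l : orient a b (l, r) = orient a b (k, r) - (b.2 - a.2) * (l - k).
    by rewrite /orient /det /=; ring.
  have Dt k l : dot (vec a b) (vec a (l, r)) = dot (vec a b) (vec a (k, r)) + (b.1 - a.1) * (l - k).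
    by rewrite /dot /=; ring.
  case: (ltrgt0P (b.2 - a.2)) => d2.
  - left=> k l kl; rewrite /side (O k l) (Dt k l); move: (orient _ _ _) (dot _ _) => o d.
    have [->|klN] := eqVneq k l; first by rewrite subrr !mulr0 subr0 addr0.
    have : 0 < (b.2 - a.2) * (l - k) by rewrite mulr_gt0 // subr_gt0 lt_neqAle klN.
    clear; move: (_ * _) ((b.1 - _) * _) => p q; lia.
  - right=> k l kl; rewrite /side (O k l) (Dt k l); move: (orient _ _ _) (dot _ _) => o d.
    have [->|klN] := eqVneq k l; first by rewrite subrr !mulr0 subr0 addr0.
    have : (b.2 - a.2) * (l - k) < 0 by rewrite nmulr_rlt0 // subr_gt0 lt_neqAle klN.
    clear; move: (_ * _) ((b.1 - _) * _) => p q; lia.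
  case: (lerP 0 (b.1 - a.1)) => d1.
  - left=> k l kl; rewrite /side (O k l) (Dt k l) d2 mul0r subr0.
    have : 0 <= (b.1 - a.1) * (l - k) by rewrite mulr_ge0 // subr_ge0.
    clear; move: (_ * _) (orient _ _ _) (dot _ _) => p o d; lia.
  right=> k l kl; rewrite /side (O k l) (Dt k l) d2 mul0r subr0.
  have : (b.1 - a.1) * (l - k) <= 0 by apply: mulr_le0_ge0; [exact: ltW|rewrite subr_ge0].
  clear; move: (_ * _) (orient _ _ _) (dot _ _) => p o d; lia.
have step k l : k < l -> jump a b k r -> jump a b l r -> False.
  move=> kl; have kl1 : k + 1 <= l by rewrite addrC -ltzD1 addrC ltrD2r.
  rewrite /jump; case: mono => mono.
    have := mono _ _ kl1; have := mono k (k + 1); have := mono l (l + 1).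
    rewrite !lerDl => /(_ isT) + /(_ isT); clear.
    by case: (side a b (k, r)); case: (side a b (l, r)); case: (side a b (k + 1, r));
      case: (side a b (l + 1, r)) => //= h1 h2 h3; intuition.
  have := mono _ _ kl1; have := mono k (k + 1); have := mono l (l + 1).
  rewrite !lerDl => /(_ isT) + /(_ isT); clear.
  by case: (side a b (k, r)); case: (side a b (l, r)); case: (side a b (k + 1, r));
    case: (side a b (l + 1, r)) => //= h1 h2 h3; intuition.
by case: (ltrgtP i j) => // ij; [move=> h1 h2|move=> h2 h1]; case: (step _ _ ij h1 h2).
Qed.

(** Reduces columns to rows. A rotation preserves [side], whereas exchanging the coordinates would
    reverse orientations. *)
Definition quarter_turn (x : int * int) : int * int := (x.2, - x.1).

Lemma side_quarter_turn a b x : side (quarter_turn a) (quarter_turn b) (quarter_turn x) = side a b x.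
Proof.
have E1 : orient (quarter_turn a) (quarter_turn b) (quarter_turn x) = orient a b x by rewrite /orient /det /=; ring.
have E2 : dot (vec (quarter_turn a) (quarter_turn b)) (vec (quarter_turn a) (quarter_turn x)) = dot (vec a b) (vec a x).
  by rewrite /dot /=; ring.
by rewrite /side E1 E2.
Qed.

Lemma card_cover (T I : finType) (S : {set T}) (F : I -> {set T}) k :
  (forall x, x \in S -> exists i, x \in F i) -> (forall i, (#|F i| <= k)%N) ->
  (#|S| <= #|I| * k)%N.
Proof.
move=> cov Fk; apply: (@leq_trans (\sum_(i : I) #|F i|)%N).
  apply: (@leq_trans #|\bigcup_i F i|).
    apply/subset_leq_card/fintype.subsetP=> x /cov[i xi]; apply/bigcupP; by exists i.
  apply: (big_ind2 (fun (A : {set T}) s => (#|A| <= s)%N)); first by rewrite cards0.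
    by move=> A a B b Aa Bb; rewrite (leq_trans (leq_card_setU A B)) ?leq_add.
  by [].
by rewrite -sum_nat_const; apply: leq_sum => i _; exact: Fk.
Qed.

(* Translating a segment along the row translates its unique jump, so each
   translation class contributes at most once. *)
Lemma card_jump (G F : finType) (k : nat) (X : G -> 'I_k) (Y : G -> F) (y : F -> int)
    (i r : int) : injective (fun g => (X g, Y g)) ->
  (#|[set p : G * G | jump ((X p.1 : nat)%:Z, y (Y p.1)) ((X p.2 : nat)%:Z, y (Y p.2)) i r]|
     <= 2 * k * (#|F| * #|F|))%N.
Proof.
move=> injXY; set S := [set p | _].
have pf (p : G * G) : (X p.2 + (k - X p.1) < 2 * k)%N.
  by have := ltn_ord (X p.1); have := ltn_ord (X p.2); lia.
pose f p : 'I_(2 * k) * (F * F) := (Ordinal (pf p), (Y p.1, Y p.2)).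
have -> : (2 * k * (#|F| * #|F|) = #|{: 'I_(2 * k) * (F * F)}|)%N by rewrite !card_prod card_ord.
rewrite -(card_in_imset (f := f)) ?max_card // => -[a b] [a' b'] /=.
rewrite !inE /= => J J' [E Ya Yb].
set t := (X a' : nat)%:Z - (X a : nat)%:Z.
have Xa : (X a' : nat)%:Z = (X a : nat)%:Z + t by rewrite /t; ring.
have Xb : (X b' : nat)%:Z = (X b : nat)%:Z + t.
  have := ltn_ord (X a); have := ltn_ord (X a'); rewrite /t; lia.
have sideE z s : side ((X a' : nat)%:Z, y (Y a')) ((X b' : nat)%:Z, y (Y b')) (z, s) =
    side ((X a : nat)%:Z, y (Y a)) ((X b : nat)%:Z, y (Y b)) (z - t, s).
  rewrite Xa Xb -Ya -Yb /side.
  have -> : orient ((X a : nat)%:Z + t, y (Y a)) ((X b : nat)%:Z + t, y (Y b)) (z, s) =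
     orient ((X a : nat)%:Z, y (Y a)) ((X b : nat)%:Z, y (Y b)) (z - t, s).
    by rewrite /orient /det /=; ring.
  congr (_ || _ && (_ <= 0)); rewrite /dot /=; ring.
have J1 : jump ((X a : nat)%:Z, y (Y a)) ((X b : nat)%:Z, y (Y b)) (i - t) r.
  by move: J'; rewrite /jump !sideE addrAC.
have t0 : t = 0 by have := jump_unique J J1; lia.
have ea : a = a'.
  apply: injXY; rewrite /= Ya; congr (_, _); apply: val_inj => /=.
  by move: Xa; rewrite t0 addr0 => -[].
have eb : b = b'.
  apply: injXY; rewrite /= Yb; congr (_, _); apply: val_inj => /=.
  by move: Xb; rewrite t0 addr0 => -[].
by rewrite ea eb.
Qed.

(** A half-plane that contains [w] and recedes along [u] contains the point where the ray meets the
    line of abscissa [e]; the inequality is scaled as in [ray_exit]. *)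
Lemma exit_value (A B c w1 w2 u1 u2 e : int) : A * w1 + B * w2 <= c ->
  A * u1 + B * u2 <= 0 -> 0 <= (e - w1) * u1 ->
  B * (w2 * `|u1| + `|e - w1| * u2) + (A * e - c) * `|u1| <= 0.
Proof.
move=> h1 h2 h3; have E : (e - w1) * `|u1| = `|e - w1| * u1 by nia.
have -> : B * (w2 * `|u1| + `|e - w1| * u2) + (A * e - c) * `|u1| =
    `|u1| * (A * w1 + B * w2 - c) + `|e - w1| * (A * u1 + B * u2).
  transitivity (`|u1| * (A * w1 + B * w2 - c) + A * ((e - w1) * `|u1|) + B * (`|e - w1| * u2)).
    by ring.
  by rewrite E; ring.
by rewrite ler_wnDr ?mulr_ge0_le0 ?subr_le0.
Qed.

Section Gap.
Variables m n : nat.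
Implicit Types (T W : {set grid m n}) (a b c d x w : grid m n).

Lemma grid_ex (i j : int) : 0 <= i -> i < m%:Z -> 0 <= j -> j < n%:Z ->
  exists x, pt x = (i, j).
Proof.
case: i => // i _; case: j => [] // j im _ jn.
by exists (Ordinal (im : (i < m)%N), Ordinal (jn : (j < n)%N)).
Qed.

Definition border_coord (k : nat) (s : bool) : int := if s then k%:Z - 1 else 0.

(** Two real half-planes with a common point share a whole ray from it. The ray leaves the grid at a
    border point of both half-planes, whose neighbouring lattice points are not in the wedge, so
    [gap_on_side] applies. *)
Lemma wedge_gap a b c d w : b \notin half a b -> w \in wedge a b c d ->
  (forall x, x \in wedge a b c d -> ~~ on_border x) ->
  (exists (i : 'I_m) (s : bool), jump (pt a) (pt b) i%:Z (border_coord n s) &&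
     jump (pt c) (pt d) i%:Z (border_coord n s)) \/
  (exists (j : 'I_n) (s : bool), jump (quarter_turn (pt a)) (quarter_turn (pt b)) j%:Z (- border_coord m s) &&
     jump (quarter_turn (pt c)) (quarter_turn (pt d)) j%:Z (- border_coord m s)).
Proof.
move=> bT; rewrite /wedge inE => /andP[w1 w2] nb.
have [v1 [c1 H1]] := half_lin a b; have [v2 [c2 H2]] := half_lin c d.
have v1N : ~~ ((v1.1 == 0) && (v1.2 == 0)).
  apply/negP => /andP[/eqP e1 /eqP e2]; move: bT w1; rewrite !H1.
  by rewrite /dot e1 e2 !mul0r => /negP.
(* [u] runs along the boundary of the first half-plane, with the sign that recedes in the second. *)
have [u [uN u1 u2]] : exists u : int * int, [/\ ~~ ((u.1 == 0) && (u.2 == 0)), dot v1 u <= 0 & dot v2 u <= 0].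
  case: (lerP (dot v2 (v1.2, - v1.1)) 0) => h.
    exists (v1.2, - v1.1); rewrite /= oppr_eq0 andbC; split=> //.
    by rewrite /dot /=; lia.
  exists (- v1.2, v1.1); rewrite /= oppr_eq0 andbC; split=> //.
    by rewrite /dot /=; lia.
  by move: h; rewrite /dot /=; lia.
move: w1 w2; rewrite H1 H2 => w1 w2.
have [m0 n0] : 0 < m%:Z /\ 0 < n%:Z by move: (ltn_ord w.1) (ltn_ord w.2); lia.
have wb : [/\ 0 <= (pt w).1, (pt w).1 <= m%:Z - 1, 0 <= (pt w).2 & (pt w).2 <= n%:Z - 1].
  by rewrite /pt /=; move: (ltn_ord w.1) (ltn_ord w.2); split; lia.
have sideE1 (i j : int) : 0 <= i -> i < m%:Z -> 0 <= j -> j < n%:Z -> side (pt a) (pt b) (i, j) = (dot v1 (i, j) <= c1).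
  by move=> i0 im j0 jn; have [x xE] := grid_ex i0 im j0 jn; rewrite -xE -H1 mem_half.
have sideE2 (i j : int) : 0 <= i -> i < m%:Z -> 0 <= j -> j < n%:Z -> side (pt c) (pt d) (i, j) = (dot v2 (i, j) <= c2).
  by move=> i0 im j0 jn; have [x xE] := grid_ex i0 im j0 jn; rewrite -xE -H2 mem_half.
have bord (i j : int) : 0 <= i -> i < m%:Z -> 0 <= j -> j < n%:Z ->
    [|| i == 0, i == m%:Z - 1, j == 0 | j == n%:Z - 1] ->
    (dot v1 (i, j) <= c1) && (dot v2 (i, j) <= c2) = false.
  move=> i0 im j0 jn Hb; have [x xE] := grid_ex i0 im j0 jn; rewrite -xE -H1 -H2.
  rewrite -in_setI; apply/negbTE/negP => /nb /negP; apply.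
  move: xE Hb; rewrite /on_border /pt => -[<- <-]; clear; lia.
have shape (v : int * int) (c0 e1 e2 : int) : (dot v (e1, e2) <= c0) = (v.2 * e2 + (v.1 * e1 - c0) <= 0).
  by rewrite /dot /=; apply/idP/idP; lia.
have shape' (v : int * int) (c0 e1 e2 : int) : (dot v (e1, e2) <= c0) = (v.1 * e1 + (v.2 * e2 - c0) <= 0).
  by rewrite /dot /=; apply/idP/idP; lia.
have [wb1 wb2 wb3 wb4] := wb.
have [] := @ray_exit (pt w) u (m%:Z - 1) (n%:Z - 1) wb1 wb2 wb3 wb4 uN.
- move=> [e [ee u0 eu nu0 nuL]]; right.
  have eb : 0 <= e /\ e < m%:Z by case: ee => ->; split=> //; lia.
  case: eb => e0 em.
  have key (v : int * int) (c0 : int) : dot v (pt w) <= c0 -> dot v u <= 0 ->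
     v.2 * ((pt w).2 * `|u.1| + `|e - (pt w).1| * u.2) + (v.1 * e - c0) * `|u.1| <= 0.
    by move=> h1 h2; apply: exit_value.
  have [||j [j0 jL J1 J2]] := @gap_on_side v1.2 (v1.1 * e - c1) v2.2 (v2.1 * e - c2) (n%:Z - 1) _ `|u.1| _ nu0 nuL (key _ _ w1 u1) (key _ _ w2 u2).
  + by rewrite normr_gt0.
  + move=> j j0 jL; rewrite -!shape; apply: bord => //; first lia.
    by case: ee => ->; rewrite eqxx ?orbT.
  have jn : (`|j| < n)%N by lia.
  have jE : (`|j|%N : int) = j by lia.
  have eE : e = border_coord m (e != 0).
    by rewrite /border_coord; case: ee => ->; [rewrite eqxx|case: eqP].
  exists (Ordinal jn), (e != 0); rewrite -eE /= jE /jump.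
  have rotE k : (k, - e) = quarter_turn (e, k) by [].
  rewrite !rotE !side_quarter_turn !sideE1 ?sideE2 -?shape; try lia.
  by rewrite !shape J1 J2.
move=> [e [ee u0 eu nu0 nuL]]; left.
have eb : 0 <= e /\ e < n%:Z by case: ee => ->; split=> //; lia.
case: eb => e0 em.
have key (v : int * int) (c0 : int) : dot v (pt w) <= c0 -> dot v u <= 0 ->
   v.1 * ((pt w).1 * `|u.2| + `|e - (pt w).2| * u.1) + (v.2 * e - c0) * `|u.2| <= 0.
  by move=> h1 h2; apply: exit_value => //; rewrite addrC.
have [||j [j0 jL J1 J2]] := @gap_on_side v1.1 (v1.2 * e - c1) v2.1 (v2.2 * e - c2) (m%:Z - 1) _ `|u.2| _ nu0 nuL (key _ _ w1 u1) (key _ _ w2 u2).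
+ by rewrite normr_gt0.
+ move=> j j0 jL; rewrite -!shape'; apply: bord => //; first lia.
  by case: ee => ->; rewrite eqxx ?orbT.
have jn : (`|j| < m)%N by lia.
have jE : (`|j|%N : int) = j by lia.
have eE : e = border_coord n (e != 0).
  by rewrite /border_coord; case: ee => ->; [rewrite eqxx|case: eqP].
exists (Ordinal jn), (e != 0); rewrite -eE /= jE /jump.
rewrite !sideE1 ?sideE2 -?shape'; try lia.
by rewrite !shape' J1 J2.
Qed.

Definition borderless (q : (grid m n * grid m n) * (grid m n * grid m n)) : bool :=
  [&& coprime_pair (pt q.1.1) (pt q.1.2), wedge q.1.1 q.1.2 q.2.1 q.2.2 != set0 &
      [forall x in wedge q.1.1 q.1.2 q.2.1 q.2.2, ~~ on_border x]].

(** A gap between horizontal neighbours is chosen in [2 * m] ways, and at most [2 * m * n ^ 2]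
    segments jump there by [card_jump]. Two segments at one gap give [8 * m ^ 3 * n ^ 4], and
    symmetrically for vertical gaps. *)
Lemma card_borderless :
  (#|[set q | borderless q]| <= 8 * (m ^ 3 * n ^ 4 + m ^ 4 * n ^ 3))%N.
Proof.
pose Jh (i : int) (r : int) := [set p : grid m n * grid m n | jump (pt p.1) (pt p.2) i r].
pose Jv (i : int) (r : int) := [set p : grid m n * grid m n | jump (quarter_turn (pt p.1)) (quarter_turn (pt p.2)) i r].
have cJh i r : (#|Jh i r| <= 2 * m * (n * n))%N.
  have := @card_jump (grid m n) 'I_n m fst snd (fun j => (j : nat)%:Z) i r.
  by rewrite card_ord; apply => -[? ?] [? ?].
have cJv i r : (#|Jv i r| <= 2 * n * (m * m))%N.
  have := @card_jump (grid m n) 'I_m n snd fst (fun j => - (j : nat)%:Z) i r.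
  by rewrite card_ord; apply => -[? ?] [? ?] [-> ->].
pose Sh := [set q : (grid m n * grid m n) * (grid m n * grid m n) |
  [exists i : 'I_m, exists s : bool, jump (pt q.1.1) (pt q.1.2) i%:Z (border_coord n s) && jump (pt q.2.1) (pt q.2.2) i%:Z (border_coord n s)]].
pose Sv := [set q : (grid m n * grid m n) * (grid m n * grid m n) |
  [exists i : 'I_n, exists s : bool, jump (quarter_turn (pt q.1.1)) (quarter_turn (pt q.1.2)) i%:Z (- border_coord m s) && jump (quarter_turn (pt q.2.1)) (quarter_turn (pt q.2.2)) i%:Z (- border_coord m s)]].
have cSh : (#|Sh| <= (m * 2) * ((2 * m * (n * n)) * (2 * m * (n * n))))%N.
  have := @card_cover _ ('I_m * bool)%type Sh (fun p => setX (Jh (p.1 : nat)%:Z (border_coord n p.2)) (Jh (p.1 : nat)%:Z (border_coord n p.2))) ((2 * m * (n * n)) * (2 * m * (n * n))).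
  rewrite card_prod card_ord card_bool; apply.
    move=> [p q]; rewrite inE /= => /existsP[i /existsP[s /andP[h1 h2]]].
    by exists (i, s); rewrite !inE /= h1 h2.
  by move=> i; rewrite cardsX leq_mul.
have cSv : (#|Sv| <= (n * 2) * ((2 * n * (m * m)) * (2 * n * (m * m))))%N.
  have := @card_cover _ ('I_n * bool)%type Sv (fun p => setX (Jv (p.1 : nat)%:Z (- border_coord m p.2)) (Jv (p.1 : nat)%:Z (- border_coord m p.2))) ((2 * n * (m * m)) * (2 * n * (m * m))).
  rewrite card_prod card_ord card_bool; apply.
    move=> [p q]; rewrite inE /= => /existsP[i /existsP[s /andP[h1 h2]]].
    by exists (i, s); rewrite !inE /= h1 h2.
  by move=> i; rewrite cardsX leq_mul.
apply: (@leq_trans #|Sh :|: Sv|).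
  apply/subset_leq_card/fintype.subsetP => -[[a b] [c d]]; rewrite !inE /borderless /=.
  case/and3P=> cp /set0Pn[w wW] /forall_inP nb.
  have [[i [s h]]|[i [s h]]] := wedge_gap (end_notin cp) wW nb.
    by apply/orP; left; apply/existsP; exists i; apply/existsP; exists s.
  by apply/orP; right; apply/existsP; exists i; apply/existsP; exists s.
apply: leq_trans (leq_card_setU Sh Sv) _; apply: leq_trans (leq_add cSh cSv) _.
rewrite !expnS !expn0 !muln1; lia.
Qed.

End Gap.

(** * Counting intersections of two half-planes *)

Section Count.
Variables m n : nat.
Notation quad := ((grid m n * grid m n) * (grid m n * grid m n))%type.
Implicit Types (T W : {set grid m n}) (a b c d x w : grid m n) (q : quad).

Definition two_lin W : Prop := exists T1 T2, [/\ lin T1, lin T2 & W = T1 :&: T2].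

Definition two_lins : {set {set grid m n}} := [set W | `[< two_lin W >]].

Definition convex q : bool := convex_quad (pt q.1.1) (pt q.1.2) (pt q.2.1) (pt q.2.2).

Definition prime_quads : {set quad} :=
  [set q | [&& coprime_pair (pt q.1.1) (pt q.1.2), coprime_pair (pt q.2.1) (pt q.2.2) & convex q]].

Let qwedge q := wedge q.1.1 q.1.2 q.2.1 q.2.2.
Let qstable q := stable q.1.1 q.1.2 q.2.1 q.2.2.
Let swap q : quad := (q.2, q.1).

Lemma card_lins : (#|[set T : {set grid m n} | `[< lin T >]]| <= (m * n) ^ 2 + 2)%N.
Proof.
have -> : ((m * n) ^ 2 + 2 = #|{: option (option (grid m n * grid m n))}|)%N.
  by rewrite !card_option !card_prod !card_ord addn2 mulnn.
pose f (o : option (option (grid m n * grid m n))) : {set grid m n} :=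
  match o with None => set0 | Some None => setT | Some (Some p) => half p.1 p.2 end.
apply: leq_trans (leq_imset_card f predT).
apply/subset_leq_card/fintype.subsetP => T; rewrite inE => /asboolP lT.
have [->|T0] := eqVneq T set0; first by apply/imsetP; exists None.
have [->|TT] := eqVneq T setT; first by apply/imsetP; exists (Some None).
have [a [b [_ ->]]] := lin_half lT T0 TT.
by apply/imsetP; exists (Some (Some (a, b))).
Qed.

(** * Degenerate quadruples *)

Lemma collinear_eq (a b c c' : int * int) : a != b -> orient a b c = 0 -> orient a b c' = 0 ->
  (if a.2 == b.2 then c.1 = c'.1 else c.2 = c'.2) -> c = c'.
Proof.
case: a b c c' => [a1 a2] [b1 b2] [c1 c2] [d1 d2]; rewrite xpair_eqE /orient /det /=.
case: (eqVneq a2 b2) => [->|ab2].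
  rewrite andbT => ab1; rewrite !subrr !mul0r !subr0 => h1 h2 ->; congr (_, _).
  by apply: (addIr (- b2)); apply: (@mulfI _ (b1 - a1)); rewrite ?subr_eq0 1?eq_sym // h1 h2.
move=> _ h1 h2 E; rewrite -E in h2 *; congr (_, _).
apply: (addIr (- a1)); apply: (@mulfI _ (b2 - a2)); first by rewrite subr_eq0 eq_sym.
by transitivity ((b1 - a1) * (c2 - a2)); lia.
Qed.

Definition flat q : bool :=
  (pt q.1.1 != pt q.1.2) && (orient (pt q.1.1) (pt q.1.2) (pt q.2.1) == 0).

(** A point on a given line is determined by its abscissa if the line is horizontal and by its
    ordinate otherwise; this replaces a factor [m * n] by [m + n]. *)
Lemma card_flat : (#|[set q | flat q]| <= (m * n) ^ 3 * (m + n))%N.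
Proof.
pose f q : (grid m n * grid m n * grid m n) * ('I_m + 'I_n) :=
  ((q.1.1, q.1.2, q.2.2),
   if (pt q.1.1).2 == (pt q.1.2).2 then inl q.2.1.1 else inr q.2.1.2).
have -> : ((m * n) ^ 3 * (m + n) = #|{: (grid m n * grid m n * grid m n) * ('I_m + 'I_n)}|)%N.
  by rewrite !card_prod card_sum !card_ord !expnS expn0 muln1 !mulnA.
rewrite -(card_in_imset (f := f)) ?max_card // => -[[a b] [c d]] [[a' b'] [c' d']].
rewrite !inE /flat /f /= => /andP[ab /eqP oc] /andP[_ /eqP oc'] [Ea Eb Ed].
rewrite -{}Ea -{}Eb -{}Ed in oc' * => E.
suff /pt_inj -> : pt c = pt c' by [].
apply: (collinear_eq ab oc oc').
by move: E; rewrite /pt /=; case: ifP => _ [->].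
Qed.

Lemma card_preim_inj (T : finType) (f : T -> T) (P : pred T) : injective f ->
  (#|[set x | P (f x)]| <= #|[set x | P x]|)%N.
Proof.
move=> fI; rewrite -(card_imset _ fI); apply/subset_leq_card/fintype.subsetP => y.
by case/imsetP=> x; rewrite inE => Px ->; rewrite inE.
Qed.

(** Stability makes the four orientations nonnegative. If one of them vanishes, the quadruple is
    [flat] up to the relabellings [f1], [f2], [f3]. *)
Lemma card_stable : (#|[set q | qstable q]| <= #|prime_quads| + 4 * ((m * n) ^ 3 * (m + n)))%N.
Proof.
pose f1 q : quad := (q.1, (q.2.2, q.2.1)).
pose f2 q : quad := (q.2, q.1).
pose f3 q : quad := (q.2, (q.1.2, q.1.1)).
have i1 : injective f1 by move=> [[? ?] [? ?]] [[? ?] [? ?]] [-> -> -> ->].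
have i2 : injective f2 by move=> [[? ?] [? ?]] [[? ?] [? ?]] [-> -> -> ->].
have i3 : injective f3 by move=> [[? ?] [? ?]] [[? ?] [? ?]] [-> -> -> ->].
have c0 := card_flat.
have c1 := leq_trans (card_preim_inj flat i1) c0.
have c2 := leq_trans (card_preim_inj flat i2) c0.
have c3 := leq_trans (card_preim_inj flat i3) c0.
have cov : [set q | qstable q] \subset prime_quads :|: ([set q | flat q] :|: ([set q | flat (f1 q)] :|: ([set q | flat (f2 q)] :|: [set q | flat (f3 q)]))).
  apply/fintype.subsetP => -[[a b] [c d]]; rewrite !inE /qstable /stable /convex /convex_quad /flat /f1 /f2 /f3 /=.
  move=> /and5P[cp1 cp2 h1 h2 /andP[h3 h4]]; rewrite cp1 cp2 !coprime_neq //=.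
  move: h1 h2 h3 h4; rewrite !mem_half /side.
  have -> : orient (pt b) (pt c) (pt d) = orient (pt c) (pt d) (pt b) by rewrite /orient /det /=; ring.
  have -> : orient (pt d) (pt a) (pt b) = orient (pt a) (pt b) (pt d) by rewrite /orient /det /=; ring.
  case: ltrgt0P => //= _; case: ltrgt0P => //= _; case: ltrgt0P => //= _; case: ltrgt0P => //= _.
apply: leq_trans (subset_leq_card cov) _.
apply: leq_trans (leq_card_setU _ _) _; rewrite leq_add2l mulSn.
apply: leq_trans (leq_card_setU _ _) _; rewrite leq_add // mulSn.
apply: leq_trans (leq_card_setU _ _) _; rewrite leq_add // mul2n -addnn.
by apply: leq_trans (leq_card_setU _ _) _; rewrite leq_add.
Qed.

Lemma card_fibers (S : {set {set grid m n}}) (A : {set quad}) :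
  (\sum_(W in S) #|[set q in A | qwedge q == W]| <= #|A|)%N.
Proof.
rewrite -[#|A|]sum1_card (partition_big qwedge predT) //= [X in (_ <= X)%N](bigID (mem S)) /=.
apply: leq_trans (leq_addr _ _); apply: leq_sum => W _.
by rewrite -sum1_card; apply: eq_leq; apply: eq_bigl => q; rewrite inE.
Qed.

(** Half-planes and wedges missing the border are set aside. Any other set has two zeros that are
    not jointly separable, by [lin_pairwise], hence a stable quadruple and also its exchange of
    edges: at least two in its fibre. *)
Lemma two_lins_upper :
  (2 * #|two_lins| <= #|prime_quads| + 4 * ((m * n) ^ 3 * (m + n)) +
     2 * ((m * n) ^ 2 + 2) + 2 * (8 * (m ^ 3 * n ^ 4 + m ^ 4 * n ^ 3)))%N.
Proof.
pose L := [set T : {set grid m n} | `[< lin T >]].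
pose B := qwedge @: [set q | borderless q].
pose S := two_lins :\: (L :|: B).
have cB : (#|B| <= 8 * (m ^ 3 * n ^ 4 + m ^ 4 * n ^ 3))%N.
  by apply: leq_trans (leq_imset_card _ _) (card_borderless m n).
have cS : (2 * #|S| <= #|prime_quads| + 4 * ((m * n) ^ 3 * (m + n)))%N.
  apply: leq_trans card_stable; apply: leq_trans (card_fibers S _).
  rewrite mulnC -sum_nat_const; apply: leq_sum => W.
  rewrite !inE negb_or => /andP[/andP[/asboolP nL WB] /asboolP[T1 [T2 [l1 l2 WE]]]].
  have W0 : W != set0 by apply/eqP => E; apply: nL; rewrite E; apply: lin_set0.
  have nT1 : T1 != set0 by apply: contra W0 => /eqP E; rewrite WE E set0I.
  have nT2 : T2 != set0 by apply: contra W0 => /eqP E; rewrite WE E setI0.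
  have nT1' : T1 != setT by apply/eqP => E; apply: nL; rewrite WE E setTI.
  have nT2' : T2 != setT by apply/eqP => E; apply: nL; rewrite WE E setIT.
  have [a [b [cp1 E1]]] := lin_half l1 nT1 nT1'.
  have [c [d [cp2 E2]]] := lin_half l2 nT2 nT2'.
  have [w0 w0W bw0] : exists2 w0, w0 \in W & on_border w0.
    apply/exists_inP; apply: contraR WB; rewrite negb_exists_in => nb.
    apply/imsetP; exists ((a, b), (c, d)); last by rewrite /qwedge /wedge /= -E1 -E2.
    by rewrite inE /borderless /= cp1 /wedge -E1 -E2 -WE W0 nb.
  have [z [z' [zW z'W nj]]] : exists z z', [/\ z \notin W, z' \notin W & ~ joint W z z'].
    apply: contrapT => H; apply: nL; apply: (lin_pairwise w0W bw0) => z z' zW z'W.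
    by apply: contrapT => nj; apply: H; exists z, z'.
  rewrite WE in W0 zW z'W nj.
  have [a' [b' [c' [d' [st WE']]]]] := stable_exists l1 l2 W0 zW z'W nj.
  have st' : qstable ((c', d'), (a', b')).
    by move: st; rewrite /qstable /stable /= => /and5P[-> -> -> -> /andP[-> ->]].
  have ne : ((a', b'), (c', d')) != ((c', d'), (a', b')) :> quad.
    apply/eqP => -[ea eb _ _]; move: st => /and5P[cp _ _ + _].
    by rewrite -ea -eb; apply/negP; apply: end_notin.
  have <- : #|[set ((a', b'), (c', d')); ((c', d'), (a', b'))] : {set quad}| = 2%N by rewrite cards2 ne.
  apply/subset_leq_card/fintype.subsetP => q; rewrite !inE => /orP[] /eqP ->.
    by rewrite /qstable /qwedge /= st WE' WE eqxx.
  by rewrite st' /qwedge /wedge /= setIC -[_ :&: _]/(wedge a' b' c' d') WE' WE eqxx.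
have : (#|two_lins| <= #|S| + (#|L| + #|B|))%N.
  rewrite -(cardsID (L :|: B) two_lins) addnC leq_add2l.
  apply: leq_trans (leq_card_setU L B).
  by apply/subset_leq_card; apply: subsetIr.
rewrite -(leq_pmul2l (isT : 0 < 2)%N) => /leq_trans; apply.
rewrite !(mulnDr 2 #|S|) (mulnDr 2 #|L|) addnA; apply: leq_add; last by rewrite leq_mul.
by apply: leq_add => //; rewrite leq_mul // card_lins.
Qed.

(** Away from the borderless quadruples, [wedge_unique] leaves at most a quadruple and its exchange
    in each fibre of the wedge map. *)
Lemma two_lins_lower :
  (#|prime_quads| <= 2 * #|two_lins| + 8 * (m ^ 3 * n ^ 4 + m ^ 4 * n ^ 3))%N.
Proof.
pose B : {set quad} := [set q | borderless q].
rewrite -(cardsID B prime_quads) addnC; apply: leq_add; last first.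
  apply: leq_trans (card_borderless m n).
  by apply/subset_leq_card; apply: subsetIr.
set A := _ :\: _.
have -> : #|A| = (\sum_(W in two_lins) #|[set q in A | qwedge q == W]|)%N.
  rewrite -[LHS]sum1_card (partition_big qwedge (mem two_lins)) /=.
    by apply: eq_bigr => W _; rewrite -sum1_card; apply: eq_bigl => q; rewrite [RHS]inE.
  move=> q _; rewrite inE; apply/asboolP; exists (half q.1.1 q.1.2), (half q.2.1 q.2.2).
  by split=> //; apply: half_lin.
rewrite mulnC -sum_nat_const; apply: leq_sum => W _.
have [->|/set0Pn[q0 q0A]] := eqVneq [set q in A | qwedge q == W] set0; first by rewrite cards0.
apply: (@leq_trans #|[set q0; swap q0]|); last by rewrite cards2; case: eqP.
apply/subset_leq_card/fintype.subsetP => q; move: q0A; rewrite !inE /A.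
move: q0 q => [[a b] [c d]] [[a' b'] [c' d']]; rewrite /borderless /convex /=.
move=> /andP[/and4P[nb cp1 cp2 cq] /eqP WE] /andP[/and4P[_ cp1' cp2' cq'] /eqP WE'].
rewrite /qwedge /= in WE WE'.
have aW : a \in wedge a b c d.
  by have /and5P[_ _ acd _ _] := convex_stable cp1 cp2 cq; rewrite inE start_in.
move: nb; rewrite cp1 /=; have -> : wedge a b c d != set0 by apply/set0Pn; exists a.
rewrite negb_forall_in /= => /exists_inP[w0 w0W]; rewrite negbK => bw0.
have WW : wedge a' b' c' d' = wedge a b c d by rewrite WE.
by have [->|->] := wedge_unique cp1 cp2 cq cp1' cp2' cq' WW w0W bw0; rewrite /swap /= eqxx ?orbT.
Qed.

End Count.

(** * Threshold functions are half-planes *)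

Section Hull.
Variables (R : realType) (m n : nat).
Implicit Types (A W : {set grid m n}) (x y z : grid m n) (f g : grid_fun m n).
Notation E := (convex_lmodType (R^o * R^o)%type).

Lemma convex_comb (Y : set E) (p q : E) (s t : R) : convex_set Y -> Y p -> Y q ->
  0 <= s -> 0 <= t -> s + t = 1 -> Y (s * p.1 + t * q.1, s * p.2 + t * q.2).
Proof.
move=> cY Yp Yq s0 t0 st; have s1 : s <= 1 by rewrite -st lerDl.
have := cY p q (Itv01 s0 s1); rewrite !in_setE => /(_ Yp Yq).
by rewrite /conv /= /unstable.onem; have -> : 1 - s = t by rewrite -st addrC addKr.
Qed.

Lemma grid_point_pt x : grid_point R x = ((pt x).1%:~R, (pt x).2%:~R) :> R^o * R^o.
Proof. by rewrite /grid_point /pt. Qed.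

Lemma hull_comb A x y z (i j k : int) : x \in A -> y \in A -> z \in A ->
  0 <= i -> 0 <= j -> 0 <= k -> 0 < i + j + k ->
  grid_hull R A ((i * (pt x).1 + j * (pt y).1 + k * (pt z).1)%:~R / (i + j + k)%:~R,
                 (i * (pt x).2 + j * (pt y).2 + k * (pt z).2)%:~R / (i + j + k)%:~R).
Proof.
move=> xA yA zA i0 j0 k0 s0 Y [cY AY].
have Ym u : u \in A -> Y (grid_point R u) by move=> uA; apply: AY; exists u.
have sN : (i + j + k)%:~R != 0 :> R by rewrite intr_eq0 gt_eqF.
have [ij0|ijN] := eqVneq (i + j) 0.
  have -> : i = 0 by lia.
  have -> : j = 0 by lia.
  have kN : k%:~R != 0 :> R by rewrite intr_eq0; lia.
  rewrite !mul0r !add0r; have := Ym _ zA; rewrite grid_point_pt.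
  by rewrite !rmorphM /= ![_ * _ / _]mulrAC !divff // !mul1r.
have ij0 : 0 < i + j by lia.
have ijR : 0 < (i + j)%:~R :> R by rewrite ltr0z.
have sR : 0 < (i + j + k)%:~R :> R by rewrite ltr0z.
have iR : 0 <= i%:~R :> R by rewrite ler0z.
have jR : 0 <= j%:~R :> R by rewrite ler0z.
have kR : 0 <= k%:~R :> R by rewrite ler0z.
have ijN' : i%:~R + j%:~R != 0 :> R by rewrite -rmorphD /= intr_eq0.
have Y1 := @convex_comb Y _ _ (i%:~R / (i + j)%:~R) (j%:~R / (i + j)%:~R) cY (Ym _ xA) (Ym _ yA).
have {}Y1 := Y1 (divr_ge0 iR (ltW ijR)) (divr_ge0 jR (ltW ijR)).
have {}Y1 := Y1 ltac:(by rewrite -mulrDl -rmorphD /= divff // gt_eqF).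
have Y2 := @convex_comb Y _ _ ((i + j)%:~R / (i + j + k)%:~R) (k%:~R / (i + j + k)%:~R) cY Y1 (Ym _ zA).
have {}Y2 := Y2 (divr_ge0 (ltW ijR) (ltW sR)) (divr_ge0 kR (ltW sR)).
have {}Y2 := Y2 ltac:(by rewrite -mulrDl -rmorphD /= divff // gt_eqF).
move: Y2; rewrite !grid_point_pt /= !rmorphD /= !rmorphM /=.
rewrite !rmorphD /= in sN.
by congr (Y (_, _)); field; rewrite sN ijN'.
Qed.

(** A nonnegative relation among differences [z - w], divided by the sum of its coefficients, is a
    common point of the two hulls; so disjoint hulls satisfy the hypothesis of [tangent].
    Conversely, the hulls lie in complementary real half-planes. *)
Lemma threshold_lin f : threshold R f <-> lin (level_set true f).
Proof.
have memF x : (x \in level_set false f) = (x \notin level_set true f).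
  by rewrite !inE; case: (f x).
split=> [thr|[v [c Hv]]].
  have [->|W0] := eqVneq (level_set true f) set0; first exact: lin_set0.
  have [->|WT] := eqVneq (level_set true f) setT; first exact: lin_setT.
  have Z0 : level_set false f != set0.
    apply: contra WT => /eqP E; apply/eqP/setP => x.
    by have := memF x; rewrite E !inE; case: (f x).
  have nD : pos_free (diffs (level_set true f) (level_set false f)).
    move=> u1 u2 u3 [w1 [z1 [w1W z1Z ->]]] [w2 [z2 [w2W z2Z ->]]] [w3 [z3 [w3W z3Z ->]]].
    move=> i j k i0 j0 k0 E1 E2.
    have [s0|sN] := ltrP 0 (i + j + k); last by move: i0 j0 k0 sN; clear; split; lia.
    have h1 := hull_comb w1W w2W w3W i0 j0 k0 s0.
    have h2 := hull_comb z1Z z2Z z3Z i0 j0 k0 s0.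
    exfalso; have /seteqP[+ _] := thr; apply; split; first exact: h2.
    move: h1; congr (grid_hull R _ (_%:~R / _, _%:~R / _)).
      by move: E1; rewrite /vec /=; clear; lia.
    by move: E2; rewrite /vec /=; clear; lia.
  have [|a [b [_ _ _ H1 H2]]] := tangent W0 Z0 nD.
    by move=> *; rewrite inE memF orbN.
  suff -> : level_set true f = half a b by apply: half_lin.
  apply/setP => x; rewrite mem_half; case: (boolP (x \in level_set true f)) => xW.
    by rewrite H1.
  by apply/esym/negbTE/H2; rewrite memF.
pose Y1 : set E := [set p | v.1%:~R * p.1 + v.2%:~R * p.2 <= c%:~R]%classic.
pose Y0 : set E := [set p | c%:~R < v.1%:~R * p.1 + v.2%:~R * p.2]%classic.
have dotE x : v.1%:~R * (grid_point R x).1 + v.2%:~R * (grid_point R x).2 = (dot v (pt x))%:~R :> R.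
  by rewrite grid_point_pt /dot rmorphD /= !rmorphM.
have comb (p q : E) (l : {i01 R}) :
    v.1%:~R * (conv l p q).1 + v.2%:~R * (conv l p q).2 =
    l%:num * (v.1%:~R * p.1 + v.2%:~R * p.2) + (1 - l%:num) * (v.1%:~R * q.1 + v.2%:~R * q.2) :> R.
  by rewrite /conv /= /unstable.onem /GRing.scale /=; ring.
have c1 : convex_set Y1.
  move=> p q l; rewrite !in_setE /Y1 /= comb => h1 h2.
  rewrite [leRHS](_ : _ = l%:num * c%:~R + (1 - l%:num) * c%:~R); last by ring.
  by rewrite lerD // ler_wpM2l // subr_ge0.
have c0 : convex_set Y0.
  move=> p q l; rewrite !in_setE /Y0 /= comb => h1 h2.
  rewrite [ltLHS](_ : _ = l%:num * c%:~R + (1 - l%:num) * c%:~R); last by ring.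
  have [->|lN] := eqVneq (l%:num) 0; first by rewrite !mul0r !add0r subr0 !mul1r.
  by apply: ltr_leD; [rewrite ltr_pM2l // lt_def lN /=|apply: ler_wpM2l; [rewrite subr_ge0|exact: ltW]].
apply/seteqP; split=> // p [h0 h1].
have p1 : Y1 p.
  apply: h1; split=> // q [x /= xW <-]; rewrite /Y1 /= dotE ler_int -Hv.
  exact: xW.
have p0 : Y0 p.
  apply: h0; split=> // q [x /= xW <-]; rewrite /Y0 /= dotE ltr_int ltNge -Hv -memF.
  exact: xW.
by move: p0 p1; rewrite /Y0 /Y1 /= ltNge => /negP.
Qed.

Lemma level_set_inj : injective (@level_set m n true).
Proof.
move=> f g /setP E; apply/ffunP => x; have := E x; rewrite !inE.
by case: (f x); case: (g x).
Qed.

Lemma level_set_mem W : level_set true [ffun x => x \in W] = W.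
Proof. by apply/setP => x; rewrite inE ffunE eqb_id. Qed.

Lemma k_threshold_two f : k_threshold R 2 f <-> two_lin (level_set true f).
Proof.
split=> [[S [S2 thr ->]]|[T1 [T2 [l1 l2 E]]]]; last first.
  exists [set [ffun x => x \in T1]; [ffun x => x \in T2]]%SET; split.
  - by rewrite cards2; case: eqP.
  - by move=> g; rewrite !inE => /orP[] /eqP ->; apply/threshold_lin; rewrite level_set_mem.
  rewrite E; apply/setP => x; rewrite inE; apply/andP/bigcapP.
    by move=> [h1 h2] g; rewrite !inE => /orP[] /eqP ->; rewrite ffunE ?h1 ?h2.
  move=> H; split; [have := H [ffun x => x \in T1]|have := H [ffun x => x \in T2]];
  by rewrite !inE eqxx ?orbT ffunE eqb_id; apply.
have lS g : g \in S -> lin (level_set true g) by move=> /thr /threshold_lin.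
have [->|/set0Pn[g1 g1S]] := eqVneq S set0.
  exists setT, setT; rewrite big_set0 setIT; split=> //; exact: lin_setT.
have [E|/set0Pn[g2]] := eqVneq (S :\ g1)%SET set0.
  exists setT, (level_set true g1); rewrite setTI; split; [exact: lin_setT|exact: lS|].
  by rewrite (big_setD1 g1) //= E big_set0 setIT.
rewrite in_setD1 => /andP[g21 g2S].
exists (level_set true g1), (level_set true g2); split; try exact: lS.
rewrite (big_setD1 g1) //= (big_setD1 g2) /=; last by rewrite in_setD1 g21.
suff -> : (S :\ g1 :\ g2)%SET = set0 by rewrite big_set0 setIT.
apply/eqP; rewrite -cards_eq0 -leqn0.
move: S2; rewrite (cardsD1 g1) g1S (cardsD1 g2) in_setD1 g21 g2S.
by rewrite !add1n !ltnS.
Qed.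

Lemma num_two_threshold : num_k_threshold R 2 m n = #|two_lins m n|.
Proof.
rewrite /num_k_threshold -(card_imset _ level_set_inj); congr #|pred_of_set _|.
apply/setP => W; apply/imsetP/idP => [[f]|].
  by rewrite inE => /asboolP /k_threshold_two H ->; rewrite inE; apply/asboolP.
rewrite inE => /asboolP H; exists [ffun x => x \in W]; last by rewrite level_set_mem.
by rewrite inE; apply/asboolP/k_threshold_two; rewrite level_set_mem.
Qed.

End Hull.

(** * Equidistribution modulo d *)

Section NatScope.
Local Open Scope nat_scope.

Definition nat_dist (x a : nat) : nat := `|(Posz x - Posz a)%R|.

(** Adding [d - 1 - a %% d] moves the class of [a] to that of [-1], where passing to the next
    integer increases the quotient by [d]. *)
Lemma sum_congr_mod d a h : (0 < d)%N ->
  (\sum_(0 <= x < h) (d %| nat_dist x a) = (h + (d - 1 - a %% d)) %/ d - (d - 1 - a %% d) %/ d)%N.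
Proof.
move=> d0; have r := ltn_pmod a d0.
elim: h => [|h IH]; first by rewrite big_geq // add0n subnn.
rewrite big_nat_recr //= {}IH addSn divnS // addnC addnBA ?leq_div2r ?leq_addl //.
congr (_ - _)%N; congr (_ + _)%N; congr nat_of_bool.
have -> : ((h + (d - 1 - a %% d)).+1 = h + d - a %% d)%N by lia.
have e : (d %| h + d - a %% d) = (d %| nat_dist h (a %% d)).
  case: (leqP (a %% d) h) => ha.
    have -> : nat_dist h (a %% d) = h - a %% d by rewrite /nat_dist; lia.
    by rewrite addnC -addnBA // dvdn_addr.
  have -> : nat_dist h (a %% d) = a %% d - h by rewrite /nat_dist; lia.
  have -> : (h + d - a %% d = d - (a %% d - h))%N by lia.
  by rewrite dvdn_subr //; lia.
have aE : (Posz a = Posz (a %/ d) * Posz d + Posz (a %% d))%R.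
  by rewrite -PoszM -PoszD -divn_eq.
rewrite e /nat_dist -[LHS]/(Posz d %| _)%Z -[RHS]/(Posz d %| _)%Z [in LHS]aE.
by rewrite opprD addrCA rpredDl // rpredN dvdz_mull.
Qed.

Lemma interval_congr (m d a : nat) (P : pred nat) : (0 < d)%N ->
  (forall i j k, i <= j -> j <= k -> k < m -> P i -> P k -> P j)%N ->
  (d * (\sum_(x < m) (P x && (d %| nat_dist x a))) <= \sum_(x < m) P x + d)%N /\
  (\sum_(x < m) P x <= d * (\sum_(x < m) (P x && (d %| nat_dist x a))) + d)%N.
Proof.
move=> d0 Pc.
have H F : (\sum_(x < m) (P x && F (x : nat)) = \sum_(0 <= x < m | P x) F x)%N.
  rewrite big_mkord [RHS]big_mkcond /=; apply: eq_bigr => x _.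
  by case: (P x).
have H0 : (\sum_(x < m) P x = \sum_(0 <= x < m | P x) 1)%N.
  by rewrite big_mkord [RHS]big_mkcond /=; apply: eq_bigr => x _; case: (P x).
rewrite H0 (H (fun x => d %| nat_dist x a)).
have [l [h [lh hm E]]] : exists l h, [/\ (l <= h)%N, (h <= m)%N &
    forall x, (x < m)%N -> P x = (l <= x < h)%N].
  have [ex|nex] := pselect (exists x, P x && (x < m)).
    case: (ex_minnP ex) => l /andP[Pl lm] lmin.
    have ub x : P x && (x < m) -> (x <= m)%N by case/andP=> _ /ltnW.
    case: (ex_maxnP ex ub) => h /andP[Ph hm] hmax.
    exists l, h.+1; rewrite hm ltnW ?ltnS ?lmin ?Ph //; split=> // x xm.
    apply/idP/idP => [Px|/andP[lx xh]]; last exact: (Pc l x h).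
    by rewrite ltnS lmin ?hmax ?Px.
  exists 0%N, 0%N; split=> // x xm; rewrite andbF; apply/negbTE/negP => Px.
  by apply: nex; exists x; rewrite Px.
have S F : (\sum_(0 <= x < m | P x) F x = \sum_(l <= x < h) F x)%N.
  rewrite [RHS](big_nat_widen _ _ m) // [RHS](big_nat_widenl l 0) //.
  rewrite big_nat_cond [RHS]big_nat_cond; apply: eq_bigl => x /=.
  by case: (ltnP x m) => xm; rewrite ?andbF // (E x xm) [(l <= x)%N && _]andbC.
rewrite !S sum_nat_const_nat muln1.
have := sum_congr_mod a h d0; have := sum_congr_mod a l d0.
rewrite [X in _ -> X = _ -> _](big_cat_nat (n := l)) //=.
set s := (\sum_(l <= x < h) _)%N => ->.
set c := (d - 1 - a %% d)%N.
have e1 := divn_eq (h + c) d; have e2 := divn_eq (l + c) d.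
have r1 := ltn_pmod (h + c) d0; have r2 := ltn_pmod (l + c) d0.
have le1 : (c %/ d <= (l + c) %/ d)%N by rewrite leq_div2r ?leq_addl.
have le2 : (c %/ d <= (h + c) %/ d)%N by rewrite leq_div2r ?leq_addl.
move: e1 e2 r1 r2 le1 le2; move: ((h + c) %/ d) ((h + c) %% d) ((l + c) %/ d) ((l + c) %% d) (c %/ d).
move=> q r q' r' q0 e1 e2 r1 r2 le1 le2 e3.
have es : (q = q' + s)%N by lia.
move: e1; rewrite es mulnDl => e1; rewrite ![(d * _)%N]mulnC; split; lia.
Qed.

Section Equi.
Variables m n : nat.
Implicit Types (K : pred (grid m n)) (a b : grid m n).

Definition row_convex K : Prop :=
  forall (i j k : 'I_m) (y : 'I_n), (i <= j)%N -> (j <= k)%N -> K (i, y) -> K (k, y) -> K (j, y).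

Definition col_convex K : Prop :=
  forall (x : 'I_m) (i j k : 'I_n), (i <= j)%N -> (j <= k)%N -> K (x, i) -> K (x, k) -> K (x, j).

Definition gcd_pair (a b : grid m n) : nat :=
  gcdn `|((pt b).1 - (pt a).1)%R| `|((pt b).2 - (pt a).2)%R|.

Lemma ord_interval (M d a : nat) (P : pred 'I_M) : (0 < d)%N ->
  (forall i j k : 'I_M, (i <= j)%N -> (j <= k)%N -> P i -> P k -> P j) ->
  (d * (\sum_(x < M) (P x && (d %| nat_dist x a))) <= \sum_(x < M) P x + d)%N /\
  (\sum_(x < M) P x <= d * (\sum_(x < M) (P x && (d %| nat_dist x a))) + d)%N.
Proof.
move=> d0 Pc; pose Q (x : nat) := if insub x is Some o then P o else false.
have QP (x : 'I_M) : Q x = P x by rewrite /Q valK.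
have Qc i j k : (i <= j -> j <= k -> k < M -> Q i -> Q k -> Q j)%N.
  move=> ij jk kM; have jM := leq_ltn_trans jk kM; have iM := leq_ltn_trans ij jM.
  rewrite -[i]/(nat_of_ord (Ordinal iM)) -[j]/(nat_of_ord (Ordinal jM)) -[k]/(nat_of_ord (Ordinal kM)).
  by rewrite !QP; apply: Pc.
have := interval_congr a d0 Qc.
have -> : (\sum_(x < M) Q x = \sum_(x < M) P x)%N by apply: eq_bigr => x _; rewrite QP.
by under eq_bigr do rewrite QP.
Qed.

(** The gcd is divisible by [d] when both coordinates are. Summing along columns costs [d * m];
    summing along rows costs [d * n], multiplied by [d] when the two estimates are composed. *)
Lemma equidistribution K a d : (0 < d)%N -> row_convex K -> col_convex K ->
  (d ^ 2 * #|[set b | K b && (d %| gcd_pair a b)]| <= #|[set b | K b]| + d ^ 2 * (m + n))%N /\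
  (#|[set b | K b]| <= d ^ 2 * #|[set b | K b && (d %| gcd_pair a b)]| + d ^ 2 * (m + n))%N.
Proof.
move=> d0 rc cc.
pose dx (x : 'I_m) := d %| nat_dist x a.1.
pose dy (y : 'I_n) := d %| nat_dist y a.2.
have cE (Q : pred (grid m n)) : #|[set b | Q b]| = (\sum_(x < m) \sum_(y < n) Q (x, y))%N.
  rewrite pair_bigA /= -sum1_card big_mkcond /=.
  by apply: eq_bigr => -[x y] _; rewrite inE; case: (Q _).
pose M1 := (\sum_(x < m) \sum_(y < n) (K (x, y) && dy y))%N.
have N1 : (d * #|[set b | K b && (d %| gcd_pair a b)]| <= M1 + d * n)%N /\
          (M1 <= d * #|[set b | K b && (d %| gcd_pair a b)]| + d * n)%N.
  have -> : #|[set b | K b && (d %| gcd_pair a b)]| = (\sum_(y < n) \sum_(x < m) ((K (x, y) && dy y) && dx x))%N.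
    rewrite cE exchange_big /=; apply: eq_bigr => y _; apply: eq_bigr => x _.
    by rewrite /gcd_pair dvdn_gcd /= -andbA [dy y && _]andbC.
  have -> : M1 = \sum_(y < n) \sum_(x < m) (K (x, y) && dy y) by rewrite /M1 exchange_big.
  rewrite big_distrr /=.
  have -> : (d * n = \sum_(y < n) d)%N by rewrite sum_nat_const card_ord mulnC.
  rewrite -!big_split /=; split; apply: leq_sum => y _.
    apply: (ord_interval (P := fun x => K (x, y) && dy y) a.1 d0 _).1.
    by move=> i j k ij jk /andP[h1 ->] /andP[h2 _]; rewrite andbT; apply: (rc i j k).
  apply: (ord_interval (P := fun x => K (x, y) && dy y) a.1 d0 _).2.
  by move=> i j k ij jk /andP[h1 ->] /andP[h2 _]; rewrite andbT; apply: (rc i j k).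
have N2 : (d * M1 <= #|[set b | K b]| + d * m)%N /\ (#|[set b | K b]| <= d * M1 + d * m)%N.
  rewrite cE /M1 big_distrr /=.
  have -> : (d * m = \sum_(x < m) d)%N by rewrite sum_nat_const card_ord mulnC.
  rewrite -!big_split /=; split; apply: leq_sum => x _.
    apply: (ord_interval (P := fun y => K (x, y)) a.2 d0 _).1.
    by move=> i j k ij jk h1 h2; apply: (cc x i j k).
  apply: (ord_interval (P := fun y => K (x, y)) a.2 d0 _).2.
  by move=> i j k ij jk h1 h2; apply: (cc x i j k).
case: N1 N2 => [h1 h2] [h3 h4]; rewrite -mulnn.
have dd : (d <= d * d)%N by rewrite leq_pmulr.
have dm : (d * m <= d * d * m)%N by rewrite leq_mul2r dd orbT.
rewrite mulnDr -mulnA; move: h1 h2 h3 h4; move: (#|_|) M1 (#|_|) => N M N' h1 h2 h3 h4.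
have {}h1 := leq_mul (leqnn d) h1; have {}h2 := leq_mul (leqnn d) h2.
by move: h1 h2; rewrite !mulnDr !mulnA; lia.
Qed.

End Equi.

End NatScope.

(** * Divisibility of an edge of a convex quadrilateral *)

Lemma affine_between (u v : int) (i j k : int) : i <= j -> j <= k ->
  0 < u * i + v -> 0 < u * k + v -> 0 < u * j + v.
Proof.
move=> ij jk; have [u0|u0] := lerP 0 u.
  by move=> h _; apply: lt_le_trans h _; rewrite lerD2r ler_wpM2l.
by move=> _ h; apply: lt_le_trans h _; rewrite lerD2r ler_wnM2l // ltW.
Qed.

(** When [b] moves along a line, the three orientations in which it occurs are affine functions of
    its position. *)
Lemma convex_quad_between (a b b' b'' c d : int * int) (u : int * int) (i j k : int) :
  i <= j -> j <= k ->
  b' = (b.1 + (j - i) * u.1, b.2 + (j - i) * u.2) ->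
  b'' = (b.1 + (k - i) * u.1, b.2 + (k - i) * u.2) ->
  convex_quad a b c d -> convex_quad a b'' c d -> convex_quad a b' c d.
Proof.
move=> ij jk -> -> /and4P[h1 h2 h3 h4] /and4P[k1 k2 _ k4]; apply/and4P; split=> //.
- have E (x : int) : orient a (b.1 + (x - i) * u.1, b.2 + (x - i) * u.2) c =
      det u (vec a c) * x + (orient a b c - det u (vec a c) * i) by rewrite /orient /det /=; ring.
  move: k1; rewrite !E; apply: (affine_between ij jk); by rewrite addrC subrK.
- have E (x : int) : orient (b.1 + (x - i) * u.1, b.2 + (x - i) * u.2) c d =
      det (vec c d) u * x + (orient b c d - det (vec c d) u * i) by rewrite /orient /det /=; ring.
  move: k2; rewrite !E; apply: (affine_between ij jk); by rewrite addrC subrK.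
have E (x : int) : orient d a (b.1 + (x - i) * u.1, b.2 + (x - i) * u.2) =
    det (vec d a) u * x + (orient d a b - det (vec d a) u * i) by rewrite /orient /det /=; ring.
move: k4; rewrite !E; apply: (affine_between ij jk); by rewrite addrC subrK.
Qed.

Section Quads.
Variables m n : nat.
Notation quad := ((grid m n * grid m n) * (grid m n * grid m n))%type.
Implicit Types (a b c : grid m n) (q : quad).

Lemma convex_row a c d : row_convex (fun b => convex ((a, b), (c, d))).
Proof.
move=> i j k y ij jk; rewrite /convex /=.
by apply: (@convex_quad_between _ _ _ _ _ _ (1, 0) (i : nat)%:Z (j : nat)%:Z (k : nat)%:Z) => //;
  rewrite /pt /= !mulr0 !mulr1 !addr0 addrC subrK.
Qed.

Lemma convex_col a c d : col_convex (fun b => convex ((a, b), (c, d))).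
Proof.
move=> x i j k ij jk; rewrite /convex /=.
by apply: (@convex_quad_between _ _ _ _ _ _ (0, 1) (i : nat)%:Z (j : nat)%:Z (k : nat)%:Z) => //;
  rewrite /pt /= !mulr0 !mulr1 !addr0 addrC subrK.
Qed.

Definition swap q : quad := (q.2, q.1).

Lemma swapK : involutive swap. Proof. by case. Qed.

Lemma convex_swap q : convex (swap q) = convex q.
Proof. by rewrite /convex /convex_quad /=; case: (0 < _); case: (0 < _); case: (0 < _); case: (0 < _). Qed.

Lemma card_swap (P : pred quad) : #|[set q | P (swap q)]| = #|[set q | P q]|.
Proof.
rewrite -(card_imset _ (inv_inj swapK)); congr #|pred_of_set _|.
apply/setP => q; rewrite [RHS]inE; apply/imsetP/idP => [[r]|Pq].
  by rewrite inE => Pr ->.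
by exists (swap q); rewrite ?inE swapK.
Qed.

Lemma card_by_second (P : pred quad) :
  #|[set q | P q]| = (\sum_(t : grid m n * (grid m n * grid m n)) #|[set b | P ((t.1, b), t.2)]|)%N.
Proof.
have cE (T : finType) (Q : pred T) : #|[set x | Q x]| = (\sum_x Q x)%N.
  by rewrite -sum1_card big_mkcond; apply: eq_bigr => x _; rewrite inE; case: (Q x).
rewrite cE; under [RHS]eq_bigr do rewrite cE.
transitivity (\sum_(a : grid m n) \sum_(r : grid m n * grid m n) \sum_(b : grid m n) P ((a, b), r))%N.
  transitivity (\sum_(a : grid m n) \sum_(b : grid m n) \sum_(r : grid m n * grid m n) P ((a, b), r))%N.
    by rewrite pair_bigA /= pair_bigA /=; apply: eq_bigr => -[[a b] r].
  by apply: eq_bigr => a _; rewrite exchange_big.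
by rewrite pair_bigA.
Qed.

Definition count_dvd (P : pred quad) (d : nat) : nat :=
  #|[set q | [&& convex q, P q & d %| gcd_pair q.1.1 q.1.2]%N]|.

(* [P] may only constrain the side opposite to the one whose gcd is tested. *)
Definition second_side (P : pred quad) : Prop := forall p p' r, P (p, r) = P (p', r).

Lemma count_dvd_equi P d : (0 < d)%N -> second_side P ->
  (d ^ 2 * count_dvd P d <= count_dvd P 1 + d ^ 2 * (m + n) * (m * n) ^ 3)%N /\
  (count_dvd P 1 <= d ^ 2 * count_dvd P d + d ^ 2 * (m + n) * (m * n) ^ 3)%N.
Proof.
move=> d0 sP; rewrite /count_dvd !card_by_second.
have cT : ((m * n) ^ 3 = #|{: grid m n * (grid m n * grid m n)}|)%N.
  by rewrite !card_prod !card_ord !expnS expn0 muln1.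
have -> : (d ^ 2 * (m + n) * (m * n) ^ 3 = \sum_(t : grid m n * (grid m n * grid m n)) d ^ 2 * (m + n))%N.
  by rewrite sum_nat_const -cT mulnC.
rewrite big_distrr /= -!big_split /=.
suff H (t : grid m n * (grid m n * grid m n)) :
   (d ^ 2 * #|[set b | [&& convex (t.1, b, t.2), P (t.1, b, t.2) & d %| gcd_pair t.1 b]]| <=
   #|[set b | [&& convex (t.1, b, t.2), P (t.1, b, t.2) & 1 %| gcd_pair t.1 b]]| + d ^ 2 * (m + n))%N /\
   (#|[set b | [&& convex (t.1, b, t.2), P (t.1, b, t.2) & 1 %| gcd_pair t.1 b]]| <=
   d ^ 2 * #|[set b | [&& convex (t.1, b, t.2), P (t.1, b, t.2) & d %| gcd_pair t.1 b]]| + d ^ 2 * (m + n))%N.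
  by split; apply: leq_sum => t _; have [] := H t.
case: t => a [c e] /=; pose p := P ((a, a), (c, e)).
have rc : row_convex (fun b => convex (a, b, (c, e)) && p).
  move=> i j k y ij jk /andP[h1 ->] /andP[h2 _]; rewrite andbT.
  exact: (convex_row ij jk h1 h2).
have cc : col_convex (fun b => convex (a, b, (c, e)) && p).
  move=> x i j k ij jk /andP[h1 ->] /andP[h2 _]; rewrite andbT.
  exact: (convex_col ij jk h1 h2).
have := equidistribution a d0 rc cc.
have -> : [set b | convex (a, b, (c, e)) && p && (d %| gcd_pair a b)%N] =
    [set b | [&& convex (a, b, (c, e)), P (a, b, (c, e)) & d %| gcd_pair a b]%N].
  by apply/setP => b; rewrite !inE -andbA /p (sP (a, b) (a, a)).
have -> : [set b | convex (a, b, (c, e)) && p] =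
    [set b | [&& convex (a, b, (c, e)), P (a, b, (c, e)) & 1 %| gcd_pair a b]%N].
  by apply/setP => b; rewrite !inE dvd1n andbT /p (sP (a, b) (a, a)).
by [].
Qed.

(** The residue class contains [a] itself, and leaving it out absorbs the error [g] of
    [ord_interval]. Only a bound without additive error can be summed over all large [g]. *)
Lemma ord_congr_other (M g : nat) (a : 'I_M) : (0 < g)%N ->
  (g * #|[set x : 'I_M | (x != a) && (g %| nat_dist x a)%N]| <= M)%N.
Proof.
move=> g0; have [+ _] := @ord_interval M g a predT g0 (fun _ _ _ _ _ _ _ => isT).
rewrite sum_nat_const card_ord muln1 (bigD1 a) //=.
have -> : nat_dist a a = 0%N by rewrite /nat_dist subrr.
rewrite dvdn0 mulnDr muln1 addnC leq_add2r.
have -> // : #|[set x : 'I_M | (x != a) && (g %| nat_dist x a)%N]| = (\sum_(i < M | i != a) (g %| nat_dist i a))%N.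
rewrite -sum1_card [LHS]big_mkcond [RHS]big_mkcond /=.
by apply: eq_bigr => x _; rewrite inE; case: (x != a); case: (g %| _)%N.
Qed.

Lemma card_gcd_dvd a g : (0 < g)%N ->
  (g ^ 2 * #|[set b | [&& b.1 != a.1, b.2 != a.2 & g %| gcd_pair a b]]| <= m * n)%N.
Proof.
move=> g0.
have -> : [set b | [&& b.1 != a.1, b.2 != a.2 & g %| gcd_pair a b]%N] =
    setX [set x | (x != a.1) && (g %| nat_dist x a.1)%N] [set y | (y != a.2) && (g %| nat_dist y a.2)%N].
  apply/setP => -[x y]; rewrite !inE /= /gcd_pair dvdn_gcd /nat_dist /=.
  by case: (x != _); case: (y != _); rewrite ?andbF.
by rewrite cardsX -mulnn mulnACA leq_mul ?ord_congr_other.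
Qed.

(** Points sharing a coordinate with [a] number at most [m + n]. Any other point has a gcd below [m]
    and is counted at least once, in the term where [g] equals its gcd. *)
Lemma card_gcd_gt a L : (#|[set b | (L < gcd_pair a b)%N]| <=
  (m + n) + \sum_(L.+1 <= g < m) #|[set b | [&& b.1 != a.1, b.2 != a.2 & g %| gcd_pair a b]%N]|)%N.
Proof.
pose X := [set b : grid m n | b.1 == a.1]; pose Y := [set b : grid m n | b.2 == a.2].
have cX : (#|X| <= n)%N.
  have -> : X = setX [set a.1] setT by apply/setP => -[x y]; rewrite !inE andbT.
  by rewrite cardsX cards1 cardsT card_ord mul1n.
have cY : (#|Y| <= m)%N.
  have -> : Y = setX setT [set a.2] by apply/setP => -[x y]; rewrite !inE.
  by rewrite cardsX cards1 cardsT card_ord muln1.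
pose Z := [set b : grid m n | [&& b.1 != a.1, b.2 != a.2 & (L < gcd_pair a b)%N]].
have cov : [set b | (L < gcd_pair a b)%N] \subset X :|: Y :|: Z.
  by apply/fintype.subsetP => b; rewrite !inE => ->; rewrite andbT; case: eqP; case: eqP.
apply: leq_trans (subset_leq_card cov) _.
apply: leq_trans (leq_card_setU _ _) _; apply: leq_add.
  by apply: leq_trans (leq_card_setU _ _) _; rewrite addnC leq_add.
have cE (Q : pred (grid m n)) : #|[set x | Q x]| = (\sum_x Q x)%N.
  by rewrite -sum1_card big_mkcond; apply: eq_bigr => x _; rewrite inE; case: (Q x).
rewrite /Z cE; under [leqRHS]eq_bigr do rewrite cE.
rewrite exchange_big /=; apply: leq_sum => b _.
case: (boolP [&& _, _ & _]) => // /and3P[b1 b2 Lg].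
have gm : (gcd_pair a b < m)%N.
  apply: leq_ltn_trans (dvdn_leq _ (dvdn_gcdl _ _)) _.
    by rewrite absz_gt0 subr_eq0 eqz_nat.
  by move: (ltn_ord a.1) (ltn_ord b.1); rewrite /pt /=; lia.
have gin : gcd_pair a b \in index_iota L.+1 m by rewrite mem_index_iota Lg.
by rewrite (bigD1_seq _ gin) ?iota_uniq //= b1 b2 dvdnn leq_addr.
Qed.

End Quads.

(** * The Basel sum *)

Section Basel.
Variable R : realType.
Implicit Types (x : R) (K M N : nat).

Lemma sin_le_id x : 0 < x -> sin x <= x.
Proof.
move=> x0.
have [|c _] := @MVT R sin cos 0 x x0 (fun y _ => is_derive_sin y).
  by apply: continuous_subspaceT => y; exact: continuous_sin.
by rewrite sin0 !subr0 => ->; rewrite ler_piMl ?cos_le1 // ltW.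
Qed.

Lemma id_le_tan x : 0 < x -> x < pi / 2 -> x <= tan x.
Proof.
move=> x0 xp.
have cp y : 0 <= y -> y <= x -> cos y != 0.
  move=> y0 yx; rewrite gt_eqF // cos_gt0_pihalf // (le_lt_trans yx xp) andbT.
  by rewrite (lt_le_trans _ y0) // oppr_lt0 divr_gt0 // pi_gt0.
have [||c] := @MVT R tan (fun y => (cos y) ^- 2) 0 x x0.
- move=> y; rewrite in_itv /= => /andP[y0 yx]; apply: is_derive_tan.
  by apply: cp; exact: ltW.
- apply: derivable_within_continuous => y; rewrite in_itv /= => /andP[y0 yx].
  by apply: derivable_tan; apply: cp.
rewrite in_itv /= tan0 !subr0 => /andP[c0 cx] ->.
have cc : 0 < cos c.
  by rewrite cos_gt0_pihalf // (lt_trans cx xp) andbT (lt_trans _ c0) // oppr_lt0 divr_gt0 // pi_gt0.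
by rewrite ler_peMl ?(ltW x0) // invf_ge1 ?exprn_gt0 // exprn_ile1 ?cos_le1 // ltW.
Qed.

(** From [sin x <= x <= tan x], since the inverse square of the sine is one plus the square of the
    cotangent. *)
Lemma inv_sin2_bounds x : 0 < x -> x < pi / 2 ->
  x ^- 2 <= (sin x) ^- 2 /\ (sin x) ^- 2 <= x ^- 2 + 1.
Proof.
move=> x0 xp; have s0 : 0 < sin x by rewrite sin_gt0_pihalf // x0.
have c0 : 0 < cos x.
  by rewrite cos_gt0_pihalf // xp andbT (lt_trans _ x0) // oppr_lt0 divr_gt0 // pi_gt0.
split.
  by rewrite lef_pV2 ?posrE ?exprn_gt0 // lerXn2r ?nnegrE ?(ltW x0) ?(ltW s0) ?sin_le_id.
have t := id_le_tan x0 xp; rewrite /tan ler_pdivlMr // in t.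
have -> : (sin x) ^- 2 = (cos x / sin x) ^+ 2 + 1.
  rewrite expr_div_n; apply: (@mulIf _ (sin x ^+ 2)); first by rewrite expf_neq0 // gt_eqF.
  by rewrite mulVf ?expf_neq0 ?gt_eqF // mulrDl mul1r divfK ?cos2Dsin2 // expf_neq0 // gt_eqF.
rewrite lerD2r -exprVn lerXn2r ?nnegrE ?divr_ge0 ?invr_ge0 ?(ltW x0) ?(ltW s0) ?(ltW c0) //.
by rewrite ler_pdivrMr // ler_pdivlMl // mulrC.
Qed.

Definition theta n k : R := (k.*2.+1)%:R * pi / (4 * 2 ^ n)%:R.

Lemma theta_bounds n k : (k < 2 ^ n)%N -> 0 < theta n k /\ theta n k < pi / 2.
Proof.
move=> kn; have p0 := pi_gt0 R; have d0 : 0 < (4 * 2 ^ n)%:R :> R by rewrite ltr0n muln_gt0 expn_gt0.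
split; first by rewrite divr_gt0 // mulr_gt0 // ltr0n.
rewrite ltr_pdivrMr // mulrC [ltRHS](_ : _ = pi * (2 * 2 ^ n)%:R); last first.
  by rewrite -mulrA; congr (_ * _); rewrite !natrM; field.
by rewrite ltr_pM2l // ltr_nat; lia.
Qed.

Lemma inv_sin2_half x : 0 < x -> x < pi / 2 ->
  (sin (x / 2)) ^- 2 + (sin (pi / 2 - x / 2)) ^- 2 = 4 * (sin x) ^- 2.
Proof.
move=> x0 xp; have -> : sin (pi / 2 - x / 2) = cos (x / 2).
  by rewrite sinB sin_pihalf cos_pihalf mul1r mul0r subr0.
have y0 : 0 < x / 2 by rewrite divr_gt0.
have yp : x / 2 < pi / 2 by apply: le_lt_trans xp; rewrite ler_pdivrMr // ler_peMr ?ltW // ltr1n.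
have s0 : sin (x / 2) != 0 by rewrite gt_eqF // sin_gt0_pihalf // y0.
have c0 : cos (x / 2) != 0.
  by rewrite gt_eqF // cos_gt0_pihalf // yp andbT (lt_trans _ y0) // oppr_lt0 divr_gt0 // pi_gt0.
have -> : sin x = (cos (x / 2) * sin (x / 2)) *+ 2.
  by rewrite -sin_mulr2n; congr sin; rewrite mulr2n -splitr.
have cs := cos2Dsin2 (x / 2).
move: s0 c0 cs; move: (sin _) (cos _) => s c s0 c0 cs.
have -> : s ^- 2 + c ^- 2 = (c ^+ 2 + s ^+ 2) / (c ^+ 2 * s ^+ 2) by field; rewrite s0 c0.
by rewrite cs; field; rewrite s0 c0.
Qed.

(** The angles of level [n.+1] are [x / 2] and [pi / 2 - x / 2] for [x] of level [n], so
    [inv_sin2_half] multiplies the sum by 4 at each level. At level 0 the only angle is [pi / 4],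
    with value 2. *)
Lemma sum_inv_sin2 n : \sum_(k < 2 ^ n) (sin (theta n k)) ^- 2 = 2 * 4 ^+ n :> R.
Proof.
elim: n => [|n IH].
  rewrite big_ord1 expr0 mulr1 /theta.
  have cs := cos2Dsin2 (pi / 4 : R).
  have e : sin (pi / 4) = cos (pi / 4) :> R.
    rewrite -[in LHS](_ : pi / 2 - pi / 4 = pi / 4); last by field.
    by rewrite sinB sin_pihalf cos_pihalf mul1r mul0r subr0.
  rewrite muln1 mul1r; rewrite -e -mulr2n in cs.
  rewrite -[_ ^+ 2 *+ 2]mulr_natr in cs.
  have s0 : sin (pi / 4) ^+ 2 != 0 :> R by apply/eqP => z; move: cs; rewrite z mul0r => /esym /eqP; rewrite oner_eq0.
  by apply: (mulfI s0); rewrite mulfV // cs.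
have -> : (2 ^ n.+1 = 2 ^ n + 2 ^ n)%N by rewrite expnS mul2n addnn.
rewrite big_split_ord /= [X in _ + X](reindex_inj rev_ord_inj) /= -big_split /=.
rewrite exprS mulrCA -IH big_distrr /=; apply: eq_bigr => k _.
have [t0 tp] := theta_bounds (ltn_ord k); rewrite -inv_sin2_half //.
have dN : (2 ^ n)%:R != 0 :> R by rewrite pnatr_eq0 expn_eq0.
have -> : theta n.+1 k = theta n k / 2.
  by rewrite /theta expnS !natrM; field.
congr (_ + sin _ ^- 2); rewrite /theta expnS.
have -> : ((2 ^ n + (2 ^ n - k.+1)).*2.+1 = 4 * 2 ^ n - k.*2.+1)%N.
  by have := ltn_ord k; lia.
rewrite natrB; last by have := ltn_ord k; lia.
by rewrite !natrM; field.
Qed.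

(** The inverse of zero being zero, the term [k = 0] vanishes and the sum runs over
    [1, ..., K - 1]. *)
Definition inv_sq_sum K : R := \sum_(0 <= k < K) k%:R ^- 2.

Definition odd_inv_sq_sum K : R := \sum_(0 <= k < K) (k.*2.+1)%:R ^- 2.

Lemma odd_inv_sq_sum_bounds n :
  pi ^+ 2 / 8 - pi ^+ 2 / 16 / 2 ^+ n <= odd_inv_sq_sum (2 ^ n) /\
  odd_inv_sq_sum (2 ^ n) <= pi ^+ 2 / 8.
Proof.
have p0 := pi_gt0 R; have pN : pi != 0 :> R by rewrite gt_eqF.
have dN : (2 ^ n)%:R != 0 :> R by rewrite pnatr_eq0 expn_eq0.
have E : \sum_(k < 2 ^ n) (theta n k) ^- 2 = 16 * 4 ^+ n / pi ^+ 2 * odd_inv_sq_sum (2 ^ n).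
  rewrite /odd_inv_sq_sum big_mkord big_distrr /=; apply: eq_bigr => k _.
  have kN : (k.*2.+1)%:R != 0 :> R by rewrite pnatr_eq0.
  have -> : 4 ^+ n = (2 ^ n)%:R ^+ 2 :> R.
    by rewrite -!natrX -expnM mulnC expnM.
  rewrite /theta natrM; move: kN dN; move: (k.*2.+1)%:R (2 ^ n)%:R => u v uN vN.
  by move: pN; move: (pi : R) => p pN; field; rewrite uN pN vN.
have U : \sum_(k < 2 ^ n) (theta n k) ^- 2 <= 2 * 4 ^+ n.
  rewrite -sum_inv_sin2; apply: ler_sum => k _.
  by have [t0 tp] := theta_bounds (ltn_ord k); have [] := inv_sin2_bounds t0 tp.
have L : 2 * 4 ^+ n <= \sum_(k < 2 ^ n) (theta n k) ^- 2 + 2 ^+ n.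
  have -> : 2 ^+ n = \sum_(k < 2 ^ n) (1 : R).
    by rewrite sumr_const card_ord -natrX.
  rewrite -sum_inv_sin2 -big_split /=; apply: ler_sum => k _.
  by have [t0 tp] := theta_bounds (ltn_ord k); have [] := inv_sin2_bounds t0 tp.
have p2 : 0 < pi ^+ 2 :> R by rewrite exprn_gt0.
have four : 4 ^+ n = 2 ^+ n * 2 ^+ n :> R by rewrite -exprMn -natrM.
have t0 : 0 < 2 ^+ n :> R by rewrite exprn_gt0.
move: U L; rewrite E four; clear E p0.
move: pN p2; move: (odd_inv_sq_sum _) (2 ^+ n) t0 (pi : R) => o t t0 p pN p2.
have c0 : 0 < 16 * (t * t) / p ^+ 2 by rewrite divr_gt0 // mulr_gt0 // mulr_gt0.
move=> U L; split.
  rewrite -(ler_pM2l c0); rewrite [leLHS](_ : _ = 2 * (t * t) - t).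
    by rewrite lerBlDr.
  by field; rewrite pN gt_eqF.
rewrite -(ler_pM2l c0) [leRHS](_ : _ = 2 * (t * t)) //.
by field; rewrite pN.
Qed.

Lemma inv_sq_sum_double K : inv_sq_sum K.*2 = inv_sq_sum K / 4 + odd_inv_sq_sum K.
Proof.
rewrite /inv_sq_sum /odd_inv_sq_sum; elim: K => [|K IH]; first by rewrite !big_geq // mul0r addr0.
rewrite doubleS !big_nat_recr //= IH -muln2 natrM.
have [->|K0] := eqVneq K 0%N; first by rewrite mul0r !expr0n /= invr0; ring.
have KN : K%:R != 0 :> R by rewrite pnatr_eq0.
rewrite mulrDl; have -> : (K%:R * 2) ^- 2 = K%:R ^- 2 / 4 :> R by field.
by ring.
Qed.

(** Doubling divides the error by 4 and adds the error of the odd sum. The constant [c = pi ^ 2 / 4]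
    solves [c / 4 + pi ^ 2 / 16 = c / 2], so the bound reproduces itself. *)
Lemma inv_sq_sum_pow2 n : 0 <= pi ^+ 2 / 6 - inv_sq_sum (2 ^ n) /\
  pi ^+ 2 / 6 - inv_sq_sum (2 ^ n) <= pi ^+ 2 / 4 / 2 ^+ n.
Proof.
have p2 : 0 < pi ^+ 2 :> R by rewrite exprn_gt0 // pi_gt0.
elim: n => [|n [IH1 IH2]].
  rewrite /inv_sq_sum big_nat1 expr0 expr0n /= invr0; split; lra.
have [h1 h2] := odd_inv_sq_sum_bounds n.
rewrite expnS mul2n inv_sq_sum_double [2 ^+ n.+1]exprS.
have -> : pi ^+ 2 / 4 / (2 * 2 ^+ n) = (pi ^+ 2 / 2 ^+ n) / 8 :> R.
  by field; rewrite expf_neq0.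
have e1 : pi ^+ 2 / 4 / 2 ^+ n = (pi ^+ 2 / 2 ^+ n) / 4 :> R by field; rewrite expf_neq0.
have e2 : pi ^+ 2 / 16 / 2 ^+ n = (pi ^+ 2 / 2 ^+ n) / 16 :> R by field; rewrite expf_neq0.
rewrite e1 in IH2; rewrite e2 in h1.
by split; lra.
Qed.

(** Telescoping: the factor 2 makes [1 / x ^ 2 <= 2 / x - 2 / (x + 1)] valid from [x = 1] on. *)
Lemma inv_sq_tail K M : (0 < K)%N -> (K <= M)%N ->
  \sum_(K <= k < M) k%:R ^- 2 <= 2 / K%:R - 2 / M%:R :> R.
Proof.
move=> K0; elim: M => [|M IH]; first by rewrite leqNgt K0.
rewrite leq_eqVlt => /predU1P[<-|]; first by rewrite big_geq // subrr.
rewrite ltnS => KM; rewrite big_nat_recr //=.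
have M0 : 0 < M%:R :> R by rewrite ltr0n (leq_trans K0).
have M1 : 1 <= M%:R :> R by rewrite ler1n (leq_trans K0).
apply: le_trans (lerD (IH KM) (lexx _)) _.
rewrite -addrA lerD2l -natr1; set x := M%:R in M0 M1 *.
have x1 : 0 < x + 1 by rewrite addr_gt0.
rewrite -subr_ge0 (_ : _ - _ = (x - 1) / (x ^+ 2 * (x + 1))).
  by rewrite divr_ge0 ?subr_ge0 // mulr_ge0 ?exprn_ge0 // ltW.
by field; rewrite !gt_eqF.
Qed.

Lemma basel_bounds K : (0 < K)%N ->
  0 <= pi ^+ 2 / 6 - inv_sq_sum K /\ pi ^+ 2 / 6 - inv_sq_sum K <= 2 / K%:R.
Proof.
move=> K0; have p2 : 0 < pi ^+ 2 :> R by rewrite exprn_gt0 // pi_gt0.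
have split_ M : (K <= M)%N -> inv_sq_sum M = inv_sq_sum K + \sum_(K <= k < M) k%:R ^- 2.
  by move=> KM; rewrite /inv_sq_sum (big_cat_nat (n := K)).
have le2 N : (K <= 2 ^ (K + N))%N.
  by apply: leq_trans (ltnW (ltn_expl K (isT : 1 < 2)%N)) _; rewrite leq_exp2l ?leq_addr.
split.
  have [h _] := inv_sq_sum_pow2 (K + 0); apply: le_trans h _; rewrite lerD2l lerN2 (split_ _ (le2 0%N)).
  by rewrite lerDl sumr_ge0 // => k _; rewrite invr_ge0 exprn_ge0.
rewrite leNgt; apply/negP => lt.
set e := pi ^+ 2 / 6 - inv_sq_sum K - 2 / K%:R.
have e0 : 0 < e by rewrite subr_gt0.
have [N Nlt] : exists N, pi ^+ 2 / 4 / e < N%:R.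
  by exists (Num.truncn (pi ^+ 2 / 4 / e)).+1; rewrite truncnS_gt.
have [_ h] := inv_sq_sum_pow2 (K + N); have t := inv_sq_tail K0 (le2 N).
rewrite (split_ _ (le2 N)) in h.
have M0 : 0 <= 2 / (2 ^ (K + N))%:R :> R by rewrite divr_ge0.
have eN : e <= pi ^+ 2 / 4 / 2 ^+ (K + N) by rewrite /e; lra.
have NN : N%:R < 2 ^+ (K + N) :> R.
  rewrite -natrX ltr_nat; apply: leq_trans (ltn_expl N (isT : 1 < 2)%N) _.
  by rewrite leq_exp2l ?leq_addl.
move: eN; rewrite ler_pdivlMr ?exprn_gt0 // leNgt => /negP; apply.
by move: Nlt; rewrite ltr_pdivrMr // => /lt_trans; apply; rewrite [ltRHS]mulrC ltr_pM2r.
Qed.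

End Basel.

(** * The sieve *)

Section Sieve.
Variable R : realType.

Definition no_div (k n : nat) : bool := all (fun j => ~~ (j %| n)%N) (iota 2 k).

Definition mass (M : nat) (q : nat -> R) (k d : nat) : R :=
  \sum_(0 <= i < M | (d %| i)%N && no_div k i) q i.

Lemma mass_step M q k d : mass M q k.+1 d = mass M q k d - mass M q k (lcmn d k.+2).
Proof.
apply/eqP; rewrite eq_sym subr_eq eq_sym /mass; apply/eqP.
rewrite [RHS](bigID (fun i => k.+2 %| i)%N) /= addrC.
have nd i : no_div k.+1 i = no_div k i && ~~ (k.+2 %| i)%N.
  by rewrite /no_div -[iota 2 k.+1]/(iota 2 (k.+1)) -[X in iota 2 X]addn1 iotaD all_cat /= andbT add2n.
congr (_ + _); apply: eq_bigl => i.
  by rewrite nd andbA.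
by rewrite dvdn_lcm andbAC.
Qed.

(** Each excluded divisor replaces a mass by a difference of two masses, of [d] and of a least
    common multiple; hence one factor 2 per step. *)
Lemma mass_bound M q (eta : R) : (forall d, (0 < d)%N -> `|mass M q 0 d| <= eta) ->
  forall k d, (0 < d)%N -> `|mass M q k d| <= 2 ^+ k * eta.
Proof.
move=> H; elim=> [|k IH] d d0; first by rewrite mul1r H.
rewrite mass_step (le_trans (ler_normB _ _)) // exprS -mulrA mulr2n mulrDl mul1r.
by rewrite lerD ?IH // lcmn_gt0 d0.
Qed.

Lemma sum_multiples (g : nat -> R) (d M : nat) : (0 < d)%N ->
  \sum_(0 <= i < M | (d %| i)%N) g i = \sum_(0 <= k < (M + d.-1) %/ d) g (d * k)%N.
Proof.
move=> d0; elim: M => [|M IH].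
  by rewrite big_geq // divn_small ?big_geq // add0n prednK.
rewrite big_mkcond big_nat_recr //= -big_mkcond IH addSn divnS //.
have -> : ((M + d.-1).+1 = M + d)%N by lia.
rewrite dvdn_addl //; case: (boolP (d %| M)%N) => dM; last by rewrite addr0 add0n.
rewrite big_nat_recr //=; congr (_ + g _).
case/dvdnP: dM => t ->; rewrite divnMDl // divn_small ?prednK // addn0.
by rewrite mulnC.
Qed.

Local Notation rho := (6 / pi ^+ 2 : R).

Lemma rho_bounds : 0 < rho /\ rho <= 1.
Proof.
have p2 : 0 < pi ^+ 2 :> R by rewrite exprn_gt0 // pi_gt0.
split; first by rewrite divr_gt0.
have [+ _] := @basel_bounds R 2 isT.
rewrite /inv_sq_sum unlock /= expr0n /= invr0 expr1n invr1 !addr0 add0r ler_pdivrMr // mul1r; lra.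
Qed.

(* Compares [P] with the model distribution [rho * F0 / g ^ 2] of gcds: their
   difference has small mass on all multiples of [d], and excluding the multiples of
   [2, ..., L] by inclusion-exclusion leaves only [1] and the tail. *)
Lemma sieve (P : nat -> R) (F0 eta tau : R) (M L : nat) :
  (forall g, 0 <= P g) -> P 0%N = 0 -> 0 <= F0 -> (1 < M)%N -> (0 < L)%N ->
  (forall d, (0 < d)%N -> `|\sum_(0 <= g < M | (d %| g)%N) P g - F0 / d%:R ^+ 2| <= eta) ->
  \sum_(L.+1 <= g < M) P g <= tau ->
  `|P 1%N - rho * F0| <= 2 ^+ L * (eta + 2 * F0 / M%:R) + tau + 2 * F0 / L%:R.
Proof.
move=> P0 P00 F00 M1 L0 HF HT.
have [r0 r1] := rho_bounds.
have p2 : 0 < pi ^+ 2 :> R by rewrite exprn_gt0 // pi_gt0.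
pose q g := P g - rho * F0 / g%:R ^+ 2.
have M0 : 0 < M%:R :> R by rewrite ltr0n ltnW.
(* Over all multiples of [d] the model sums to [F0 / d ^ 2] by the Basel formula. Below [M] there
   are [K >= M / d] multiples, counting 0, so [basel_bounds] makes the truncation cost at most
   [2 * F0 / M]. *)
have base d : (0 < d)%N -> `|mass M q 0 d| <= eta + 2 * F0 / M%:R.
  move=> d0; rewrite /mass.
  under eq_bigl do rewrite /no_div /= andbT.
  rewrite sumrB.
  have dR : 0 < d%:R :> R by rewrite ltr0n.
  set K := ((M + d.-1) %/ d)%N.
  have -> : \sum_(0 <= i < M | (d %| i)%N) rho * F0 / i%:R ^+ 2 = rho * F0 / d%:R ^+ 2 * inv_sq_sum R K.
    rewrite (sum_multiples (fun i => rho * F0 / i%:R ^+ 2)) // /inv_sq_sum big_distrr /=.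
    apply: eq_bigr => k _.
    have -> : ((d * k)%:R ^+ 2)^-1 = d%:R ^- 2 * k%:R ^- 2 :> R by rewrite natrM exprMn invfM.
    by rewrite mulrA.
  have MK : (M <= K * d)%N.
    have := divn_eq (M + d.-1) d; have := ltn_pmod (M + d.-1) d0; rewrite -/K; lia.
  have K0 : (0 < K)%N by rewrite lt0n; apply: contraTneq MK => ->; rewrite mul0n -ltnNge ltnW.
  have KR : 0 < K%:R :> R by rewrite ltr0n.
  have [b1 b2] := @basel_bounds R K K0.
  move: (HF d d0); set S := \sum_(0 <= i < M | _) P i => HFd.
  rewrite -(subrK (F0 / d%:R ^+ 2) S) -addrA.
  apply: le_trans (ler_normD _ _) _; apply: lerD => //.
  have -> : F0 / d%:R ^+ 2 - rho * F0 / d%:R ^+ 2 * inv_sq_sum R K =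
     rho * (F0 / d%:R ^+ 2) * (pi ^+ 2 / 6 - inv_sq_sum R K).
    by move: (inv_sq_sum R K) (pi ^+ 2) p2 => B p p2; field; rewrite !gt_eqF.
  have F0d : 0 <= F0 / d%:R ^+ 2 by rewrite divr_ge0 ?exprn_ge0 // ltW.
  rewrite ger0_norm; last by rewrite mulr_ge0 // mulr_ge0 // ltW.
  apply: le_trans (_ : 1 * (F0 / d%:R ^+ 2) * (2 / K%:R) <= _).
    by apply: ler_pM => //; [apply: mulr_ge0 => //; exact: ltW|exact: ler_wpM2r].
  have -> : 1 * (F0 / d%:R ^+ 2) * (2 / K%:R) = 2 * F0 / (d%:R * (K%:R * d%:R)).
    by field; rewrite !gt_eqF.
  rewrite ler_wpM2l ?mulr_ge0 // lef_pV2 ?posrE ?mulr_gt0 // -natrM -natrM ler_nat.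
  by rewrite (leq_trans MK) // leq_pmull.
have := mass_bound base L.-1 (isT : 0 < 1)%N.
set X := eta + _.
have X0 : 0 <= X by apply: le_trans (base 1%N isT).
have two : 2 ^+ L.-1 * X <= 2 ^+ L * X.
  by rewrite ler_wpM2r // ler_eXn2l ?leq_pred // ltr1n.
(* [no_div L.-1] excludes the divisors [2, ..., L], so every index from 2 to [L] is excluded by
   itself; index 0 survives but [q 0] is 0. *)
have massE : mass M q L.-1 1 = q 1%N + \sum_(L.+1 <= i < M | no_div L.-1 i) q i.
  rewrite /mass; under eq_bigl do rewrite dvd1n.
  have q0 : q 0%N = 0 by rewrite /q P00 expr0n /= invr0 mulr0 subrr.
  rewrite (big_ltn_cond (m := 0)) ?(ltnW M1) // (big_ltn_cond (m := 1)) //.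
  have -> : no_div L.-1 1.
    by apply/allP => j; rewrite mem_iota dvdn1 => /andP[j2 _]; rewrite neq_ltn j2 orbT.
  rewrite q0 add0r if_same; congr (_ + _).
  have small i : (2 <= i)%N -> (i <= L)%N -> no_div L.-1 i = false.
    move=> i2 iL; apply/negbTE/negP => /allP /(_ i).
    by rewrite mem_iota i2 dvdnn /=; move=> h; have : false by apply: h; lia.
  case: (leqP L.+1 M) => LM.
    rewrite (big_cat_nat (n := L.+1)) //= big1_seq ?add0r // => i /andP[ni].
    by rewrite mem_index_iota => /andP[i2 iL]; rewrite small in ni.
  rewrite [RHS]big_geq 1?ltnW // big1_seq // => i /andP[ni].
  by rewrite mem_index_iota => /andP[i2 iL]; rewrite small // in ni; lia.
rewrite massE => mb.
have tail : `|\sum_(L.+1 <= i < M | no_div L.-1 i) q i| <= tau + 2 * F0 / L%:R.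
  apply: le_trans (ler_norm_sum _ _ _) _.
  apply: le_trans (_ : \sum_(L.+1 <= i < M) (P i + F0 * i%:R ^- 2) <= _).
    rewrite big_mkcond /=; apply: ler_sum => i _.
    have qi : 0 <= rho * F0 / i%:R ^+ 2 by rewrite divr_ge0 ?exprn_ge0 // mulr_ge0 // ltW.
    have le : rho * F0 / i%:R ^+ 2 <= F0 * i%:R ^- 2.
      by rewrite ler_wpM2r ?invr_ge0 ?exprn_ge0 // ler_piMl.
    case: ifP => _; last by rewrite addr_ge0 // (le_trans qi le).
    by apply: le_trans (ler_normB _ _) _; rewrite (ger0_norm (P0 i)) (ger0_norm qi) lerD2l.
  rewrite big_split /= -big_distrr /= lerD //.
  case: (leqP L.+1 M) => LM; last first.
    by rewrite big_geq 1?ltnW // mulr0 divr_ge0 ?mulr_ge0.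
  rewrite [leRHS](_ : _ = F0 * (2 / L%:R)); last by ring.
  rewrite ler_wpM2l //; apply: le_trans (inv_sq_tail R (ltn0Sn L) LM) _.
  apply: le_trans (_ : 2 / L.+1%:R <= _); first by rewrite gerBl divr_ge0.
  by rewrite ler_wpM2l // lef_pV2 ?posrE ?ltr0n // ler_nat.
rewrite -[P 1%N - _](_ : q 1%N = _); last by rewrite /q expr1n divr1.
rewrite -[q 1%N](addrK (\sum_(L.+1 <= i < M | no_div L.-1 i) q i)).
apply: le_trans (ler_normB _ _) _; rewrite -[leRHS]addrA; apply: lerD => //.
exact: le_trans two.
Qed.

End Sieve.

(** * Counting convex quadrilaterals by their edge vectors *)

Definition ppart (x : int) : nat := `|Num.max x 0|%N.

(* Number of translates of a closed walk with steps [x1, x2, x3, - (x1 + x2 + x3)]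
   that stay in [0, m), when its positive steps are cyclically consecutive. *)
Definition weight (m : nat) (x1 x2 x3 : int) : nat :=
  (m - (ppart x1 + ppart x2 + ppart x3 + ppart (- (x1 + x2 + x3))))%N.

(** Steps inside the grid stay strictly between [-m] and [m]; the additional value [-m] gives weight
    0. *)
Definition centered (m : nat) (i : 'I_(m + m)) : int := (i : nat)%:Z - m%:Z.

Lemma sum_centered (m : nat) (f : int -> nat) :
  (\sum_(i < m + m) f (centered i) = \sum_(j < m) f (j : nat)%:Z + \sum_(j < m) f (- (j.+1 : nat)%:Z))%N.
Proof.
rewrite big_split_ord /= addnC; congr (_ + _)%N.
  by apply: eq_bigr => i _; congr f; rewrite /centered /=; lia.
rewrite (reindex_inj rev_ord_inj) /=; apply: eq_bigr => i _; congr f.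
by rewrite /centered /=; have := ltn_ord i; lia.
Qed.

(** Both sides count the pairs [(u, v)] with [u < k] and [v < l], on the left according to the
    difference [u - v]. *)
Lemma trapezoid (m k l : nat) : (k <= m)%N -> (l <= m)%N ->
  (\sum_(j < m) minn l (k - j) + \sum_(j < m) minn k (l - j.+1) = k * l)%N.
Proof.
move=> km lm; elim: k km => [|k IH] km.
  rewrite !big1 // => j _; by rewrite ?sub0n ?minn0 ?min0n.
have {}IH := IH (ltnW km).
have e1 : (\sum_(j < m) minn l (k.+1 - j) = minn l k.+1 + \sum_(j < m) minn l (k - j))%N.
  case: m km {lm IH} => // m km; rewrite big_ord_recl subn0 /=; congr (_ + _)%N.
  rewrite big_ord_recr /= (_ : (k - m = 0)%N) ?minn0 ?addn0; last by lia.
  by apply: eq_bigr => i _; rewrite /bump /= add1n subSS.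
have e2 : (\sum_(j < m) minn k.+1 (l - j.+1) = \sum_(j < m) minn k (l - j.+1) + (l - k.+1))%N.
  have -> : (l - k.+1 = \sum_(j < m) (j < l - k.+1))%N.
    have : (l - k.+1 <= m)%N by lia.
    move: (l - k.+1)%N => p pm.
    rewrite -{1}[p]card_ord -sum1_card (big_ord_widen m (fun=> 1%N)) // big_mkcond.
    by apply: eq_bigr => i _; case: (i < p)%N.
  by rewrite -big_split /=; apply: eq_bigr => j _; case: ltnP; lia.
by rewrite e1 e2 mulSn -IH; lia.
Qed.

(** With [P] and [Q] the sums of the positive and negative parts of [x1] and [x2], a last step
    [j >= 0] brings the total ascent to the maximum of [P + j] and [Q], and a last step [- j.+1] to
    that of [P] and [Q + j.+1]. These are the terms of [trapezoid] for [m - P] and [m - Q]. *)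
Lemma sum_weight_last (m : nat) (x1 x2 : int) :
  (\sum_(i < m + m) weight m x1 x2 (centered i) =
   (m - (ppart x1 + ppart x2)) * (m - (ppart (- x1) + ppart (- x2))))%N.
Proof.
rewrite (sum_centered m (weight m x1 x2)).
set P := (ppart x1 + ppart x2)%N; set Q := (ppart (- x1) + ppart (- x2))%N.
have E : P%:Z - Q%:Z = x1 + x2 by rewrite /P /Q /ppart; lia.
rewrite -(trapezoid (leq_subr P m) (leq_subr Q m)).
have [PQ|PQ] := boolP ((P <= m) && (Q <= m))%N.
  congr (_ + _)%N; apply: eq_bigr => j _; rewrite /weight -/P /ppart; lia.
rewrite !big1 // => j _; rewrite ?/weight -?/P /ppart; lia.
Qed.

Lemma sum_tri (m : nat) : (2 * (\sum_(j < m) (m - j)) = m * m.+1)%N.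
Proof.
elim: m => [|m IH]; first by rewrite big_ord0.
rewrite big_ord_recl /=; under eq_bigr do rewrite /bump /= add1n subSS.
by rewrite mulnDr IH; lia.
Qed.

Lemma sum_tri' (m : nat) : (2 * (\sum_(j < m) (m - j.+1)) = m * m.-1)%N.
Proof.
case: m => [|m]; first by rewrite big_ord0.
rewrite big_ord_recr /= subnn addn0.
have -> : (\sum_(i < m) (m.+1 - i.+1) = \sum_(i < m) (m - i))%N by apply: eq_bigr => i _; rewrite subSS.
by rewrite sum_tri mulnC.
Qed.

Lemma sum_tetra (m : nat) : (6 * (\sum_(i < m) \sum_(j < m) (m - (i + j))) = m * m.+1 * m.+2)%N.
Proof.
elim: m => [|m IH]; first by rewrite big_ord0.
rewrite big_ord_recl /=; under eq_bigr do rewrite add0n.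
under [X in (_ + X)%N]eq_bigr do (rewrite big_ord_recr /= /bump /= add1n).
have -> : (\sum_(i < m) (\sum_(i0 < m) (m.+1 - (i.+1 + i0)) + (m.+1 - (i.+1 + m))) = \sum_(i < m) \sum_(j < m) (m - (i + j)))%N.
  apply: eq_bigr => i _; rewrite (_ : m.+1 - (i.+1 + m) = 0)%N ?addn0; last lia.
  by apply: eq_bigr => j _; rewrite addSn subSS.
rewrite mulnDr IH -[6%N]/(3 * 2)%N -mulnA sum_tri.
by ring.
Qed.

Lemma sum_tetra' (m : nat) : (6 * (\sum_(i < m) \sum_(j < m) (m - (i.+1 + j.+1))) = m * m.-1 * m.-2)%N.
Proof.
case: m => [|[|m]]; first by rewrite big_ord0.
  by rewrite big_ord1 big_ord1.
rewrite big_ord_recr /= [X in (_ + X)%N]big1 ?addn0; last by move=> j _; lia.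
rewrite big_ord_recr /= [X in (_ + X)%N]big1 ?addn0; last by move=> j _; lia.
have -> : (\sum_(i < m) \sum_(j < m.+2) (m.+2 - (i.+1 + j.+1)) = \sum_(i < m) \sum_(j < m) (m - (i + j)))%N.
  apply: eq_bigr => i _; rewrite !big_ord_recr /=.
  rewrite (_ : m.+2 - (i.+1 + m.+1) = 0)%N; last lia.
  rewrite (_ : m.+2 - (i.+1 + m.+2) = 0)%N ?addn0; last lia.
  by apply: eq_bigr => j _; lia.
rewrite sum_tetra; lia.
Qed.

Definition total_weight (m : nat) : nat :=
  (\sum_(i < m + m) \sum_(j < m + m) \sum_(k < m + m)
     weight m (centered i) (centered j) (centered k))%N.

(** Split by the signs of the first two steps: equal signs give [m] times two tetrahedral sums,
    opposite signs twice a product of triangular sums. The leading terms are [m ^ 4 / 3] and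
    [m ^ 4 / 2]. *)
Lemma total_weightE (m : nat) : (6 * total_weight m = 5 * m ^ 4 + m ^ 2)%N.
Proof.
rewrite /total_weight.
under eq_bigr do under eq_bigr do rewrite sum_weight_last.
under eq_bigr => i _ do rewrite (sum_centered m (fun y => (m - (ppart (centered i) + ppart y)) * (m - (ppart (- centered i) + ppart (- y))))%N).
rewrite (sum_centered m (fun x => \sum_(j < m) ((m - (ppart x + ppart (j : nat)%:Z)) * (m - (ppart (- x) + ppart (- (j : nat)%:Z)))) + \sum_(j < m) ((m - (ppart x + ppart (- (j.+1 : nat)%:Z))) * (m - (ppart (- x) + ppart (- - (j.+1 : nat)%:Z)))))%N).
have p1 (k : nat) : ppart k%:Z = k by rewrite /ppart; lia.
have p2 (k : nat) : ppart (- k%:Z) = 0%N by rewrite /ppart; lia.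
have A : (\sum_(i < m) (\sum_(j < m) ((m - (ppart i%:Z + ppart j%:Z)) * (m - (ppart (- i%:Z) + ppart (- j%:Z)))) +
   \sum_(j < m) ((m - (ppart i%:Z + ppart (- j.+1%:Z))) * (m - (ppart (- i%:Z) + ppart (- - j.+1%:Z))))) =
   m * (\sum_(i < m) \sum_(j < m) (m - (i + j))) + (\sum_(j < m) (m - j)) * (\sum_(j < m) (m - j.+1)))%N.
  rewrite big_split /=; congr (_ + _)%N.
    rewrite big_distrr /=; apply: eq_bigr => i _; rewrite big_distrr /=; apply: eq_bigr => j _.
    by rewrite !p1 !p2 addn0 subn0 mulnC.
  rewrite big_distrl /=; apply: eq_bigr => i _; rewrite big_distrr /=; apply: eq_bigr => j _.
  by rewrite opprK !p1 !p2 addn0 add0n.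
have B : (\sum_(i < m) (\sum_(j < m) ((m - (ppart (- i.+1%:Z) + ppart j%:Z)) * (m - (ppart (- - i.+1%:Z) + ppart (- j%:Z)))) +
   \sum_(j < m) ((m - (ppart (- i.+1%:Z) + ppart (- j.+1%:Z))) * (m - (ppart (- - i.+1%:Z) + ppart (- - j.+1%:Z))))) =
   (\sum_(j < m) (m - j.+1)) * (\sum_(j < m) (m - j)) + m * (\sum_(i < m) \sum_(j < m) (m - (i.+1 + j.+1))))%N.
  rewrite big_split /=; congr (_ + _)%N.
    rewrite big_distrl /=; apply: eq_bigr => i _; rewrite big_distrr /=; apply: eq_bigr => j _.
    by rewrite opprK !p1 !p2 addn0 add0n mulnC.
  rewrite big_distrr /=; apply: eq_bigr => i _; rewrite big_distrr /=; apply: eq_bigr => j _.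
  by rewrite !opprK !p1 !p2 addn0 subn0.
rewrite A B; have := sum_tri m; have := sum_tri' m; have := sum_tetra m; have := sum_tetra' m.
set T' := (\sum_(i < m) \sum_(j < m) (m - (i.+1 + j.+1)))%N.
set T := (\sum_(i < m) \sum_(j < m) (m - (i + j)))%N.
set t' := (\sum_(j < m) (m - j.+1))%N; set t := (\sum_(j < m) (m - j))%N.
move: T T' t t'; clear; move=> T T' t t' h1 h2 h3 h4.
have -> : (6 * (m * T + t * t' + (t' * t + m * T')) = m * (6 * T) + 3 * ((2 * t) * (2 * t')) + m * (6 * T'))%N.
  by ring.
rewrite h1 h2 h3 h4; case: m {h1 h2 h3 h4} => [|[|m]] //=.
by ring.
Qed.

(** * Convex cyclic orders of four vectors of sum zero *)

Definition closing (v1 v2 v3 : int * int) : int * int :=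
  (- (v1.1 + v2.1 + v3.1), - (v1.2 + v2.2 + v3.2)).

Definition cyc (v1 v2 v3 : int * int) : bool :=
  [&& 0 < det v1 v2, 0 < det v2 v3, 0 < det v3 (closing v1 v2 v3) &
      0 < det (closing v1 v2 v3) v1].

(** No two of the four vectors are parallel: up to sign, the last three expressions are the
    determinants of [v1], [v2], [v3] with the closing vector. *)
Definition generic (v1 v2 v3 : int * int) : bool :=
  [&& det v1 v2 != 0, det v1 v3 != 0, det v2 v3 != 0,
      det v1 v2 + det v1 v3 != 0, det v1 v2 != det v2 v3 & det v1 v3 + det v2 v3 != 0].

Lemma cycE v1 v2 v3 : cyc v1 v2 v3 =
  [&& 0 < det v1 v2, 0 < det v2 v3, 0 < det v1 v3 + det v2 v3 & 0 < det v1 v2 + det v1 v3].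
Proof.
have e1 : det v3 (closing v1 v2 v3) = det v1 v3 + det v2 v3 by rewrite /det /=; ring.
have e2 : det (closing v1 v2 v3) v1 = det v1 v2 + det v1 v3 by rewrite /det /=; ring.
by rewrite /cyc e1 e2.
Qed.

(* Four pairwise nonparallel vectors of sum zero carry a tournament without source or
   sink, and such a tournament has exactly one Hamiltonian cycle. *)
Lemma one_cycle v1 v2 v3 : generic v1 v2 v3 ->
  (cyc v1 v2 v3 + cyc v2 v1 v3 + cyc v1 v3 v2 + cyc v3 v2 v1 + cyc v2 v3 v1 + cyc v3 v1 v2 = 1)%N.
Proof.
rewrite /generic !cycE (det_anti v1 v2) (det_anti v1 v3) (det_anti v2 v3).
move: (det v1 v2) (det v1 v3) (det v2 v3) => a b c.
case/and5P => a0 b0 c0 ab /andP[ac bc].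
case: (ltrP 0 a); case: (ltrP 0 b); case: (ltrP 0 c); case: (ltrP 0 (a + b));
  case: (ltrP c a); case: (ltrP 0 (b + c)); lia.
Qed.

Lemma generic12 v1 v2 v3 : generic v2 v1 v3 = generic v1 v2 v3.
Proof.
rewrite /generic (det_anti v1 v2); move: (det v1 v2) (det v1 v3) (det v2 v3) => a b c; lia.
Qed.

Lemma generic23 v1 v2 v3 : generic v1 v3 v2 = generic v1 v2 v3.
Proof.
rewrite /generic (det_anti v2 v3); move: (det v1 v2) (det v1 v3) (det v2 v3) => a b c; lia.
Qed.

Lemma weight12 m x1 x2 x3 : weight m x2 x1 x3 = weight m x1 x2 x3.
Proof. by rewrite /weight (addnC (ppart x2)) (addrC x2). Qed.

Lemma weight23 m x1 x2 x3 : weight m x1 x3 x2 = weight m x1 x2 x3.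
Proof. by rewrite /weight (addnAC (ppart x1) (ppart x3)) (addrAC x1). Qed.

Section Sym.
Variables (B : finType) (F : B -> B -> B -> nat).

Lemma sum_sym12 : (\sum_(t : B * B * B) F t.1.1 t.1.2 t.2 = \sum_(t : B * B * B) F t.1.2 t.1.1 t.2)%N.
Proof.
rewrite (reindex_inj (h := fun t => ((t.1.2, t.1.1), t.2))) //.
by move=> [[? ?] ?] [[? ?] ?] [-> -> ->].
Qed.

Lemma sum_sym23 : (\sum_(t : B * B * B) F t.1.1 t.1.2 t.2 = \sum_(t : B * B * B) F t.1.1 t.2 t.1.2)%N.
Proof.
rewrite (reindex_inj (h := fun t => ((t.1.1, t.2), t.1.2))) //.
by move=> [[? ?] ?] [[? ?] ?] [-> -> ->].
Qed.

End Sym.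

(** Dividing each determinant by the negative product of its two abscissas shows that the slopes
    [y / x] decrease strictly all around the cycle. *)
Lemma no_alternation (x1 x2 x3 x4 y1 y2 y3 y4 : int) :
  0 < x1 -> x2 < 0 -> 0 < x3 -> x4 < 0 ->
  0 < x1 * y2 - y1 * x2 -> 0 < x2 * y3 - y2 * x3 ->
  0 < x3 * y4 - y3 * x4 -> 0 < x4 * y1 - y4 * x1 -> False.
Proof.
move=> p1 p2 p3 p4; rewrite (mulrC y1) (mulrC y2) (mulrC y3) (mulrC y4) !subr_gt0 => d1 d2 d3 d4.
have h1 : x3 * (x2 * y1) < x3 * (x1 * y2) by rewrite ltr_pM2l.
have h2 : x1 * (x3 * y2) < x1 * (x2 * y3) by rewrite ltr_pM2l.
have h3 : x1 * (x4 * y3) < x1 * (x3 * y4) by rewrite ltr_pM2l.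
have h4 : x3 * (x1 * y4) < x3 * (x4 * y1) by rewrite ltr_pM2l.
have k1 : x2 * (x3 * y1) < x2 * (x1 * y3).
  rewrite (_ : x2 * (x3 * y1) = x3 * (x2 * y1)); last by ring.
  apply: lt_trans h1 _; rewrite (_ : x3 * (x1 * y2) = x1 * (x3 * y2)); last by ring.
  by rewrite (_ : x2 * (x1 * y3) = x1 * (x2 * y3)); last by ring.
have k2 : x4 * (x1 * y3) < x4 * (x3 * y1).
  rewrite (_ : x4 * (x1 * y3) = x1 * (x4 * y3)); last by ring.
  apply: lt_trans h3 _; rewrite (_ : x1 * (x3 * y4) = x3 * (x1 * y4)); last by ring.
  by rewrite (_ : x4 * (x3 * y1) = x3 * (x4 * y1)); last by ring.
rewrite ltr_nM2l // in k1; rewrite ltr_nM2l // in k2.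
by have := lt_trans k1 k2; rewrite ltxx.
Qed.

Definition alternating (x1 x2 x3 : int) : bool :=
  [&& 0 < x1, x2 < 0, 0 < x3 & - (x1 + x2 + x3) < 0] ||
  [&& x1 < 0, 0 < x2, x3 < 0 & 0 < - (x1 + x2 + x3)].

Lemma cyc_not_alternating v1 v2 v3 : cyc v1 v2 v3 ->
  ~~ alternating v1.1 v2.1 v3.1 /\ ~~ alternating v1.2 v2.2 v3.2.
Proof.
rewrite /cyc /det /closing /= => /and4P[h1 h2 h3 h4].
split; apply/negP => /orP[] /and4P[p1 p2 p3 p4].
- exact: (no_alternation p1 p2 p3 p4 h1 h2 h3 h4).
- exact: (no_alternation p2 p3 p4 p1 h2 h3 h4 h1).
- apply: (@no_alternation _ _ _ _ (- v1.1) (- v2.1) (- v3.1) (v1.1 + v2.1 + v3.1) p1 p2 p3 p4).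
  + by move: h1; congr (0 < _); ring.
  + by move: h2; congr (0 < _); ring.
  + by move: h3; congr (0 < _); ring.
  + by move: h4; congr (0 < _); ring.
apply: (@no_alternation _ _ _ _ (- v2.1) (- v3.1) (v1.1 + v2.1 + v3.1) (- v1.1) p2 p3 p4 p1).
+ by move: h2; congr (0 < _); ring.
+ by move: h3; congr (0 < _); ring.
+ by move: h4; congr (0 < _); ring.
+ by move: h1; congr (0 < _); ring.
Qed.

(** Without alternation the closed walk climbs from its minimum to its maximum in a single cyclic
    run, so its range is its total ascent. *)
Lemma walk_range (x1 x2 x3 : int) : ~~ alternating x1 x2 x3 ->
  Num.max 0 (Num.max x1 (Num.max (x1 + x2) (x1 + x2 + x3))) -
  Num.min 0 (Num.min x1 (Num.min (x1 + x2) (x1 + x2 + x3))) =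
  (ppart x1 + ppart x2 + ppart x3 + ppart (- (x1 + x2 + x3)))%N.
Proof.
have pE x : (ppart x)%:Z = if 0 <= x then x else 0 by rewrite /ppart; case: ifP; lia.
rewrite !PoszD !pE /alternating.
set M := Num.max 0 _; set N := Num.min 0 _.
have M1 : [/\ 0 <= M, x1 <= M, x1 + x2 <= M & x1 + x2 + x3 <= M].
  by rewrite /M !le_max !lexx !orbT.
have M2 : [\/ M = 0, M = x1, M = x1 + x2 | M = x1 + x2 + x3].
  by rewrite /M /Order.max; do ?[case: ifP => _]; solve [by constructor 1|by constructor 2|by constructor 3|by constructor 4].
have N1 : [/\ N <= 0, N <= x1, N <= x1 + x2 & N <= x1 + x2 + x3].
  by rewrite /N !ge_min !lexx !orbT.
have N2 : [\/ N = 0, N = x1, N = x1 + x2 | N = x1 + x2 + x3].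
  by rewrite /N /Order.min; do ?[case: ifP => _]; solve [by constructor 1|by constructor 2|by constructor 3|by constructor 4].
move: M N M1 M2 N1 N2 => M N [m0 m1 m2 m3] M2 [n0 n1 n2 n3] N2.
clear pE; case: (lerP 0 x1) => s1; case: (lerP 0 x2) => s2; case: (lerP 0 x3) => s3;
  case: (lerP 0 (- (x1 + x2 + x3))) => s4 na; case: M2 => eM; case: N2 => eN; lia.
Qed.

(** * Closed walks in an interval with prescribed steps *)

Section Steps.
Variable m : nat.

Lemma step_proof (a b : 'I_m) : (b + m - a < m + m)%N.
Proof. by have := ltn_ord a; have := ltn_ord b; lia. Qed.

Definition step (a b : 'I_m) : 'I_(m + m) := Ordinal (step_proof a b).

Lemma centered_step a b : centered (step a b) = (b : nat)%:Z - (a : nat)%:Z.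
Proof. by rewrite /centered /=; have := ltn_ord a; lia. Qed.

Definition walk_steps (p : 'I_m * 'I_m * ('I_m * 'I_m)) : 'I_(m + m) * 'I_(m + m) * 'I_(m + m) :=
  (step p.1.1 p.1.2, step p.1.2 p.2.1, step p.2.1 p.2.2).

Lemma centered_inj : injective (@centered m).
Proof. by move=> i j; rewrite /centered => h; apply: val_inj => /=; lia. Qed.

Lemma card_window (l h : nat) : (h <= m)%N -> #|[set a : 'I_m | (l <= a < h)%N]| = (h - l)%N.
Proof.
move=> hm; rewrite -sum1_card big_mkcond /=.
transitivity (\sum_(0 <= a < m | (l <= a < h)%N) 1)%N.
  by rewrite big_mkord [RHS]big_mkcond; apply: eq_bigr => i _; rewrite inE.
rewrite -[RHS]muln1 -sum_nat_const_nat [RHS](big_nat_widen _ _ m) // [RHS](big_nat_widenl l 0) //.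
by apply: eq_bigl => a /=; rewrite andbC.
Qed.

(** The steps and the starting point determine the walk. The admissible starting points form a
    window of length [m] minus the range of the walk. *)
Lemma card_walks (t : 'I_(m + m) * 'I_(m + m) * 'I_(m + m)) :
  ~~ alternating (centered t.1.1) (centered t.1.2) (centered t.2) ->
  #|[set p | walk_steps p == t]| = weight m (centered t.1.1) (centered t.1.2) (centered t.2).
Proof.
case: t => [[i j] k] /=; set x1 := centered i; set x2 := centered j; set x3 := centered k => na.
pose p1 := x1; pose p2 := x1 + x2; pose p3 := x1 + x2 + x3.
pose mx := Num.max 0 (Num.max p1 (Num.max p2 p3)).
pose mn := Num.min 0 (Num.min p1 (Num.min p2 p3)).
have mx0 : 0 <= mx by rewrite le_max lexx.
have mn0 : mn <= 0 by rewrite ge_min lexx.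
have wE : weight m x1 x2 x3 = ((m - `|mx|) - `|mn|)%N.
  have := walk_range na; rewrite /weight -/p1 -/p2 -/p3 -/mx -/mn.
  move: mx0 mn0; move: (_ + _ + _ + _)%N (mx) (mn); clear => S X Y; lia.
rewrite wE -card_window ?leq_subr //.
have inj : {in [set p | walk_steps p == (i, j, k)] &, injective (fun p : 'I_m * 'I_m * ('I_m * 'I_m) => p.1.1)}.
  move=> [[a b] [c d]] [[a' b'] [c' d']]; rewrite !inE /walk_steps /= => /eqP[e1 e2 e3] /eqP[e1' e2' e3'] ea.
  have /eqP := congr1 (@centered m) (etrans e1 (esym e1')).
  have /eqP := congr1 (@centered m) (etrans e2 (esym e2')).
  have /eqP := congr1 (@centered m) (etrans e3 (esym e3')).
  rewrite !centered_step ea => h3 h2 h1.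
  have eb : b = b' by apply: val_inj; move: h1 => /=; lia.
  have ec : c = c' by apply: val_inj; move: h2; rewrite eb /=; lia.
  have ed : d = d' by apply: val_inj; move: h3; rewrite ec /=; lia.
  by rewrite eb ec ed.
rewrite -(card_in_imset inj); congr #|pred_of_set _|; apply/setP => a; rewrite inE.
apply/imsetP/idP => [[[[a' b] [c d]]]|].
  rewrite inE /walk_steps /= => /eqP[e1 e2 e3] ->.
  have := congr1 (@centered m) e1; have := congr1 (@centered m) e2; have := congr1 (@centered m) e3.
  rewrite !centered_step -/x1 -/x2 -/x3 => h3 h2 h1.
  have m1 : - (a' : nat)%:Z <= mn.
    by rewrite /mn !le_min /p1 /p2 /p3 -h1 -h2 -h3; clear; lia.
  have m2 : mx < m%:Z - (a' : nat)%:Z.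
    have := (ltn_ord a', ltn_ord b, ltn_ord c, ltn_ord d).
    by rewrite /mx !gt_max /p1 /p2 /p3 -h1 -h2 -h3; clear => -[[[]]]; lia.
  by move: m1 m2 mx0 mn0; move: (mx) (mn); clear => X Y; lia.
move=> aw.
have bd y : y = p1 \/ y = p2 \/ y = p3 -> 0 <= (a : nat)%:Z + y /\ (a : nat)%:Z + y < m%:Z.
  move=> hy; have y1 : mn <= y.
    by case: hy => [->|[->|->]]; rewrite /mn !ge_min lexx ?orbT.
  have y2 : y <= mx.
    by case: hy => [->|[->|->]]; rewrite /mx !le_max lexx ?orbT.
  move: aw y1 y2 mx0 mn0 (ltn_ord a); move: (mx) (mn); clear => X Y; lia.
have ex y : y = p1 \/ y = p2 \/ y = p3 -> exists b : 'I_m, (b : nat)%:Z = (a : nat)%:Z + y.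
  move=> /bd[]; case: (_ + y) => // b _ bm.
  by exists (Ordinal (bm : (b < m)%N)).
have [b be] := ex p1 (or_introl erefl).
have [c ce] := ex p2 (or_intror (or_introl erefl)).
have [d de] := ex p3 (or_intror (or_intror erefl)).
exists ((a, b), (c, d)) => //; rewrite inE /walk_steps /=.
apply/eqP; congr (_, _, _); apply: centered_inj; rewrite centered_step.
- by rewrite be /p1 addrC addKr.
- by rewrite ce be /p1 /p2 -/x2; ring.
- by rewrite de ce /p2 /p3 -/x3; ring.
Qed.

End Steps.

Lemma sum_nat_partition (T U : finType) (f : T -> U) (P : pred T) :
  #|[set x | P x]| = (\sum_(u : U) #|[set x | P x && (f x == u)]|)%N.
Proof.
rewrite -sum1_card (partition_big f predT) //=; apply: eq_bigr => u _.
by rewrite -sum1_card; apply: eq_bigl => x; rewrite !inE.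
Qed.

(** * Symmetrization over the orders of the edge vectors *)

Section Valtr.
Variables m n : nat.
Notation quad := ((grid m n * grid m n) * (grid m n * grid m n))%type.
Notation box := ('I_(m + m) * 'I_(n + n))%type.
Implicit Types (u v w : box) (a b : grid m n) (q : quad).

Definition box_vec u : int * int := (centered u.1, centered u.2).

Definition box_step a b : box := (step a.1 b.1, step a.2 b.2).

Lemma box_vec_step a b : box_vec (box_step a b) = vec (pt a) (pt b).
Proof. by rewrite /box_vec !centered_step. Qed.

Definition box_weight u v w : nat :=
  (weight m (centered u.1) (centered v.1) (centered w.1) *
   weight n (centered u.2) (centered v.2) (centered w.2))%N.

Definition quad_steps q : box * box * box :=
  (box_step q.1.1 q.1.2, box_step q.1.2 q.2.1, box_step q.2.1 q.2.2).

Definition box_cyc u v w := cyc (box_vec u) (box_vec v) (box_vec w).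

Definition box_generic u v w := generic (box_vec u) (box_vec v) (box_vec w).

Lemma convex_cyc q : convex q = box_cyc (quad_steps q).1.1 (quad_steps q).1.2 (quad_steps q).2.
Proof.
rewrite /box_cyc !box_vec_step /convex /convex_quad /cyc /=.
move: (pt q.1.1) (pt q.1.2) (pt q.2.1) (pt q.2.2) => a b c d.
have -> : orient a b c = det (vec a b) (vec b c) by rewrite /orient /det /=; ring.
have -> : orient b c d = det (vec b c) (vec c d) by rewrite /orient /det /=; ring.
have -> : orient c d a = det (vec c d) (closing (vec a b) (vec b c) (vec c d)).
  by rewrite /orient /det /=; ring.
have -> // : orient d a b = det (closing (vec a b) (vec b c) (vec c d)) (vec a b).
by rewrite /orient /det /=; ring.
Qed.

Lemma card_quads_steps t : box_cyc t.1.1 t.1.2 t.2 ->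
  #|[set q | quad_steps q == t]| = box_weight t.1.1 t.1.2 t.2.
Proof.
move=> ct; have [ax ay] := cyc_not_alternating ct.
pose tx := (t.1.1.1, t.1.2.1, t.2.1); pose ty := (t.1.1.2, t.1.2.2, t.2.2).
rewrite /box_weight -(@card_walks m tx) // -(@card_walks n ty) // -cardsX.
pose g q := (((q.1.1.1, q.1.2.1), (q.2.1.1, q.2.2.1)), ((q.1.1.2, q.1.2.2), (q.2.1.2, q.2.2.2))).
have gI : injective g.
  by move=> [[[? ?] [? ?]] [[? ?] [? ?]]] [[[? ?] [? ?]] [[? ?] [? ?]]] [-> -> -> -> -> -> -> ->].
rewrite -(card_imset _ gI); congr #|pred_of_set _|; apply/setP => -[[[a b] [c d]] [[a' b'] [c' d']]].
have tE : t = ((tx.1.1, ty.1.1), (tx.1.2, ty.1.2), (tx.2, ty.2)).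
  by case: t {ct ax ay} @tx @ty => [[[? ?] [? ?]] [? ?]].
rewrite !inE /=; apply/imsetP/andP => [[q]|].
  rewrite inE {1}tE => /eqP h [-> -> -> -> -> -> -> ->]; move: h => [h1 h2 h3 h4 h5 h6].
  by rewrite /walk_steps /= h1 h2 h3 h4 h5 h6; split; apply/eqP.
move=> [/eqP hx /eqP hy]; exists (((a, a'), (b, b')), ((c, c'), (d, d'))) => //.
by rewrite inE {1}tE -hx -hy.
Qed.

Lemma card_convex_box : #|[set q : quad | convex q]| =
  (\sum_(t : box * box * box) box_cyc t.1.1 t.1.2 t.2 * box_weight t.1.1 t.1.2 t.2)%N.
Proof.
rewrite (sum_nat_partition quad_steps); apply: eq_bigr => t _.
case: (boolP (box_cyc _ _ _)) => ct.
  rewrite mul1n -card_quads_steps //; congr #|pred_of_set _|; apply/setP => q; rewrite !inE.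
  by case: eqP => [qt|]; rewrite ?andbF // convex_cyc qt ct.
rewrite mul0n; apply/eqP; rewrite cards_eq0; apply/eqP/setP => q; rewrite !inE.
by case: eqP => [qt|]; rewrite ?andbF // convex_cyc qt (negPf ct).
Qed.

Lemma sum_box_weight : (\sum_(t : box * box * box) box_weight t.1.1 t.1.2 t.2 =
  total_weight m * total_weight n)%N.
Proof.
have tE (k : nat) : total_weight k = (\sum_(t : 'I_(k + k) * 'I_(k + k) * 'I_(k + k))
    weight k (centered t.1.1) (centered t.1.2) (centered t.2))%N.
  by rewrite /total_weight pair_bigA /= pair_bigA.
rewrite !tE big_distrl /=; under [RHS]eq_bigr do rewrite big_distrr /=.
rewrite pair_bigA /=.
pose h (p : ('I_(m + m) * 'I_(m + m) * 'I_(m + m)) * ('I_(n + n) * 'I_(n + n) * 'I_(n + n))) : box * box * box :=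
  ((p.1.1.1, p.2.1.1), (p.1.1.2, p.2.1.2), (p.1.2, p.2.2)).
rewrite (reindex h) //.
exists (fun t : box * box * box => ((t.1.1.1, t.1.2.1, t.2.1), (t.1.1.2, t.1.2.2, t.2.2))).
  by move=> [[[? ?] ?] [[? ?] ?]] _.
by move=> [[[? ?] [? ?]] [? ?]] _.
Qed.

Lemma det_line (v u u' : int * int) : v != (0, 0) -> det v u = det v u' ->
  (if v.1 == 0 then u.2 = u'.2 else u.1 = u'.1) -> u = u'.
Proof.
case: v u u' => [v1 v2] [x y] [x' y']; rewrite xpair_eqE /det /=.
case: (eqVneq v1 0) => [->|v10] /=.
  by move=> v20 E ->; congr (_, _); apply: (mulfI v20); lia.
by move=> _ E e; rewrite -e in E *; congr (_, _); apply: (mulfI v10); lia.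
Qed.

Definition degenerate (s : bool) (t : box * box * box) : bool :=
  det (box_vec t.1.1) (box_vec t.1.2) +
    (if s then det (box_vec t.1.1) (box_vec t.2) else 0) == 0.

(** If the first vector is nonzero, the condition puts the second on a line depending on the other
    two, where one coordinate determines it. [None] records the case of a zero first vector. *)
Lemma card_degenerate (s : bool) :
  (#|[set t | degenerate s t]| <= (4 * (m * n)) ^ 2 * (2 * (m + n) + 1))%N.
Proof.
pose f (t : box * box * box) : box * box * option ('I_(m + m) + 'I_(n + n)) :=
  if box_vec t.1.1 == (0, 0) then (t.1.2, t.2, None)
  else (t.1.1, t.2, Some (if (box_vec t.1.1).1 == 0 then inr t.1.2.2 else inl t.1.2.1)).
have vI : injective box_vec.
  by move=> [x y] [x' y'] [/(@centered_inj m) -> /(@centered_inj n) ->].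
have -> : ((4 * (m * n)) ^ 2 * (2 * (m + n) + 1) = #|{: box * box * option ('I_(m + m) + 'I_(n + n))}|)%N.
  by rewrite !card_prod card_option card_sum !card_ord; ring.
rewrite -(card_in_imset (f := f)) ?max_card // => -[[v u] w] [[v' u'] w'].
rewrite !inE /degenerate /f /= => /eqP E /eqP E'.
case: (eqVneq (box_vec v) (0, 0)) => [v0|v0]; case: (eqVneq (box_vec v') (0, 0)) => [v0'|v0'] //.
  by move=> [-> ->]; congr (_, _, _); apply: vI; rewrite v0 v0'.
case=> ev ew h; rewrite -{}ev -{}ew in E' h *; congr (_, _, _).
apply: vI; apply: (det_line v0).
  by apply: (addIr (if s then det (box_vec v) (box_vec w) else 0)); rewrite E E'.
by move: h; case: ifP => _ [] e; rewrite /box_vec /= e.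
Qed.

Lemma card_not_generic :
  (#|[set t : box * box * box | ~~ box_generic t.1.1 t.1.2 t.2]| <=
   6 * ((4 * (m * n)) ^ 2 * (2 * (m + n) + 1)))%N.
Proof.
pose D := degenerate.
pose p1 (t : box * box * box) : box * box * box := (t.1.1, t.2, t.1.2).
pose p2 (t : box * box * box) : box * box * box := (t.1.2, t.2, t.1.1).
pose p3 (t : box * box * box) : box * box * box := (t.1.2, t.1.1, t.2).
pose p4 (t : box * box * box) : box * box * box := (t.2, t.1.1, t.1.2).
have i1 : injective p1 by move=> [[? ?] ?] [[? ?] ?] [-> -> ->].
have i2 : injective p2 by move=> [[? ?] ?] [[? ?] ?] [-> -> ->].
have i3 : injective p3 by move=> [[? ?] ?] [[? ?] ?] [-> -> ->].
have i4 : injective p4 by move=> [[? ?] ?] [[? ?] ?] [-> -> ->].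
have c s (p : box * box * box -> box * box * box) : injective p -> (#|[set t | D s (p t)]| <= (4 * (m * n)) ^ 2 * (2 * (m + n) + 1))%N.
  by move=> pI; exact: (leq_trans (card_preim_inj (D s) pI) (card_degenerate s)).
have cov : [set t : box * box * box | ~~ box_generic t.1.1 t.1.2 t.2] \subset
   [set t | D false (id t)] :|: ([set t | D false (p1 t)] :|: ([set t | D false (p2 t)] :|:
   ([set t | D true (id t)] :|: ([set t | D true (p3 t)] :|: [set t | D true (p4 t)])))).
  apply/fintype.subsetP => -[[u v] w]; rewrite !inE /D /degenerate /= /box_generic /generic.
  move: (box_vec u) (box_vec v) (box_vec w) => a b d.
  rewrite (det_anti a b) (det_anti a d) (det_anti b d).
  move: (det a b) (det a d) (det b d) => x y z; clear; lia.
apply: leq_trans (subset_leq_card cov) _; move: c; set K := (_ ^ 2 * _)%N => c.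
rewrite !mulSn mul0n addn0.
do 5 (apply: leq_trans (leq_card_setU _ _) _; apply: leq_add; first exact: c).
exact: c.
Qed.

Lemma box_weight_le u v w : (box_weight u v w <= m * n)%N.
Proof. by rewrite leq_mul // leq_subr. Qed.

(** With the closing vector kept last, the 3! orders of the other three are all the cyclic orders of
    the four. The weight is symmetric, so [one_cycle] makes the convex orders one sixth of the
    generic sum. [E] bounds the nongeneric triples, each of weight at most [m * n]. *)
Lemma valtr_bounds : let N := #|[set q : quad | convex q]| in
  let E := (m * n * (6 * ((4 * (m * n)) ^ 2 * (2 * (m + n) + 1))))%N in
  (6 * N <= total_weight m * total_weight n + 6 * E)%N /\
  (total_weight m * total_weight n <= 6 * N + E)%N.
Proof.
move=> N E.
pose G (t : box * box * box) := box_generic t.1.1 t.1.2 t.2.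
pose W (t : box * box * box) := box_weight t.1.1 t.1.2 t.2.
have bad (P : pred (box * box * box)) : (\sum_(t | ~~ G t) P t * W t <= E)%N.
  apply: (@leq_trans (\sum_(t | ~~ G t) m * n)).
    by apply: leq_sum => t _; rewrite -[leqRHS]mul1n leq_mul ?leq_b1 ?box_weight_le.
  rewrite sum_nat_const mulnC leq_mul //.
  apply: leq_trans card_not_generic; apply: eq_leq; apply: eq_card => t; by rewrite !inE.
have NE : N = (\sum_(t | G t) box_cyc t.1.1 t.1.2 t.2 * W t + \sum_(t | ~~ G t) box_cyc t.1.1 t.1.2 t.2 * W t)%N.
  by rewrite /N card_convex_box (bigID G).
have TE : (total_weight m * total_weight n = \sum_(t | G t) W t + \sum_(t | ~~ G t) predT t * W t)%N.
  rewrite -sum_box_weight (bigID G) /=; congr (_ + _)%N.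
  by apply: eq_bigr => t _; rewrite mul1n.
pose F u v w := (box_generic u v w * (box_cyc u v w * box_weight u v w))%N.
have g12 u v w : box_generic v u w = box_generic u v w by apply: generic12.
have g23 u v w : box_generic u w v = box_generic u v w by apply: generic23.
have w12 u v w : box_weight v u w = box_weight u v w by rewrite /box_weight !(weight12 _ (centered u.1)) !(weight12 _ (centered u.2)).
have w23 u v w : box_weight u w v = box_weight u v w by rewrite /box_weight !(weight23 _ _ (centered v.1)) !(weight23 _ _ (centered v.2)).
have FE : (\sum_(t | G t) box_cyc t.1.1 t.1.2 t.2 * W t = \sum_(t : box * box * box) F t.1.1 t.1.2 t.2)%N.
  by rewrite big_mkcond; apply: eq_bigr => t _; rewrite /F /G; case: ifP; rewrite ?mul1n ?mul0n.
have six : (\sum_(t | G t) W t = 6 * (\sum_(t : box * box * box) F t.1.1 t.1.2 t.2))%N.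
  have e213 := sum_sym12 F; have e132 := sum_sym23 F.
  have e231 := etrans e132 (sum_sym12 (fun u v w => F u w v)).
  have e312 := etrans e213 (sum_sym23 (fun u v w => F v u w)).
  have e321 := etrans e231 (sum_sym23 (fun u v w => F v w u)).
  transitivity (\sum_(t : box * box * box) (F t.1.1 t.1.2 t.2 + F t.1.2 t.1.1 t.2 +
     F t.1.1 t.2 t.1.2 + F t.2 t.1.2 t.1.1 + F t.1.2 t.2 t.1.1 + F t.2 t.1.1 t.1.2))%N; last first.
    by rewrite !big_split /= -e213 -e132 -e321 -e231 -e312; ring.
  rewrite big_mkcond; apply: eq_bigr => -[[u v] w] _; rewrite /G /W /F /=.
  have g213 := g12 u v w; have g132 := g23 u v w.
  have g231 : box_generic v w u = box_generic u v w by rewrite g23 g12.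
  have g312 : box_generic w u v = box_generic u v w by rewrite g12 g23.
  have g321 : box_generic w v u = box_generic u v w by rewrite g12 g23 g12.
  have w213 := w12 u v w; have w132 := w23 u v w.
  have w231 : box_weight v w u = box_weight u v w by rewrite w23 w12.
  have w312 : box_weight w u v = box_weight u v w by rewrite w12 w23.
  have w321 : box_weight w v u = box_weight u v w by rewrite w12 w23 w12.
  rewrite g213 g132 g231 g312 g321 w213 w132 w231 w312 w321.
  case: (boolP (box_generic u v w)) => g; last by rewrite !mul0n.
  by rewrite !mul1n -!mulnDl (one_cycle g) mul1n.
have b1 := bad predT; have b2 := bad (fun t => box_cyc t.1.1 t.1.2 t.2).
rewrite NE TE FE six mulnDr; split; last by rewrite -addnA leq_add2l (leq_trans b1) // leq_addl.
by rewrite -addnA leq_add2l (leq_trans _ (leq_addl _ _)) // leq_mul2l b2.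
Qed.

End Valtr.

(** * Asymptotics *)

Section PrimeDensity.
Variables (R : realType) (m n : nat).
Hypotheses (m0 : (0 < m)%N) (n0 : (0 < n)%N).
Notation quad := ((grid m n * grid m n) * (grid m n * grid m n))%type.
Implicit Types (q : quad) (P : pred quad).

Local Notation rho := (6 / pi ^+ 2 : R).
Let V : R := (m * n)%:R ^+ 4.
Let eta : R := (m + n)%:R * (m * n)%:R ^+ 3.

Definition gcd1 q := gcd_pair q.1.1 q.1.2.
Definition gcd2 q := gcd_pair q.2.1 q.2.2.

Lemma gcd_pair_lt (a b : grid m n) : (gcd_pair a b < m + n)%N.
Proof.
rewrite /gcd_pair; have [E|N] := eqVneq (a.1 : nat) b.1.
  by rewrite /pt /= E subrr gcd0n; have := ltn_ord a.2; have := ltn_ord b.2; lia.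
apply: leq_ltn_trans (dvdn_leq _ (dvdn_gcdl _ _)) _.
  by rewrite absz_gt0 subr_eq0 eqz_nat eq_sym.
by rewrite /pt /=; have := ltn_ord a.1; have := ltn_ord b.1; lia.
Qed.

Lemma convex_gcd1 q : convex q -> gcd1 q != 0%N.
Proof.
case: q => [[a b] [c d]]; rewrite /convex /convex_quad /gcd1 /gcd_pair /= => /and4P[h _ _ _].
apply/eqP => g0; have : (0 < 0 :> int); last by [].
have z1 : (pt b).1 - (pt a).1 = 0.
  by apply/eqP; rewrite -absz_eq0 -dvd0n -g0 dvdn_gcdl.
have z2 : (pt b).2 - (pt a).2 = 0.
  by apply/eqP; rewrite -absz_eq0 -dvd0n -g0 dvdn_gcdr.
by move: h; rewrite /orient /det /= z1 z2 !mul0r subrr.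
Qed.

Lemma card_quad P : (#|[set q | P q]|%:R : R) <= V.
Proof.
rewrite /V -natrX ler_nat; apply: leq_trans (max_card _) _.
by rewrite !card_prod !card_ord !expnS expn0 muln1; apply: eq_leq; ring.
Qed.

Lemma sum_gcd_classes (f : quad -> nat) P d : (forall q, f q < m + n)%N ->
  \sum_(0 <= g < m + n | (d %| g)%N) (#|[set q | P q && (f q == g)]|%:R : R) =
  #|[set q | P q && (d %| f q)%N]|%:R.
Proof.
move=> fl; rewrite -natr_sum; congr _%:R.
pose F q : 'I_(m + n) := Ordinal (fl q).
rewrite (sum_nat_partition F) big_mkord big_mkcond /=; apply: eq_bigr => g _.
case: ifP => dg.
  congr #|pred_of_set _|; apply/setP => q; rewrite !inE -andbA; congr (_ && _).
  rewrite -val_eqE /=; case: eqP => [->|]; last by rewrite andbF.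
  by rewrite dg.
apply/esym/eqP; rewrite cards_eq0; apply/eqP/setP => q; rewrite !inE -andbA.
rewrite -val_eqE /=; case: eqP => [->|]; rewrite ?andbF //.
by rewrite dg andbF.
Qed.

Lemma card_gcd_pair_tail (L : nat) : (0 < L)%N ->
  (#|[set p : grid m n * grid m n | (L < gcd_pair p.1 p.2)%N]|%:R : R) <=
  (m * n)%:R * ((m + n)%:R + 2 * (m * n)%:R / L%:R).
Proof.
move=> L0.
have -> : #|[set p : grid m n * grid m n | (L < gcd_pair p.1 p.2)%N]| =
    (\sum_(a : grid m n) #|[set b | (L < gcd_pair a b)%N]|)%N.
  rewrite (sum_nat_partition fst); apply: eq_bigr => a _.
  rewrite -(card_imset (mem [set b | (L < gcd_pair a b)%N]) (f := pair a)); last by move=> b b' [].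
  congr #|pred_of_set _|; apply/setP => -[a' b]; rewrite inE /=.
  apply/andP/imsetP => [[h /eqP e] | [b' + [-> ->]]].
    by exists b; [rewrite inE -e|rewrite e].
  by rewrite inE => ->.
rewrite natr_sum; apply: le_trans (_ : \sum_(a : grid m n) ((m + n)%:R + 2 * (m * n)%:R / L%:R) <= _).
  apply: ler_sum => a _; apply: le_trans (_ : ((m + n) + \sum_(L.+1 <= g < m) #|[set b : grid m n | [&& b.1 != a.1, b.2 != a.2 & (g %| gcd_pair a b)%N]]|)%:R <= _).
    by rewrite ler_nat card_gcd_gt.
  rewrite natrD lerD2l natr_sum.
  apply: le_trans (_ : \sum_(L.+1 <= g < m) (m * n)%:R * g%:R ^- 2 <= _).
    apply: ler_sum_nat => g /andP[Lg _].
    have g0 : (0 < g)%N by apply: leq_ltn_trans Lg.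
    by rewrite ler_pdivlMr ?exprn_gt0 ?ltr0n // -natrX -natrM ler_nat mulnC card_gcd_dvd.
  rewrite -big_distrr /=; have [Lm|mL] := leqP L.+1 m; last first.
    by rewrite big_geq 1?ltnW // mulr0 divr_ge0 ?mulr_ge0.
  rewrite [leRHS](_ : _ = (m * n)%:R * (2 / L%:R)); last by ring.
  apply: ler_wpM2l => //; apply: le_trans (inv_sq_tail R (ltn0Sn L) Lm) _.
  apply: le_trans (_ : 2 / L.+1%:R <= _); first by rewrite gerBl divr_ge0.
  by apply: ler_wpM2l => //; rewrite lef_pV2 ?posrE ?ltr0n // ler_nat.
by rewrite sumr_const card_prod !card_ord -[leLHS]mulr_natl.
Qed.

Lemma card_tail P (L : nat) : (0 < L)%N ->
  \sum_(L.+1 <= g < m + n) (#|[set q | P q && (gcd1 q == g)]|%:R : R) <= eta + 2 * V / L%:R.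
Proof.
move=> L0; rewrite -natr_sum.
apply: le_trans (_ : (#|[set q : quad | (L < gcd1 q)%N]|%:R : R) <= _).
  rewrite ler_nat (sum_nat_partition (fun q => Ordinal (gcd_pair_lt q.1.1 q.1.2))).
  have [LM|ML] := leqP L.+1 (m + n); last by rewrite big_geq // ltnW.
  rewrite -(big_mkord predT (fun g => #|[set q : quad | (L < gcd1 q)%N && (gcd1 q == g)]|)).
  rewrite [leqRHS](big_cat_nat (n := L.+1)) //=; apply: leq_trans (leq_addl _ _).
  rewrite big_nat [leqRHS]big_nat; apply: leq_sum => g /andP[Lg _].
  apply/subset_leq_card/fintype.subsetP => q; rewrite !inE => /andP[_ /eqP ->].
  by rewrite Lg eqxx.
have -> : [set q : quad | (L < gcd1 q)%N] = setX [set p : grid m n * grid m n | (L < gcd_pair p.1 p.2)%N] setT.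
  by apply/setP => q; rewrite !inE andbT.
rewrite cardsX cardsT natrM !card_prod !card_ord.
apply: le_trans (ler_wpM2r _ (card_gcd_pair_tail L0)) _ => //.
rewrite le_eqVlt; apply/orP; left; apply/eqP.
rewrite /eta /V (natrM _ (m * n) (m * n)); move: (m * n)%:R (m + n)%:R => x y.
have LN : L%:R != 0 :> R by rewrite pnatr_eq0 -lt0n.
by field.
Qed.

Lemma count_dvd_real P d : (0 < d)%N -> second_side P ->
  `|(count_dvd P d)%:R - (count_dvd P 1)%:R / d%:R ^+ 2| <= eta.
Proof.
move=> d0 sP; have [h1 h2] := count_dvd_equi d0 sP.
have dR : 0 < d%:R ^+ 2 :> R by rewrite exprn_gt0 ?ltr0n.
have e1 : d%:R ^+ 2 * (count_dvd P d)%:R <= (count_dvd P 1)%:R + d%:R ^+ 2 * eta.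
  by rewrite /eta -!natrX -!natrM -natrD ler_nat mulnA.
have e2 : (count_dvd P 1)%:R <= d%:R ^+ 2 * (count_dvd P d)%:R + d%:R ^+ 2 * eta.
  by rewrite /eta -!natrX -!natrM -natrD ler_nat mulnA.
rewrite -(ler_pM2l dR) -[X in X * `|_|](gtr0_norm dR) -normrM mulrBr.
rewrite [d%:R ^+ 2 * (_ / _)]mulrC divfK ?gt_eqF // ler_norml; lra.
Qed.

Lemma eta_ge0 : 0 <= eta. Proof. by rewrite mulr_ge0 ?exprn_ge0. Qed.

Lemma V_div_le : V / (m + n)%:R <= eta.
Proof.
have s0 : 0 < (m + n)%:R :> R by rewrite ltr0n addn_gt0 m0.
rewrite ler_pdivrMr // /V /eta mulrAC exprS ler_wpM2r ?exprn_ge0 //.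
rewrite -natrM ler_nat; nia.
Qed.

Definition opp_gcd (e : nat) : pred quad := fun q => (e %| gcd2 q)%N.

(** Sieves the first edge while the gcd of the opposite edge is a multiple of [e]. The error does
    not depend on [e], which lets this bound serve as the divisibility hypothesis of the second
    sieve. *)
Lemma first_sieve (e L : nat) : (0 < L)%N ->
  `|#|[set q | [&& convex q, (gcd1 q == 1)%N & opp_gcd e q]]|%:R - rho * (count_dvd (opp_gcd e) 1)%:R|
    <= (3 * 2 ^+ L + 1) * eta + 4 * V / L%:R.
Proof.
move=> L0; have sP : second_side (opp_gcd e) by [].
pose P g : R := #|[set q | (convex q && opp_gcd e q) && (gcd1 q == g)]|%:R.
have F (d : nat) : \sum_(0 <= g < m + n | (d %| g)%N) P g = (count_dvd (opp_gcd e) d)%:R.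
  rewrite (sum_gcd_classes (fun q => convex q && opp_gcd e q) _ (fun q => gcd_pair_lt q.1.1 q.1.2)).
  by congr (#|pred_of_set _|%:R); apply/setP => q; rewrite !inE andbA.
have P0 : P 0%N = 0.
  rewrite /P (_ : [set _ | _] = set0) ?cards0 //; apply/setP => q; rewrite !inE.
  by case: (boolP (convex q)) => //= /convex_gcd1 /negPf ->; rewrite andbF.
set C : R := (count_dvd (opp_gcd e) 1)%:R.
have CV : C <= V by apply: card_quad.
have M1 : (1 < m + n)%N by lia.
have := @sieve R P C eta (eta + 2 * V / L%:R) (m + n) L _ P0 _ M1 L0.
have -> : P 1%N = #|[set q | [&& convex q, (gcd1 q == 1)%N & opp_gcd e q]]|%:R.
  congr (#|pred_of_set _|%:R); apply/setP => q; rewrite !inE.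
  by rewrite -andbA [opp_gcd e q && _]andbC.
move=> H; apply: le_trans (H _ _ _ _) _ => //.
- by move=> d d0; rewrite F; apply: count_dvd_real.
- exact: card_tail.
have Ls : 0 < L%:R :> R by rewrite ltr0n.
have c1 : C / (m + n)%:R <= eta by apply: le_trans V_div_le; rewrite ler_wpM2r ?invr_ge0.
have c2 : C / L%:R <= V / L%:R by rewrite ler_wpM2r ?invr_ge0 // ltW.
have e0 := eta_ge0; have t0 : 0 <= 2 ^+ L :> R by rewrite exprn_ge0.
have c3 := ler_wpM2l t0 c1.
move: c1 c2 c3; rewrite -!(mulrA 2) -!(mulrA 4).
move: (C / _) (C / _) (V / L%:R) (2 ^+ L) t0 => x y z a a0 c1 c2 c3.
have -> : a * (eta + 2 * y) = a * eta + 2 * (a * y) by ring.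
lra.
Qed.

(** The second sieve runs over the quadrilaterals whose first edge is already coprime, with total
    mass [rho * N]. Its hypothesis at [e] combines [first_sieve] with equidistribution of the second
    edge, carried over by [swap]. *)
Lemma prime_quads_sieve (L1 L2 : nat) : (0 < L1)%N -> (0 < L2)%N ->
  `|#|prime_quads m n|%:R - rho ^+ 2 * #|[set q : quad | convex q]|%:R| <=
  2 ^+ L2 * ((3 * 2 ^+ L1 + 4) * eta + 4 * V / L1%:R) + eta + 4 * V / L2%:R.
Proof.
move=> L10 L20; have [r0 r1] := rho_bounds R.
pose P h : R := #|[set q | (convex (swap q) && (gcd2 q == 1)%N) && (gcd1 q == h)]|%:R.
pose T : pred quad := fun=> true.
set N : R := #|[set q : quad | convex q]|%:R.
have NEn : #|[set q : quad | convex q]| = count_dvd T 1.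
  by rewrite /count_dvd; apply: eq_card => q; rewrite !inE dvd1n !andbT.
have NE : N = (count_dvd T 1)%:R by rewrite /N NEn.
have F (e : nat) : \sum_(0 <= h < m + n | (e %| h)%N) P h =
    #|[set q | [&& convex q, (gcd1 q == 1)%N & opp_gcd e q]]|%:R.
  rewrite (sum_gcd_classes (fun q => convex (swap q) && (gcd2 q == 1)%N) _ (fun q => gcd_pair_lt q.1.1 q.1.2)).
  congr _%:R; transitivity #|[set q | (fun r => [&& convex r, (gcd1 r == 1)%N & opp_gcd e r]) (swap q)]|.
    by apply: eq_card => q; rewrite !inE -andbA.
  exact: card_swap.
have P0 : P 0%N = 0.
  rewrite /P (_ : [set _ | _] = set0) ?cards0 //; apply/setP => q; rewrite !inE convex_swap.
  by case: (boolP (convex q)) => //= /convex_gcd1 /negPf ->; rewrite andbF.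
have NV : N <= V by apply: card_quad.
have M1 : (1 < m + n)%N by lia.
have CE (e : nat) : (count_dvd (opp_gcd e) 1)%:R = (count_dvd T e)%:R :> R.
  congr _%:R; rewrite /count_dvd.
  transitivity #|[set q | (fun r => [&& convex r, T r & (e %| gcd_pair r.1.1 r.1.2)%N]) (swap q)]|; last exact: card_swap.
  by apply: eq_card => q; rewrite !inE dvd1n convex_swap andbT.
have N0 : 0 <= rho * N by rewrite mulr_ge0 // ltW.
have := @sieve R P (rho * N) ((3 * 2 ^+ L1 + 2) * eta + 4 * V / L1%:R) (eta + 2 * V / L2%:R) (m + n) L2 _ P0 N0 M1 L20.
have -> : P 1%N = #|prime_quads m n|%:R.
  congr _%:R; transitivity #|[set q | (fun r => r \in prime_quads m n) (swap q)]|; last first.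
    by rewrite card_swap; apply: eq_card => q; rewrite inE.
  apply: eq_card => q; rewrite !inE.
  rewrite /coprime_pair /coprime /gcd1 /gcd2 /gcd_pair /= -[convex (q.2, q.1)]/(convex (swap q)).
  by case: (convex (swap q)); rewrite ?andbT ?andbF.
have -> : rho * (rho * N) = rho ^+ 2 * N by rewrite mulrA.
move=> H; apply: le_trans (H _ _ _) _ => //.
- move=> e e0; rewrite F.
  have f := @first_sieve e L1 L10; rewrite CE in f.
  have g := @count_dvd_real T e e0 (fun _ _ _ => erefl); rewrite -NE in g.
  rewrite -(subrK (rho * (count_dvd T e)%:R) #|_|%:R) -addrA.
  apply: le_trans (ler_normD _ _) _.
  have -> : rho * (count_dvd T e)%:R - rho * N / e%:R ^+ 2 = rho * ((count_dvd T e)%:R - N / e%:R ^+ 2).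
    by rewrite mulrBr mulrA.
  rewrite normrM (gtr0_norm r0).
  have : rho * `|(count_dvd T e)%:R - N / e%:R ^+ 2| <= 1 * eta by rewrite ler_pM // ltW.
  move: f; move: `|_ - _| (rho * _) => x y; lra.
- exact: card_tail.
have Ls : 0 < L2%:R :> R by rewrite ltr0n.
have rN : rho * N <= V by apply: le_trans NV; rewrite ler_piMl.
have c1 : rho * N / (m + n)%:R <= eta by apply: le_trans V_div_le; rewrite ler_wpM2r ?invr_ge0.
have c2 : rho * N / L2%:R <= V / L2%:R by rewrite ler_wpM2r ?invr_ge0 // ltW.
have e0 := eta_ge0; have t0 : 0 <= 2 ^+ L2 :> R by rewrite exprn_ge0.
have c3 := ler_wpM2l t0 c1.
move: c1 c2 c3; rewrite -!(mulrA 2) -!(mulrA 4).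
move: (rho * N / _) (rho * N / _) (V / L2%:R) (V / L1%:R) (2 ^+ L1) (2 ^+ L2) t0 => x y z w a b b0 c1 c2 c3.
have -> : b * ((3 * a + 2) * eta + 4 * w + 2 * y) = b * ((3 * a + 2) * eta + 4 * w) + 2 * (b * y) by ring.
have -> : b * ((3 * a + 4) * eta + 4 * w) = b * ((3 * a + 2) * eta + 4 * w) + 2 * (b * eta) by ring.
lra.
Qed.

End PrimeDensity.

Section Bounds.
Variables (m n : nat).
Hypotheses (m0 : (0 < m)%N) (n0 : (0 < n)%N).

Let e : nat := ((m + n) * (m * n) ^ 3)%N.

(** [26 = 4 + 6 + 16]: flat quadruples, half-planes and wedges missing the border. *)
Lemma two_lins_prime_quads :
  (2 * #|two_lins m n| <= #|prime_quads m n| + 26 * e)%N /\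
  (#|prime_quads m n| <= 2 * #|two_lins m n| + 8 * e)%N.
Proof.
have e1 : (m ^ 3 * n ^ 4 + m ^ 4 * n ^ 3 = e)%N by rewrite /e; ring.
have e2 : ((m * n) ^ 3 * (m + n) = e)%N by rewrite /e mulnC.
have mn0 : (0 < m * n)%N by rewrite muln_gt0 m0.
have e3 : ((m * n) ^ 2 + 2 <= 3 * e)%N.
  have h1 : (1 <= m + n)%N by rewrite addn_gt0 m0.
  have h2 : ((m * n) ^ 2 <= (m * n) ^ 3)%N by rewrite leq_pexp2l.
  have h3 : ((m * n) ^ 3 <= e)%N by rewrite /e leq_pmull.
  have h4 : (1 <= (m * n) ^ 2)%N by rewrite expn_gt0 mn0.
  lia.
have := two_lins_upper m n; have := two_lins_lower m n; rewrite e1 e2; lia.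
Qed.

(** [288 = 96 * 3] comes from [2 * (m + n) + 1 <= 3 * (m + n)]; one more [e] absorbs the lower terms
    of the two total weights. *)
Lemma convex_count : let N := #|[set q : (grid m n * grid m n) * (grid m n * grid m n) | convex q]%SET| in
  (216 * N <= 25 * (m * n) ^ 4 + 216 * (289 * e))%N /\
  (25 * (m * n) ^ 4 <= 216 * N + 216 * (289 * e))%N.
Proof.
move=> N; have := valtr_bounds m n; rewrite -/N /=.
set E := (m * n * _)%N => -[h1 h2].
have h1' : (1 <= m + n)%N by rewrite addn_gt0 m0.
have hE : (E <= 288 * e)%N.
  have -> : E = (96 * (m * n) ^ 3 * (2 * (m + n) + 1))%N by rewrite /E; ring.
  have -> : (288 * e = 96 * (m * n) ^ 3 * (3 * (m + n)))%N by rewrite /e; ring.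
  by rewrite leq_mul //; lia.
have S : (36 * (total_weight m * total_weight n) =
   25 * (m * n) ^ 4 + (5 * (m ^ 4 * n ^ 2) + 5 * (m ^ 2 * n ^ 4) + m ^ 2 * n ^ 2))%N.
  have -> : (36 * (total_weight m * total_weight n) = (6 * total_weight m) * (6 * total_weight n))%N by ring.
  by rewrite !total_weightE; ring.
have e1 : (e = m ^ 3 * n ^ 4 + m ^ 4 * n ^ 3)%N by rewrite /e; ring.
have k1 : (m ^ 4 * n ^ 2 <= e)%N.
  by rewrite e1 (leq_trans _ (leq_addl _ _)) // leq_mul // leq_pexp2l.
have k2 : (m ^ 2 * n ^ 4 <= e)%N.
  by rewrite e1 (leq_trans _ (leq_addr _ _)) // leq_mul // leq_pexp2l.
have k3 : (m ^ 2 * n ^ 2 <= e)%N by apply: leq_trans k1; rewrite leq_mul // leq_pexp2l.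
move: h1 h2 hE S k1 k2 k3; clear.
move: (total_weight m * _)%N (m ^ 4 * _)%N (m ^ 2 * n ^ 4)%N (m ^ 2 * n ^ 2)%N ((m * n) ^ 4)%N => *; lia.
Qed.

End Bounds.

Section Asymptotics.
Variable R : realType.

(** [316 = 26 + 289 + 1] adds the errors of [two_lins_prime_quads] and [convex_count] to the
    isolated error term of the second sieve. *)
Lemma two_lins_asymptotic (m n L1 L2 : nat) : (0 < m)%N -> (0 < n)%N -> (0 < L1)%N -> (0 < L2)%N ->
  `|#|two_lins m n|%:R - 25 / (12 * pi ^+ 4) * (m * n)%:R ^+ 4 : R| <=
   (2 ^+ L2 * (3 * 2 ^+ L1 + 4) + 316) * ((m + n)%:R * (m * n)%:R ^+ 3) +
   (2 ^+ L2 * 4 / L1%:R + 4 / L2%:R) * (m * n)%:R ^+ 4.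
Proof.
move=> m0 n0 L10 L20; have := @prime_quads_sieve R m n m0 n0 L1 L2 L10 L20.
have [r0 r1] := rho_bounds R.
have [t1 t2] := @two_lins_prime_quads m n m0 n0; have [c1 c2] := @convex_count m n m0 n0.
have eR : ((m + n) * (m * n) ^ 3)%N%:R = (m + n)%:R * (m * n)%:R ^+ 3 :> R by rewrite natrM natrX.
have VR : ((m * n) ^ 4)%N%:R = (m * n)%:R ^+ 4 :> R by rewrite natrX.
have h0 : 0 <= (m + n)%:R * (m * n)%:R ^+ 3 :> R by rewrite mulr_ge0 ?exprn_ge0.
have castD1 (x y z : nat) : (2 * x <= y + 26 * z)%N -> 2 * x%:R <= y%:R + 26 * z%:R :> R.
  by rewrite -(ler_nat R) natrD !natrM.
have castD2 (x y z : nat) : (y <= 2 * x + 8 * z)%N -> y%:R <= 2 * x%:R + 8 * z%:R :> R.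
  by rewrite -(ler_nat R) natrD !natrM.
have castD3 (x y z : nat) : (216 * x <= 25 * y + 216 * (289 * z))%N ->
    216 * x%:R <= 25 * y%:R + 216 * (289 * z%:R) :> R.
  by rewrite -(ler_nat R) natrD !natrM.
have castD4 (x y z : nat) : (25 * y <= 216 * x + 216 * (289 * z))%N ->
    25 * y%:R <= 216 * x%:R + 216 * (289 * z%:R) :> R.
  by rewrite -(ler_nat R) natrD !natrM.
move: (castD1 _ _ _ t1) (castD2 _ _ _ t2) (castD3 _ _ _ c1) (castD4 _ _ _ c2).
clear t1 t2 c1 c2; rewrite eR VR.
set t : R := #|two_lins m n|%:R; set P : R := #|prime_quads m n|%:R.
set N : R := #|_|%:R; move: ((m + n)%:R * _) h0 => h h0.
move: t P N ((m * n)%:R ^+ 4) => t P N V t1 t2 c1 c2.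
have -> : 25 / (12 * pi ^+ 4) * V = (6 / pi ^+ 2) ^+ 2 * (25 / 216 * V) / 2 :> R.
  have : pi != 0 :> R by rewrite gt_eqF // pi_gt0.
  by move: (pi : R) => p pN; field.
have r2 : 0 <= (6 / pi ^+ 2) ^+ 2 :> R by rewrite exprn_ge0 // ltW.
have r3 : (6 / pi ^+ 2) ^+ 2 <= 1 :> R by rewrite exprn_ile1 // ltW.
move: (_ ^+ 2) r2 r3 => r r2 r3 H.
have NV : `|r * N - r * (25 / 216 * V)| <= 289 * h.
  rewrite -mulrBr normrM (ger0_norm r2).
  apply: le_trans (_ : 1 * (289 * h) <= _); last by rewrite mul1r.
  by apply: ler_pM => //; rewrite ler_norml; apply/andP; split; lra.
set X := 2 ^+ L2 * ((3 * 2 ^+ L1 + 4) * h + 4 * V / L1%:R) + 4 * V / L2%:R.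
have -> : (2 ^+ L2 * (3 * 2 ^+ L1 + 4) + 316) * h + (2 ^+ L2 * 4 / L1%:R + 4 / L2%:R) * V = X + 316 * h.
  by rewrite /X; ring.
have {}H : `|P - r * N| <= X + h by apply: le_trans H _; rewrite /X; lra.
move: X H NV => X; move: (r * N) (r * _) => y z.
rewrite !ler_norml => /andP[h1 h2] /andP[h3 h4]; apply/andP; split; lra.
Qed.

End Asymptotics.

Local Open Scope classical_set_scope.
Local Open Scope ring_scope.

Theorem theorem1 (R : realType) :
  (fun mn : nat * nat => (num_k_threshold R 2 mn.1 mn.2)%:R : R) =
  (fun mn : nat * nat =>
     25 / (12 * pi ^+ 4) * mn.1%:R ^+ 4 * mn.2%:R ^+ 4 : R)
  +o_ (\oo, \oo) (fun mn : nat * nat => mn.1%:R ^+ 4 * mn.2%:R ^+ 4 : R).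
Proof.
apply/eqaddoP => eps eps0.
have large (x : R) : exists k, (0 < k)%N /\ x < k%:R.
  by exists (Num.truncn x).+1; rewrite truncnS_gt.
(* The level [L2] comes first, [L1] has to beat [2 ^ L2], and the grid size [K] has to beat both.
   Each of the three errors then takes at most [eps / 3]; the 6 in the choice of [K] shares its
   third between the two summands of [m + n]. *)
have [L2 [L20 L2R]] := large (12 / eps).
pose b : R := 2 ^+ L2 * 4.
have [L1 [L10 L1R]] := large (3 * b / eps).
pose A : R := 2 ^+ L2 * (3 * 2 ^+ L1 + 4) + 316.
have [K [K0 KR]] := large (6 * A / eps).
exists ([set m | (K <= m)%N], [set n | (K <= n)%N]).
  by split; apply: nbhs_infty_ge.
move=> [m n] /= [Km Kn].
have m0 : (0 < m)%N by apply: leq_trans Km.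
have n0 : (0 < n)%N by apply: leq_trans Kn.
have mR : 0 < m%:R :> R by rewrite ltr0n.
have nR : 0 < n%:R :> R by rewrite ltr0n.
change (`|(num_k_threshold R 2 m n)%:R - 25 / (12 * pi ^+ 4) * m%:R ^+ 4 * n%:R ^+ 4 : R| <=
  eps * `|m%:R ^+ 4 * n%:R ^+ 4|).
rewrite num_two_threshold.
have V0 : 0 <= m%:R ^+ 4 * n%:R ^+ 4 :> R by rewrite mulr_ge0 ?exprn_ge0.
rewrite (ger0_norm V0) -mulrA -exprMn.
have := @two_lins_asymptotic R m n L1 L2 m0 n0 L10 L20.
rewrite natrM; set V := (m%:R * n%:R) ^+ 4 => H; apply: le_trans H _.
have VE : 0 <= V by rewrite exprn_ge0 // mulr_ge0.
rewrite -/A -/b.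
have l1 : b / L1%:R <= eps / 3.
  by rewrite ler_pdivrMr ?ltr0n //; move: (ltW L1R); rewrite ler_pdivrMr //; lra.
have l2 : 4 / L2%:R <= eps / 3.
  by rewrite ler_pdivrMr ?ltr0n //; move: (ltW L2R); rewrite ler_pdivrMr //; lra.
have l3 : A * ((m + n)%:R * (m%:R * n%:R) ^+ 3) <= eps / 3 * V.
  have A0 : 0 <= A.
    apply: addr_ge0; last exact: ler0n.
    apply: mulr_ge0; first exact: exprn_ge0.
    by apply: addr_ge0 => //; apply: mulr_ge0 => //; exact: exprn_ge0.
  have KA : 6 * A <= eps * K%:R by move: (ltW KR); rewrite ler_pdivrMr // [K%:R * _]mulrC.
  have Km' : K%:R <= m%:R :> R by rewrite ler_nat.
  have Kn' : K%:R <= n%:R :> R by rewrite ler_nat.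
  rewrite /V [_ ^+ 4]exprS mulrA [leRHS]mulrA ler_wpM2r ?exprn_ge0 ?mulr_ge0 // ?(ltW mR) ?(ltW nR) //.
  have e1 : 6 * A * n%:R <= eps * m%:R * n%:R.
    by rewrite ler_wpM2r ?(ltW nR) // (le_trans KA) // ler_wpM2l // ltW.
  have e2 : 6 * A * m%:R <= eps * n%:R * m%:R.
    by rewrite ler_wpM2r ?(ltW mR) // (le_trans KA) // ler_wpM2l // ltW.
  rewrite natrD; nra.
have l4 : (b / L1%:R + 4 / L2%:R) * V <= (eps / 3 + eps / 3) * V.
  by rewrite ler_wpM2r // lerD.
have -> : eps * V = eps / 3 * V + (eps / 3 + eps / 3) * V by field.
exact: lerD.
Qed.
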